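(* There is an algorithm which, given a temporal graph $\mathcal{G}=(G,\lambda)$ with $n$ vertices, $m$ edges and $k$ monolabel triangles, decides whether $\mathcal{G}$ is a comparability temporal graph and, if the answer is YES, constructs a TTO (temporal transitive orientation) of $\mathcal{G}$, in time $O(nm+\min\{kn,m^2\})$.
   Context: A (simple) temporal graph $\mathcal{G}=(G,\lambda)$ consists of a finite simple undirected graph $G=(V,E)$ and a function $\lambda:E\to\mathbb{N}$ (time-labels). An orientation $O$ of $\mathcal{G}$ is the choice of exactly one of $(a,b)$, $(b,a)$ for each edge $ab\in E$. An orientation $O$ is a temporal transitive orientation (TTO) if whenever $(a,b)\in O$ and $(b,c)\in O$ with $\lambda(ab)\le\lambda(bc)$, then $(a,c)\in O$ and $\lambda(ac)\ge\lambda(bc)$. A comparability temporal graph is a temporal graph that admits a TTO. A monolabel triangle is a triangle of $G$ whose three edges have the same time-label. *)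

(* Defs.v *)
From mathcomp Require Import all_boot.

Set Implicit Arguments.
Unset Strict Implicit.
Unset Printing Implicit Defensive.

(** * Temporal graphs and temporal transitive orientations *)

(** The label function is given on ordered pairs; its values on pairs that are
    not edges are irrelevant everywhere below. *)
Record temporal_graph (n : nat) := TemporalGraph {
  adj : rel 'I_n;
  label : 'I_n -> 'I_n -> nat;
  adj_sym : symmetric adj;
  adj_irr : irreflexive adj;
  label_sym : forall a b, adj a b -> label a b = label b a }.

Definition edges n (G : temporal_graph n) : {set {set 'I_n}} :=
  [set [set p.1; p.2] | p : 'I_n * 'I_n & adj G p.1 p.2].

Definition monolabel_triangles n (G : temporal_graph n) : {set {set 'I_n}} :=
  [set T | [exists a, exists b, exists c,
     [&& T == [set a; b; c], adj G a b, adj G b c, adj G a c,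
         label G a b == label G b c & label G b c == label G a c]]].

(** [O a b] means that the ordered pair (a, b) is chosen. *)
Definition orientation n (G : temporal_graph n) (O : rel 'I_n) : Prop :=
  (forall a b, O a b -> adj G a b) /\
  (forall a b, adj G a b -> O a b (+) O b a).

Definition is_TTO n (G : temporal_graph n) (O : rel 'I_n) : Prop :=
  orientation G O /\
  (forall a b c, O a b -> O b c -> label G a b <= label G b c ->
     O a c /\ label G b c <= label G a c).

Definition comparability_temporal_graph n (G : temporal_graph n) : Prop :=
  exists O : rel 'I_n, is_TTO G O.

(** * Random access machine *)

(** Structured programs for a word RAM.  A program is a finite syntax tree, hence
    uses finitely many registers; subtraction is truncated; [Fetch e] is the
    content of the memory cell whose address is [e]. *)
Inductive binop := OpAdd | OpSub | OpMul | OpLt | OpEq.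

Inductive expr :=
| Cst of nat
| Reg of nat
| Fetch of expr
| Bin of binop & expr & expr.

Inductive cmd :=
| Skip
| Assign of nat & expr          (* register := expression *)
| Store of expr & expr          (* M[address] := value *)
| Seq of cmd & cmd
| If of expr & cmd & cmd        (* a test succeeds when its value is nonzero *)
| While of expr & cmd.

Record state := State { regs : nat -> nat; memory : nat -> nat }.

Definition upd (f : nat -> nat) (i v : nat) : nat -> nat :=
  fun j => if j == i then v else f j.

Definition set_reg (s : state) i v := State (upd (regs s) i v) (memory s).
Definition set_mem (s : state) i v := State (regs s) (upd (memory s) i v).

Definition eval_binop (o : binop) (x y : nat) : nat :=
  match o with
  | OpAdd => x + y
  | OpSub => x - y
  | OpMul => x * y
  | OpLt => x < y
  | OpEq => x == y
  end.

(** [W] is the word bound (to be polynomial in the size of the graph, i.e. words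
    of logarithmic length): results of operations and addresses must not exceed
    [W], otherwise the machine is stuck.  Input data (such as time-labels) may
    exceed [W]: they can be copied and compared, but take part in arithmetic
    only when the result is at most [W]. *)
Fixpoint eval (W : nat) (s : state) (e : expr) : option nat :=
  match e with
  | Cst k => Some k
  | Reg i => Some (regs s i)
  | Fetch e1 =>
      if eval W s e1 is Some a then
        if a <= W then Some (memory s a) else None
      else None
  | Bin o e1 e2 =>
      if eval W s e1 is Some x then
        if eval W s e2 is Some y then
          let r := eval_binop o x y in if r <= W then Some r else None
        else None
      else None
  end.

Fixpoint expr_cost (e : expr) : nat :=
  match e with
  | Cst _ | Reg _ => 1
  | Fetch e1 => (expr_cost e1).+1
  | Bin _ e1 e2 => (expr_cost e1 + expr_cost e2).+1
  end.

(** [exec W c s t s']: started in [s], the program [c] halts in [s'] after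
    exactly [t] elementary steps. *)
Inductive exec (W : nat) : cmd -> state -> nat -> state -> Prop :=
| ExecSkip s : exec W Skip s 1 s
| ExecAssign s i e v :
    eval W s e = Some v ->
    exec W (Assign i e) s (expr_cost e).+1 (set_reg s i v)
| ExecStore s ea ev a v :
    eval W s ea = Some a -> a <= W -> eval W s ev = Some v ->
    exec W (Store ea ev) s (expr_cost ea + expr_cost ev).+1 (set_mem s a v)
| ExecSeq s c1 t1 s1 c2 t2 s2 :
    exec W c1 s t1 s1 -> exec W c2 s1 t2 s2 ->
    exec W (Seq c1 c2) s (t1 + t2) s2
| ExecIf s e v c1 c2 t s' :
    eval W s e = Some v -> exec W (if v != 0 then c1 else c2) s t s' ->
    exec W (If e c1 c2) s (expr_cost e + t).+1 s'
| ExecWhileStop s e c :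
    eval W s e = Some 0 -> exec W (While e c) s (expr_cost e).+1 s
| ExecWhileLoop s e v c t1 s1 t2 s2 :
    eval W s e = Some v -> v != 0 ->
    exec W c s t1 s1 -> exec W (While e c) s1 t2 s2 ->
    exec W (While e c) s (expr_cost e + t1 + t2).+1 s2.

(** The machine is deterministic, so the existence of one halting execution
    determines the running time and the output. *)
Lemma exec_det W c s t1 s1 t2 s2 :
  exec W c s t1 s1 -> exec W c s t2 s2 -> t1 = t2 /\ s1 = s2.
Proof.
move=> H; elim: H t2 s2 => {c s t1 s1}.
- by move=> s t2 s2 H; inversion H; subst.
- by move=> s i e v Hv t2 s2 H; inversion H; subst; split; congruence.
- by move=> s ea ev a v Ha _ Hv t2 s2 H; inversion H; subst; split; congruence.
- move=> s c1 t1 s1 c2 t2 s2 _ IH1 _ IH2 t s' H.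
  inversion H as [| | |? ? u1 r1 ? u2 r2 E1 E2| | |]; subst.
  by case: (IH1 _ _ E1) => ? ?; subst; case: (IH2 _ _ E2) => ? ?; subst.
- move=> s e v c1 c2 t s' Hv _ IH t2 s2 H.
  inversion H as [| | | |? ? v' ? ? u ? Hv' E| |]; subst.
  have ? : v' = v by congruence.
  by subst; case: (IH _ _ E) => -> ->.
- move=> s e c Hv t2 s2 H.
  inversion H as [| | | | | |? ? v ? ? ? ? ? Hv' nz]; subst => //.
  by move: nz; have -> : v = 0 by congruence.
- move=> s e v c t1 s1 t2 s2 Hv nz _ IH1 _ IH2 t s' H.
  inversion H as [| | | | |? ? ? Hv'|? ? ? ? u1 r1 u2 r2 ? ? E1 E2]; subst.
    by move: nz; have -> : v = 0 by congruence.
  by case: (IH1 _ _ E1) => ? ?; subst; case: (IH2 _ _ E2) => ? ?; subst.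
Qed.

(** * Input and output conventions *)

(** [es] lists every edge exactly once, in any order and with its endpoints in
    either order. *)
Definition edge_listing n (G : temporal_graph n) (es : seq ('I_n * 'I_n)) :=
  perm_eq [seq [set p.1; p.2] | p <- es] (enum (edges G)).

(** The input word is n, m, u_0, v_0, label(u_0 v_0), u_1, v_1, label(u_1 v_1),
    etc.; it is stored from address 0 on, all other cells and all registers
    being initially 0. *)
Definition input_word n (G : temporal_graph n) (es : seq ('I_n * 'I_n)) :
    seq nat :=
  n :: size es ::
  flatten [seq [:: val p.1; val p.2; label G p.1 p.2] | p <- es].

Definition initial_state n (G : temporal_graph n) (es : seq ('I_n * 'I_n)) :=
  State (fun _ => 0) (nth 0 (input_word G es)).

(** The answer is YES when the final content of cell 0 is nonzero. *)
Definition answers_yes (s : state) : bool := memory s 0 != 0.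

(** The orientation written in the final memory, as a list of [m] ordered pairs
    stored in the cells 1, ..., 2m. *)
Definition output_orientation n (m : nat) (s : state) : rel 'I_n :=
  fun a b => [exists i : 'I_m,
    (memory s (1 + 2 * i) == a) && (memory s (2 + 2 * i) == b)].

Arguments output_orientation : clear implicits.

(* Main.v *)
(** Being a temporal transitive orientation is a 2-SAT condition on the arcs,
    plus acyclicity of the monolabel triangles.  To the binary implications one
    adds those which a monolabel triangle [abc] of label [l] and a vertex [d]
    with [0 < lambda(bd) <= l < lambda(ad)], [cd] absent or of label less than
    [l], force jointly: these are the implications [ac => ab].  For this enlarged
    set there is a temporal version of Golumbic's triangle lemma: if
    [bc] implies an arc [w], then either [w] is the arc opposite to [a] in
    another monolabel triangle, whose other two sides follow those of [abc], or
    the orientation of [abc] is decided up to trivial cases.  It follows that if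
    some solution exists, every set of arcs that is closed under the implications
    and under unit propagation in the monolabel triangles, and contains no two
    opposite arcs, extends to a solution.

    Hence no backtracking is needed: the algorithm takes an undecided edge and
    propagates its two directions alternately, one (arc, vertex) pair at a time,
    until one of them closes without conflict; that one is kept.  The loser costs
    no more than the winner, so the propagations cost [O(nm)] in total, and the
    answer is NO as soon as both directions fail.  The additional implications
    are tabulated beforehand: for an arc [ac] lying in [t] monolabel triangles one
    examines either the [t n] pairs (triangle, vertex) or the [2m] arcs [bd],
    whichever is cheaper, which gives [O(nm + min(kn, m^2))]. *)

Require Import Defs.
From mathcomp Require Import all_boot.
From mathcomp Require Import zify.
From Stdlib Require Import Classical.

Set Implicit Arguments.
Unset Strict Implicit.
Unset Printing Implicit Defensive.

(** A solution need not contain the arcs [S] fixed so far, so it cannot directly certify the next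
    choice. It is used for one thing only: at an undecided edge, [x] is the direction that lies in
    the solution [T]. Two facts make this enough. First, a monolabel triangle with one arc in [S]
    becomes a pair of binary clauses, and [S] together with all arcs reachable from [x] is again
    closed under unit propagation, unless [x] reaches its own reverse ([nae_ascend]). Second, such a
    conflict never depends on [S] ([imp_conflict]): once the steps that use [S] are moved to the end
    of the path, at most two remain and they can be eliminated, so the conflict would already refute
    [T]. The configuration [cfg] is the case that a tail step leaves open in the triangle lemma,
    when the new vertex is joined to the fixed corner by an edge of larger label. On the machine,
    the cubic table is too large to be cleared within the time bound. It relies on memory being zero
    at the start, and the marks of the tentative runs are stamped by the race number instead of
    being erased. *)

Section Star.
Variables (U : Type) (R : U -> U -> Prop).
Inductive star (x : U) : U -> Prop :=
| star_refl : star x x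
| star_step y z : star x y -> R y z -> star x z.
Lemma star_trans x y z : star x y -> star y z -> star x z.
Proof. by move=> xy; elim=> // u v _ xu uv; apply: star_step uv. Qed.
Lemma star1 x y : R x y -> star x y.
Proof. by move=> xy; apply: star_step xy; apply: star_refl. Qed.
End Star.

(** * Implications between arcs *)

Section Implications.
(* [l a b] is the label plus one on edges and zero elsewhere, so that "not an
   edge, or an edge with a smaller label" is a single strict inequality. *)
Variables (V : eqType) (l : V -> V -> nat).
Hypotheses (lsym : forall a b, l a b = l b a) (lxx : forall a, l a a = 0).

Definition rv (u : V * V) := (u.2, u.1).

(** A forbidden pattern: [(x, y)] and [(y, z)] cannot both be chosen, since the temporal condition
    would then ask for [(x, z)] with a label at least that of [yz]. The rules [rhead] and [rtail]
    read this clause in its two directions. *)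
Definition fbd x y z := 0 < l x y /\ l x y <= l y z /\ l x z < l y z.
Definition mono a b c := 0 < l a b /\ l a b = l b c /\ l b c = l a c.
(* Four vertices for which the binary implications together with one monolabel
   triangle entail the further implications [ralpha] and [rbeta] below. *)
Definition cfg a b c d :=
  mono a b c /\ 0 < l b d /\ l b d <= l a b /\ l a b < l a d /\ l c d < l a b.

Ltac syms := repeat match goal with
  | _ : context [l ?a ?b] |- _ =>
      lazymatch goal with _ : l a b = l b a |- _ => fail | _ => pose proof (lsym a b) end
  | |- context [l ?a ?b] =>
      lazymatch goal with _ : l a b = l b a |- _ => fail | _ => pose proof (lsym a b) end
  end.
Ltac arith := unfold cfg, fbd, mono in *; simpl; syms; lia.

Section Rel.
Variable S : V * V -> Prop.

(* [rS1] and [rS2]: once [(b, c)] belongs to [S], acyclicity of the monolabel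
   triangle [abc] becomes a binary clause. *)
Inductive rstep : V * V -> V * V -> Prop :=
| rhead x y z : fbd x y z -> rstep (x, y) (z, y)
| rtail x y z : fbd x y z -> rstep (y, z) (y, x)
| ralpha a b c d : cfg a b c d -> rstep (b, a) (c, a)
| rbeta a b c d : cfg a b c d -> rstep (a, c) (a, b)
| rS1 a b c : mono a b c -> S (b, c) -> rstep (c, a) (b, a)
| rS2 a b c : mono a b c -> S (b, c) -> rstep (a, b) (a, c).

Definition imp := star rstep.

(** The six rules form three contrapositive pairs, which gives the skew symmetry usual for the
    implication graph of a 2-SAT instance. *)
Lemma rstep_rv u v : rstep u v -> rstep (rv v) (rv u).
Proof.
case=> [x y z|x y z|a b c d|a b c d|a b c|a b c] H.
- exact: rtail. - exact: rhead. - exact: rbeta H. - exact: ralpha H.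
- exact: rS2. - exact: rS1.
Qed.

Lemma imp_rv u v : imp u v -> imp (rv v) (rv u).
Proof.
elim=> [|y z _ IH /rstep_rv H]; first exact: star_refl.
by apply: star_trans IH; apply: star1.
Qed.
End Rel.

Definition none (u : V * V) := False.

Lemma imp_sub S u v : imp none u v -> imp S u v.
Proof.
elim=> [|y z _ IH H]; first exact: star_refl.
apply: star_step IH _; case: H => // *; try by econstructor; eauto.
Qed.

(** Only the rules independent of [S] appear in [cl_step]; the rules [rS1] and [rS2] are instances
    of unit propagation [cl_nae], as [cl_imp] shows. *)
Record closed (S : V * V -> Prop) := Closed {
  cl_cons : forall u, S u -> ~ S (rv u);
  cl_step : forall u v, S u -> rstep none u v -> S v;
  cl_nae : forall a b c, mono a b c -> S (a, b) -> S (b, c) -> S (a, c) }.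

Lemma closed_none : closed none.
Proof. by split. Qed.

Lemma cl_imp S u v : closed S -> S u -> imp S u v -> S v.
Proof.
move=> cS Su; elim=> // y z _ Sy H.
case: H Sy => [x' y' z' H|x' y' z' H|a b c d H|a b c d H|a b c H Sbc|a b c H Sbc] Sy.
- by apply: (cl_step cS Sy); apply: rhead.
- by apply: (cl_step cS Sy); apply: rtail.
- by apply: (cl_step cS Sy); apply: ralpha H.
- by apply: (cl_step cS Sy); apply: rbeta H.
- by apply: (cl_nae cS _ Sbc Sy); arith.
- by apply: (cl_nae cS _ Sy Sbc); arith.
Qed.

Lemma cl_imp_rv S u v : closed S -> S (rv v) -> imp S u v -> S (rv u).
Proof. by move=> cS Sv /imp_rv; apply: cl_imp. Qed.

Definition unset S (u : V * V) := ~ S u /\ ~ S (rv u).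

(* If [(b, c)] implies [w], then either [w] is the opposite arc of a monolabel
   triangle with the same vertex [a], or the triangle [abc] is decided. *)
Definition transport S a b c w :=
  (exists b' c', [/\ w = (b', c'), mono a b' c',
      imp S (b, a) (b', a) & imp S (a, c) (a, c')]) \/
  imp S (a, c) w \/ imp S (b, a) w \/ imp S (b, a) (c, a).

(** In each rule the edge from [a] to the vertex that is new in [w] is compared with the labels of
    the triangle. Equality tends to give another monolabel triangle at [a]; inequality gives a short
    chain of implications starting from [(a, c)] or [(b, a)]. *)
Lemma transport_step S a b c w : closed S ->
  mono a b c -> unset S (a, b) -> unset S (a, c) ->
  rstep S (b, c) w -> transport S a b c w.
Proof.
move=> cS M [nab nba] [nac nca]; move: nba nca; rewrite /rv /= => nba nca.
have P2 w' : imp S (a, c) w' -> transport S a b c w' by right; left.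
have P3 w' : imp S (b, a) w' -> transport S a b c w' by right; right; left.
have P4 w' : imp S (b, a) (c, a) -> transport S a b c w' by right; right; right.
have P1 b' c' : mono a b' c' -> imp S (b, a) (b', a) -> imp S (a, c) (a, c') ->
    transport S a b c (b', c') by left; exists b', c'.
have S1 u v w' : rstep S u v -> imp S v w' -> imp S u w'.
  by move=> H; apply: star_trans; apply: star1.
have R u : imp S u u by exact: star_refl.
move E : (b, c) => u H; move: E.
case: H => {u w}
  [x y z H [? ?]|x y z H [? ?]|a1 b1 c1 d H [? ?]|a1 b1 c1 d H [? ?]|a1 b1 c1 H Sb [? ?]|a1 b1 c1 H Sb [? ?]];
  subst.
- have [h|h] := ltnP (l a z) (l y z).
    by apply/P2/star1/rhead; arith.
  have [h1|h1] := leqP (l a z) (l a y).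
    by apply: P1 => //; [arith|apply/star1/rhead; arith].
  apply: P3; apply: (S1 _ (z, a)); first by apply: rhead; arith.
  by apply/star1/rtail; arith.
- have [h|h|h] := ltngtP (l a x) (l a y).
  + by apply/P3/star1/rtail; arith.
  (* The hypotheses of this case are exactly those of [cfg] on [a], [b], [c] and the new vertex:
     this is where the added rules originate. *)
  + by apply/P4/star1/(@ralpha _ a y z x); arith.
  + have [h1|h1] := ltnP (l x y) (l a y).
      apply: P4; apply: (S1 _ (x, a)); first by apply: rhead; arith.
      by apply/star1/rhead; arith.
    by apply: P1 => //; [arith|apply/star1/rtail; arith].
(* The added rules have to be transported in turn; this case and the next show that no further rules
   arise. *)
- have [h|h|h] := ltngtP (l a c1) (l a a1).
  + by apply/P2/star1/rhead; arith.
  + apply: P3; apply: (S1 _ (c1, a)); first by apply: rhead; arith.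
    by apply/star1/rtail; arith.
  + have [h1|h1|h1] := ltngtP (l a d) (l a a1).
    * apply: P4; apply: (S1 _ (b1, d)); first by apply: rtail; arith.
      apply: (S1 _ (a1, d)); first by apply: rhead; arith.
      by apply/star1/rtail; arith.
    * by apply: P1 => //; [arith|apply/star1/(@ralpha _ a b1 c1 d); arith].
    * by apply/P2/star1/(@ralpha _ a1 a c1 d); arith.
- have [h|h|h] := ltngtP (l a b1) (l a c1).
  + by apply/P3/star1/rtail; arith.
  + apply: P3; apply: (S1 _ (b1, a)); first by apply: rhead; arith.
    apply: (S1 _ (b1, c1)); first by apply: rtail; arith.
    apply: (S1 _ (b1, d)); first by apply: rtail; arith.
    apply: (S1 _ (a1, d)); first by apply: rhead; arith.
    by apply/star1/rtail; arith.
  + have [h1|h1|h1] := ltngtP (l a d) (l a c1).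
    * by apply/P3/star1/(@rbeta _ a1 b1 a d); arith.
    * by apply: P1 => //; [arith|apply/star1/(@rbeta _ a b1 c1 d); arith].
    * apply: P2; apply: (S1 _ (a, d)); first by apply: rtail; arith.
      apply: (S1 _ (a1, d)); first by apply: rhead; arith.
      by apply/star1/rtail; arith.
- have [h|h|h] := ltngtP (l a b1) (l a c1).
  (* With a smaller label, the arc of [S] would force an arc of the triangle, which is undecided by
     hypothesis. *)
  + case: nab; apply: (cl_step cS Sb); apply: rhead; arith.
  + apply: P3; apply: (S1 _ (b1, a)); first by apply: rhead; arith.
    by apply/star1/rtail; arith.
  + by apply: P1 => //; [arith|apply/star1/rS1 => //; arith].
- have [h|h|h] := ltngtP (l a c1) (l a b1).
  + case: nca; apply: (cl_step cS Sb); apply: rtail; arith.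
  + case: nac; apply: (cl_step cS (cl_step cS Sb (@rhead _ _ _ a _))); first by arith.
    by apply: rtail; arith.
  + by apply: P1 => //; [arith|apply/star1/rS2 => //; arith].
Qed.

Lemma mono_rot a b c : mono a b c -> mono b c a.
Proof. by move=> M; arith. Qed.

Section Propagation.
(* Along a path from [x] to an arc of a monolabel triangle, [transport_step]
   moves the triangle backwards while its third vertex stays fixed, unless it
   yields the conclusion.  In [nae_descend] this third vertex is an endpoint of
   [x], so that the triangle cannot reach [x]; in [nae_ascend] it may, and then
   the path to its other arc is followed instead. *)
Variables (S : V * V -> Prop) (x : V * V).
Hypotheses (cS : closed S) (xN : ~ S (rv x)).

Let reach u := imp S x u.
Let refuted := reach (rv x).

Lemma reach_trans u v : reach u -> imp S u v -> reach v.
Proof. exact: star_trans. Qed.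

Lemma reach_conflict u : reach u -> reach (rv u) -> refuted.
Proof. by move=> xu /imp_rv; rewrite /refuted /reach /rv /= -surjective_pairing; apply: star_trans. Qed.

Lemma reach_not_rv u : reach u -> S (rv u) -> False.
Proof. by move=> xu Su; apply: xN; apply: (cl_imp_rv cS Su xu). Qed.

Lemma nae_descend y : reach y -> forall a b c, y = (c, b) -> mono a b c ->
  reach (b, a) -> x.2 = a -> S (c, a) \/ reach (c, a) \/ refuted.
Proof.
elim=> [|v w xv IH vw] a b c E M xba x2.
  by move: x2 M; rewrite E /= => ->; rewrite /mono lxx; lia.
subst w.
have [?|nca] := classic (S (c, a)); first by left.
have xcb : reach (c, b) by apply: star_step vw.
have [Sba|nba] := classic (S (b, a)).
  by right; left; apply: reach_trans xcb _; apply: star1; apply: rS2 Sba; arith.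
have [Sab|nab] := classic (S (a, b)); first by case: (reach_not_rv xba).
have [Sac|nac] := classic (S (a, c)).
  right; right; apply: (reach_conflict xcb); apply: reach_trans xba _.
  by apply: star1; apply: rS2 Sac; arith.
(* The last step from [v] to [(c, b)] is read as its contrapositive from [(b, c)] to [rv v], so that
   transport yields a triangle one step earlier on the path. *)
have := rstep_rv vw.
case/(transport_step cS M) => //.
- move=> [b' [c' [E M' bb' cc']]]; have Ev : v = (c', b').
    by move: E; case: (v) => p q [-> ->].
  have cc := imp_rv cc'; rewrite /rv /= in cc.
  case: (IH a b' c' Ev M') => //.
  + exact: reach_trans bb'.
  + by move=> H; left; apply: (cl_imp cS H cc).
  + by case=> H; right; [left; apply: reach_trans cc|right].
- case=> [H|[H|H]].
  + by right; left; apply: reach_trans xv _; have := imp_rv H; rewrite /rv /= -surjective_pairing.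
  + by right; right; apply: (reach_conflict xv); apply: reach_trans xba H.
  + by right; left; apply: reach_trans xba H.
Qed.

Lemma nae_ascend y : reach y -> forall a b c, y = (c, b) -> mono a b c ->
  reach (a, c) -> S (a, b) \/ reach (a, b) \/ refuted.
Proof.
elim=> [|v w xv IH vw] a b c E M xac.
  apply: (nae_descend xac erefl (mono_rot M)); last by rewrite E.
  by rewrite -E; apply: star_refl.
subst w.
have [?|nab] := classic (S (a, b)); first by left.
have xcb : reach (c, b) by apply: star_step vw.
have [Sba|nba] := classic (S (b, a)).
  right; right; apply: (reach_conflict xac); apply: reach_trans xcb _.
  by apply: star1; apply: rS2 Sba; arith.
have [Sac|nac] := classic (S (a, c)).
  by right; left; apply: reach_trans xcb _; apply: star1; apply: rS1 Sac; arith.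
have [Sca|nca] := classic (S (c, a)); first by case: (reach_not_rv xac).
have := rstep_rv vw.
case/(transport_step cS M) => //.
- move=> [b' [c' [E M' bb' cc']]]; have Ev : v = (c', b').
    by move: E; case: (v) => p q [-> ->].
  have bb := imp_rv bb'; rewrite /rv /= in bb.
  case: (IH a b' c' Ev M') => //.
  + exact: reach_trans cc'.
  + by move=> H; left; apply: (cl_imp cS H bb).
  + by case=> H; right; [left; apply: reach_trans bb|right].
- case=> [H|[H|H]].
  + by right; right; apply: (reach_conflict xv); apply: reach_trans xac H.
  + by right; left; apply: reach_trans xv _; have := imp_rv H; rewrite /rv /= -surjective_pairing.
  + by right; left; apply: reach_trans xac _; have := imp_rv H.
Qed.

End Propagation.

Section Commute.
(* The steps using a triangle with one arc in [S] can be moved to the end of a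
   path of implications. *)
Variable S : V * V -> Prop.
Hypothesis cS : closed S.

Local Notation N := (imp none).

Let un (u : V * V) : unset none u.
Proof. by split. Qed.

Lemma unset_imp u v w : unset S u -> unset S w -> N u v -> N v w -> unset S v.
Proof.
move=> [_ nu] [nw _] /(@imp_sub S) uv /(@imp_sub S) vw; split=> H.
  exact: nw (cl_imp cS H vw).
exact: nu (cl_imp_rv cS H uv).
Qed.

(** Since [(b, a)] is in [S], the arc [(a, c)] implies [(b, c)]. The transported triangle keeps the
    vertex [a] and a side [(b', a)] in [S], so the plain path can be followed first, from [(a, c)]
    to [(a, c')], and the step through [S] taken last. *)
Lemma commute_tail a b c w : mono a b c -> S (b, a) -> unset S (a, c) ->
  unset S (b, c) -> N (b, c) w -> unset S w ->
  N (a, c) w \/ exists b' c', [/\ w = (b', c'), mono a b' c', S (b', a) & N (a, c) (a, c')].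
Proof.
move=> M Sba nac nbc; elim=> [|v w' bv IH vw] nw.
  by right; exists b, c; split=> //; apply: star_refl.
have nv : unset S v by apply: (unset_imp nbc nw) => //; apply: star1.
case: (IH nv) => [H|[b' [c' [E M' Sb' H]]]]; first by left; apply: star_step vw.
subst v; have [] := transport_step closed_none M' (un _) (un _) vw.
  move=> [b2 [c2 [-> M2 H1 H2]]]; right; exists b2, c2; split=> //.
    by apply: (cl_imp cS Sb'); apply: imp_sub.
  exact: star_trans H2.
case=> [H1|[H1|H1]].
- by left; apply: star_trans H1.
- by case: nw => [[]]; apply: (cl_imp cS Sb'); apply: imp_sub.
- case: nac => _ []; apply: (@cl_imp_rv S (a, c) (a, c')) => //.
    by apply: (cl_imp cS Sb'); apply: imp_sub.
  exact: imp_sub.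
Qed.

Lemma commute_head a b c w : mono a b c -> S (a, c) -> unset S (b, a) ->
  unset S (b, c) -> N (b, c) w -> unset S w ->
  N (b, a) w \/ exists b' c', [/\ w = (b', c'), mono a b' c', S (a, c') & N (b, a) (b', a)].
Proof.
move=> M Sac nba nbc; elim=> [|v w' bv IH vw] nw.
  by right; exists b, c; split=> //; apply: star_refl.
have nv : unset S v by apply: (unset_imp nbc nw) => //; apply: star1.
case: (IH nv) => [H|[b' [c' [E M' Sc' H]]]]; first by left; apply: star_step vw.
subst v; have [] := transport_step closed_none M' (un _) (un _) vw.
  move=> [b2 [c2 [-> M2 H1 H2]]]; right; exists b2, c2; split=> //.
    by apply: (cl_imp cS Sc'); apply: imp_sub.
  exact: star_trans H1.
case=> [H1|[H1|H1]].
- by case: nw => [[]]; apply: (cl_imp cS Sc'); apply: imp_sub.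
- by left; apply: star_trans H1.
- case: nba => _ []; apply: (@cl_imp_rv S (b, a) (b', a)) => //; last exact: imp_sub.
  by apply: (cl_imp cS Sc'); have := imp_rv H1; apply: imp_sub.
Qed.

Definition rot1 u v := exists a b c, [/\ u = (c, a), v = (b, a), mono a b c & S (b, c)].
Definition rot2 u v := exists a b c, [/\ u = (a, b), v = (a, c), mono a b c & S (b, c)].

Lemma rot12_rv u v : rot1 u v -> rot2 (rv v) (rv u).
Proof. by move=> [a [b [c [-> -> M H]]]]; exists a, b, c. Qed.
Lemma rot21_rv u v : rot2 u v -> rot1 (rv v) (rv u).
Proof. by move=> [a [b [c [-> -> M H]]]]; exists a, b, c. Qed.

Lemma commute1 u v w : rot1 u v -> unset S u -> unset S v -> unset S w ->
  N v w -> N u w \/ exists2 u', N u u' & rot1 u' w.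
Proof.
move=> [a [b [c [-> -> M H]]]] nu nv nw vw.
have M' : mono c b a by arith.
case: (commute_tail M' H nu nv vw nw) => [|[b' [c' [-> M2 H1 H2]]]]; first by left.
by right; exists (c, c') => //; exists c', b', c; split=> //; arith.
Qed.

Lemma commute2 u v w : rot2 u v -> unset S u -> unset S v -> unset S w ->
  N v w -> N u w \/ exists2 u', N u u' & rot2 u' w.
Proof.
move=> [a [b [c [-> -> M H]]]] nu nv nw vw.
have M' : mono b a c by arith.
case: (commute_head M' H nu nv vw nw) => [|[b' [c' [-> M2 H1 H2]]]]; first by left.
by right; exists (b', b) => //; exists b', b, c'; split=> //; arith.
Qed.

(** The four vertices span a clique with a single label: any other label on the sixth edge would
    make [S] inconsistent or decide [u]. Unit propagation then puts the composed arc into [S]. *)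
Lemma rot2_trans u v w : rot2 u v -> unset S u -> rot2 v w -> rot2 u w.
Proof.
move=> [a [b [c [-> -> M H]]]] nu [a' [b' [d [[? ?] -> M' H']]]]; subst a' b'.
exists a, b, d; have [h|h|h] := ltngtP (l b d) (l a b).
- by case: (cl_cons cS H'); apply: (cl_step cS H); apply: rhead; arith.
- case: nu => _ []; apply: (cl_step cS (cl_step cS H' (@rhead _ _ _ b _))); first by arith.
  by apply: rtail; arith.
- by split=> //; [arith|apply: (cl_nae cS _ H H'); arith].
Qed.

Lemma rot1_trans u v w : rot1 u v -> rot1 v w -> unset S w -> rot1 u w.
Proof.
move=> /rot12_rv uv /rot12_rv vw nw.
have nw' : unset S (rv w) by case: nw => ? ?; split=> //; rewrite /rv /= -surjective_pairing.
have := rot2_trans vw nw' uv => /rot21_rv; rewrite /rv /= -!surjective_pairing //.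
Qed.

Lemma rot1_rot2 u v w : rot1 u v -> unset S u -> rot2 v w ->
  exists2 z, rot2 u z & rot1 z w.
Proof.
move=> [a [b [c [-> -> M H]]]] [nu nu'] [b' [a' [q [[? ?] -> M' H']]]]; subst a' b'.
rewrite /rv /= in nu'.
have [h|h|h] := ltngtP (l c q) (l a b).
- by case: nu'; apply: (cl_step cS H'); apply: rtail; arith.
- case: nu; apply: (cl_step cS (cl_step cS H' (@rhead _ _ _ c _))); first by arith.
  by apply: rtail; arith.
- by exists (c, q); [exists c, a, q|exists q, b, c]; split=> //; arith.
Qed.

Definition normal x w := exists2 y, N x y &
  [\/ w = y, rot2 y w, rot1 y w | exists2 z, rot2 y z & rot1 z w].

Lemma rot2_imp u v : rot2 u v -> imp S u v.
Proof. by move=> [a [b [c [-> -> M H]]]]; apply/star1/rS2. Qed.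
Lemma rot1_imp u v : rot1 u v -> imp S u v.
Proof. by move=> [a [b [c [-> -> M H]]]]; apply/star1/rS1. Qed.

Lemma unset_between u v w : unset S u -> unset S w -> imp S u v -> imp S v w -> unset S v.
Proof.
move=> [_ nu] [nw _] uv vw; split=> H.
  exact: nw (cl_imp cS H vw).
exact: nu (cl_imp_rv cS H uv).
Qed.

(** A sorting argument: [commute1] and [commute2] move plain steps to the front, [rot1_rot2]
    exchanges rotations of different kinds, and rotations of the same kind merge. *)
Lemma normal_form x w : unset S x -> unset S w -> imp S x w -> normal x w.
Proof.
move=> nx nw; move=> xw; elim: xw nw => [|v w' xv IH vw] nw.
  by exists x; [apply: star_refl|apply: Or41].
have nv : unset S v by apply: (unset_between nx nw) => //; apply: star1.
have [y xy C] := IH nv.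
have ny : unset S y.
  apply: (unset_between nx nv); first exact: imp_sub.
  case: C => [->|/rot2_imp|/rot1_imp|[z /rot2_imp H1 /rot1_imp]] //; first exact: star_refl.
  exact: star_trans.
have app y' : N y y' -> N x y' by apply: star_trans.
have: N v w' \/ rot2 v w' \/ rot1 v w'.
  case: vw => [a b c H|a b c H|a b c d H|a b c d H|a b c H Sb|a b c H Sb].
  - by left; apply/star1/rhead.
  - by left; apply/star1/rtail.
  - by left; apply/star1/ralpha/H.
  - by left; apply/star1/rbeta/H.
  - by right; right; exists a, b, c.
  - by right; left; exists a, b, c.
case=> [Nvw|[R2|R1]].
- case: C => [?|H|H|[z H1 H2]].
  + by subst v; exists w'; [apply: app|apply: Or41].
  + by case: (commute2 H ny nv nw Nvw) => [?|[y' ? ?]]; [exists w'|exists y'];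
       (try exact: app); [apply: Or41|apply: Or42].
  + by case: (commute1 H ny nv nw Nvw) => [?|[y' ? ?]]; [exists w'|exists y'];
       (try exact: app); [apply: Or41|apply: Or43].
  + have nz : unset S z by apply: (unset_between ny nv (rot2_imp H1) (rot1_imp H2)).
    case: (commute1 H2 nz nv nw Nvw) => [zw|[z' zz' H3]].
      by case: (commute2 H1 ny nz nw zw) => [?|[y' ? ?]]; [exists w'|exists y'];
         (try exact: app); [apply: Or41|apply: Or42].
    have nz' : unset S z' by apply: (unset_between nz nw (imp_sub _ zz') (rot1_imp H3)).
    case: (commute2 H1 ny nz nz' zz') => [?|[y' ? ?]]; [exists z'|exists y'];
      try exact: app.
      exact: Or43.
    by apply: Or44; exists z'.
- case: C => [?|H|H|[z H1 H2]].
  + by subst v; exists y => //; apply: Or42.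
  + by exists y => //; apply: Or42; apply: rot2_trans R2.
  + by exists y => //; apply: Or44; apply: rot1_rot2 R2.
  + have nz : unset S z by apply: (unset_between ny nv (rot2_imp H1) (rot1_imp H2)).
    have [z' H3 H4] := rot1_rot2 H2 nz R2.
    by exists y => //; apply: Or44; exists z' => //; apply: rot2_trans H3.
- case: C => [?|H|H|[z H1 H2]].
  + by subst v; exists y => //; apply: Or43.
  + by exists y => //; apply: Or44; exists v.
  + by exists y => //; apply: Or43; apply: rot1_trans R1 nw.
  + by exists y => //; apply: Or44; exists z => //; apply: rot1_trans R1 nw.
Qed.

Lemma nae_none x a b c : mono a b c -> N x (c, b) -> N x (a, c) ->
  N x (a, b) \/ N x (rv x).
Proof.
move=> M xcb xac.
by have [] := nae_ascend closed_none (fun f => f) xcb erefl M xac.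
Qed.

Lemma conflict_none x u : N x u -> N x (rv u) -> N x (rv x).
Proof. exact: reach_conflict. Qed.

(** In normal form at most two rotations remain. If there is one, [nae_none] derives the third arc
    of its triangle, whose reverse is in [S], unless the conflict is already plain. If there are
    two, they are first reduced to that situation on four vertices. *)
Lemma imp_conflict x : unset S x -> imp S x (rv x) -> N x (rv x).
Proof.
move=> nx; have nx' : unset S (rv x).
  by case: nx => ? ?; split=> //; rewrite /rv /= -surjective_pairing.
case: x nx nx' => q b nx nx'; rewrite /rv /= in nx' *.
have noS u : N (q, b) u -> S (rv u) -> False.
  by move=> H Su; case: nx' => []; case; apply: (@cl_imp_rv S (q, b) u) => //; apply: imp_sub.
case/(normal_form nx nx') => y xy [E|R2|R1|[z R2 R1]].
- by rewrite -E in xy.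
- case: R2 xy => [a [p [c [-> [? ?] M H]]]] xy; subst a c.
  have M' : mono q p b by arith.
  case: (nae_none M' xy (star_refl _ _)); last by [].
  by move=> /noS; case.
- case: R1 xy => [a [p [c [-> [? ?] M H]]]] xy; subst a p.
  have M' : mono c b q by arith.
  case: (nae_none M' (star_refl _ _) xy); last by [].
  by move=> /noS; case.
have ny : unset S y.
  apply: (unset_between nx nx' (imp_sub _ xy)).
  exact: star_trans (rot2_imp R2) (rot1_imp R1).
case: R1 R2 => [q1 [b1 [c [-> [? ?] M H]]]]; subst q1 b1.
case=> [c1 [a [q1 [? [? ?] M' H']]]]; subst y c1 q1.
case: ny => nca nac; rewrite /rv /= in nac.
have [h|h|h] := ltngtP (l a b) (l c a).
- by case: nac; apply: (cl_step cS H); apply: rhead; arith.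
- apply: conflict_none xy _; apply: (@star_step _ _ _ (a, b)); last by apply: rtail; arith.
  by apply: star1; apply: rhead; arith.
(* In the remaining case [a], [b], [c], [q] form a clique with a single label; one rotation is
   commuted back through the plain path, and the triangle [q], [a], [b] gives the contradiction. *)
have nab : unset S (a, b).
  split=> Sab; last by case: nx' => [[]]; apply: (cl_nae cS _ Sab H'); arith.
  by apply: nac; apply: (cl_nae cS _ Sab H); arith.
have := imp_rv xy; rewrite /rv /= => acbq.
have M1 : mono b a c by arith.
case: (@commute_head b a c (b, q) M1 H _ _ acbq nx') => //.
- move=> /imp_rv; rewrite /rv /= => xba.
  have M2 : mono q a b by arith.
  case: (nae_none M2 xba (star_refl _ _)) => //.
  by move=> /noS; case.
- move=> [b' [c' [[? ?] M2 _ _]]]; subst b'.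
  by move: M2; rewrite /mono lxx; lia.
Qed.

End Commute.

(** * Extending a closed set under the guidance of a solution *)

Variable T : V * V -> Prop.
Hypotheses (cT : closed T) (totT : forall a b, 0 < l a b -> T (a, b) \/ T (b, a)).

Definition extend (S : V * V -> Prop) x u := S u \/ imp S x u.

(* [T] only serves to choose the direction of the next arc. *)
Lemma closed_extend S x : closed S -> unset S x -> T x -> closed (extend S x).
Proof.
move=> cS nx Tx.
have xN : ~ imp S x (rv x).
  move=> /(imp_conflict cS nx) H; apply: (cl_cons cT Tx).
  by apply: (cl_imp cT Tx); apply: imp_sub.
have noS u : imp S x u -> S (rv u) -> False.
  by move=> xu Su; case: nx => _; apply; apply: (cl_imp_rv cS Su).
have imp1 u v : imp S x u -> rstep S u v -> extend S x v.
  by move=> xu uv; right; apply: star_step uv.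
split.
- move=> u [Su|xu] [Su'|xu'].
  + exact: cl_cons Su Su'.
  + by apply: (noS _ xu'); rewrite /rv /= -surjective_pairing.
  + exact: noS xu Su'.
  + exact: xN (reach_conflict xu xu').
- move=> u v [Su|xu] uv; first by left; apply: cl_step uv.
  by apply: (imp1 u) => //; case: uv => // *; by econstructor; eauto.
- move=> a b c M [Sab|xab] [Sbc|xbc].
  + by left; apply: cl_nae M Sab Sbc.
  + by apply: (imp1 (b, c)) => //; apply: rS1 => //; arith.
  + by apply: (imp1 (a, b)) => //; apply: rS2.
  + have M' : mono a c b by arith.
    case: (nae_ascend cS (proj2 nx) xbc erefl M' xab) => [|[|/xN]] //; by [left|right].
Qed.

Lemma extend_all S (es : seq (V * V)) : closed S ->
  (forall u, u \in es -> 0 < l u.1 u.2) ->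
  exists S', [/\ closed S', forall u, S u -> S' u &
    forall u, u \in es -> S' u \/ S' (rv u)].
Proof.
move=> cS; elim: es => [|u es IH] Hes; first by exists S.
have [|S1 [cS1 sub1 tot1]] := IH; first by move=> v ves; apply: Hes; rewrite in_cons ves orbT.
have [Su|nu] := classic (S1 u \/ S1 (rv u)).
  by exists S1; split=> // v; rewrite in_cons => /orP [/eqP -> //|/tot1].
have nuu : unset S1 u by split=> H; apply: nu; [left|right].
have nru : unset S1 (rv u).
  by case: nuu => ? ?; split=> //; rewrite /rv /= -surjective_pairing.
have: T u \/ T (rv u).
  by have := totT (Hes u (mem_head _ _)); rewrite -surjective_pairing.
have ext x : unset S1 x -> T x -> (x = u \/ x = rv u) ->
    exists S', [/\ closed S', forall u, S u -> S' u &
      forall v, v \in u :: es -> S' v \/ S' (rv v)].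
  move=> nx Tx xu; exists (extend S1 x); split.
  - exact: closed_extend.
  - by move=> v /sub1 ?; left.
  - move=> v; rewrite in_cons => /orP [/eqP ->|/tot1 [?|?]]; last 2 first.
    + by left; left.
    + by right; left.
    by case: xu => <-; [left|right]; right; apply: star_refl.
case=> Tu; first by apply: (ext u) => //; left.
by apply: (ext (rv u)) => //; right.
Qed.

(** * Temporal transitive orientations as total closed sets *)

Record tto (O : V * V -> Prop) := Tto {
  tto_edge : forall a b, O (a, b) -> 0 < l a b;
  tto_total : forall a b, 0 < l a b -> O (a, b) \/ O (b, a);
  tto_anti : forall u, O u -> ~ O (rv u);
  tto_trans : forall a b c, O (a, b) -> O (b, c) -> l a b <= l b c ->
    O (a, c) /\ l b c <= l a c }.

Lemma fbd_pos x y z : fbd x y z -> 0 < l x y /\ 0 < l y z.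
Proof. by rewrite /fbd; lia. Qed.

(** The rule [ralpha] comes for free: forbidden patterns lead from [(b, a)] through [(d, a)] and
    [(d, b)] to [(c, b)], and unit propagation ends the chain. Unit propagation does not supply
    contrapositives, so [rbeta] stays as a hypothesis; this is why the program tabulates only
    [rbeta]. *)
Lemma closed_of (S : V * V -> Prop) :
  (forall u, S u -> ~ S (rv u)) ->
  (forall x y z, fbd x y z -> S (x, y) -> S (z, y)) ->
  (forall x y z, fbd x y z -> S (y, z) -> S (y, x)) ->
  (forall a b c d, cfg a b c d -> S (a, c) -> S (a, b)) ->
  (forall a b c, mono a b c -> S (a, b) -> S (b, c) -> S (a, c)) -> closed S.
Proof.
move=> Hc Hh Ht Hb Hn; split=> // u v Su H.
case: H Su => [x y z F|x y z F|a b c d F|a b c d F|a b c M []|a b c M []].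
- exact: Hh.
- exact: Ht.
- move=> Sba.
  have Sda : S (d, a) by apply: Hh Sba; arith.
  have Sdb : S (d, b) by apply: Ht Sda; arith.
  have Scb : S (c, b) by apply: Hh Sdb; arith.
  by apply: Hn Scb Sba; arith.
- exact: Hb F.
Qed.

Lemma tto_closed O : tto O -> closed O.
Proof.
move=> [Oe Ot Oa Otr].
have Hh x y z : fbd x y z -> O (x, y) -> O (z, y).
  move=> F xy; have [_ p] := fbd_pos F; case: (Ot _ _ p) => // yz.
  by have [] := Otr _ _ _ xy yz; arith.
have Ht x y z : fbd x y z -> O (y, z) -> O (y, x).
  move=> F yz; have [p _] := fbd_pos F; case: (Ot _ _ p) => // xy.
  by have [] := Otr _ _ _ xy yz; arith.
have Hn a b c : mono a b c -> O (a, b) -> O (b, c) -> O (a, c).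
  by move=> M ab bc; case: (Otr _ _ _ ab bc) => //; arith.
apply: closed_of => // a b c d F ac.
have [|//|ba] := Ot a b; first by arith.
have da : O (d, a) by apply: Hh ba; arith.
have db : O (d, b) by apply: Ht da; arith.
have cb : O (c, b) by apply: Hh db; arith.
by case: (Oa _ ac); apply: Hn cb ba; arith.
Qed.

(** The arc [(a, c)] comes from the forbidden pattern [b], [c], [a], except when all three labels
    agree; only then does unit propagation intervene. *)
Lemma closed_tto S : closed S -> (forall a b, S (a, b) -> 0 < l a b) ->
  (forall a b, 0 < l a b -> S (a, b) \/ S (b, a)) -> tto S.
Proof.
move=> cS Se St; split=> //; first exact: cl_cons.
move=> a b c ab bc le.
have pab := Se _ _ ab; have pbc := Se _ _ bc.
have [lt|ge] := ltnP (l a c) (l b c).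
  case: (cl_cons cS bc); apply: (cl_step cS ab); apply: rhead; arith.
split=> //; have [lt|eq] : l b c < l a c \/ l b c = l a c by lia.
  by apply: (cl_step cS bc); apply: rhead; arith.
have [lt'|eq'] : l a b < l b c \/ l a b = l b c by lia.
  by apply: (cl_step cS bc); apply: rhead; arith.
by apply: (cl_nae cS _ ab bc); arith.
Qed.
End Implications.

(** * Propagation of one arc *)

Section Run.
Variables (n : nat) (l : nat -> nat -> nat).
Hypotheses (lsym : forall a b, l a b = l b a) (lxx : forall a, l a a = 0).
Hypothesis lbound : forall a b, 0 < l a b -> a < n.

Variable sg : nat -> nat -> bool.
Let S (u : nat * nat) := sg u.1 u.2 : Prop.
Hypothesis cS : closed l S.

Variable x0 : nat * nat.

Definition fbdb x y z := [&& 0 < l x y, l x y <= l y z & l x z < l y z].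
Definition monob a b c := [&& 0 < l a b, l a b == l b c & l b c == l a c].
Definition cfgb a b c d :=
  [&& monob a b c, 0 < l b d, l b d <= l a b, l a b < l a d & l c d < l a b].

Lemma fbdP x y z : reflect (fbd l x y z) (fbdb x y z).
Proof. by apply: (iffP idP); rewrite /fbdb /fbd => H; lia. Qed.
Lemma monoP a b c : reflect (mono l a b c) (monob a b c).
Proof. by apply: (iffP idP); rewrite /monob /mono => H; lia. Qed.
Lemma cfgP a b c d : reflect (cfg l a b c d) (cfgb a b c d).
Proof. by apply: (iffP idP); rewrite /cfgb /monob /cfg /mono => H; lia. Qed.

Lemma monob_rot a b c : monob a b c -> monob b c a.
Proof. by move=> /monoP M; apply/monoP; apply: mono_rot. Qed.

Implicit Type q : seq (nat * nat).

Definition known q a b := sg a b || ((a, b) \in q).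

(* [st] is a queue of arcs together with a failure flag. *)
Definition force (st : seq (nat * nat) * bool) a b :=
  if known st.1 b a then (st.1, true)
  else if known st.1 a b then st else (rcons st.1 (a, b), st.2).

(* The vertices [z] for which [rbeta] derives [(x, z)] from [(x, y)]. *)
Definition beta_tab x y z := [exists d : 'I_n, cfgb x z y d].

Definition step_in q x y z := fbdb x y z || monob x y z && known q z x.
Definition step_out q x y z :=
  [|| fbdb z x y, monob x y z && known q y z | beta_tab x y z].

(* The run examines the triangles formed by the [h]-th arc of its queue and the
   vertex [w]. *)
Definition advance q h w :=
  let: (x, y) := nth (0, 0) q h in
  let st := if step_in q x y w then force (q, false) w y else (q, false) in
  if step_out st.1 x y w then force st x w else st.

(** Stated through all closed extensions of [sg] that contain [x0], so that the failure of a run is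
    a semantic refutation, independent of the path of implications that led to it. *)
Definition forced u := forall S', closed l S' -> (forall v, S v -> S' v) -> S' x0 -> S' u.
Definition refuted := forall S', closed l S' -> (forall v, S v -> S' v) -> ~ S' x0.

Definition handled q h w (u : nat * nat) z :=
  (u \in q) && ((index u q < h) || (index u q == h) && (z < w)).

Definition wf q := [/\ uniq q, x0 \in q &
  forall u, u \in q -> [/\ 0 < l u.1 u.2, forced u, ~~ sg u.1 u.2, ~~ sg u.2 u.1 &
                           (u.2, u.1) \notin q]].

(** A triangle rule with both arcs in the queue is demanded only after both (arc, vertex) pairs have
    been handled. It is thus enough that the later of the two fires it. *)
Definition saturated q h w := forall x y z, handled q h w (x, y) z ->
  [/\ fbdb x y z -> known q z y, fbdb z x y -> known q x z,
      beta_tab x y z -> known q x z,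
      monob x y z -> sg y z || handled q h w (y, z) x -> known q x z
    & monob x y z -> sg z x || handled q h w (z, x) y -> known q z y].

Lemma force_wf q (d : bool) a b : wf q -> 0 < l a b -> forced (a, b) -> (d -> refuted) ->
  let st := force (q, d) a b in
  [/\ wf st.1, st.2 -> refuted, d -> st.2, prefix q st.1 & ~~ st.2 -> known st.1 a b].
Proof.
move=> [uq xq Hq] pab fab dr; rewrite /force /=.
have [kba|kba] := boolP (known q b a); first split=> //=.
  - move=> _ S' cS' sub Sx; have Sab := fab S' cS' sub Sx.
    apply: (cl_cons cS' Sab); rewrite /rv /=.
    by case/orP: kba => [/(sub (b, a))//|/Hq [_ fba _ _ _]]; exact: fba.
  - exact: prefix_refl.
have [kab|kab] := boolP (known q a b); first by split=> //=; apply: prefix_refl.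
split=> //=.
- split=> //; rewrite ?rcons_uniq ?mem_rcons ?in_cons ?xq ?orbT ?uq ?andbT //.
    by apply: contra kab => H; rewrite /known H orbT.
  move=> u; rewrite mem_rcons in_cons => /orP [/eqP ->|uq']; last first.
    have [? ? ? ? nu] := Hq u uq'; split=> //.
    rewrite mem_rcons in_cons negb_or nu andbT.
    apply: contra kba => /eqP [<- <-]; rewrite /known -surjective_pairing uq' orbT //.
  move: kba kab; rewrite /known !negb_or => /andP [? ?] /andP [? ?]; split=> //=.
  rewrite mem_rcons in_cons negb_or; apply/andP; split=> //.
  by apply/eqP => -[E _]; move: pab; rewrite E lxx.
- exact: prefix_rcons.
- by move=> _; rewrite /known mem_rcons mem_head orbT.
Qed.

Definition run_inv q h w (d : bool) :=
  [/\ wf q, h <= size q, w < n & if d then refuted else saturated q h w].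

Definition next_h h w := if w.+1 == n then h.+1 else h.
Definition next_w w := if w.+1 == n then 0 else w.+1.

Lemma known_forced q a b S' : wf q -> closed l S' -> (forall v, S v -> S' v) ->
  S' x0 -> known q a b -> S' (a, b).
Proof.
move=> [_ _ Hq] cS' sub Sx /orP [/(sub (a, b))//|/Hq [_ f _ _ _]]; exact: f.
Qed.

Lemma prefix_known q q' a b : prefix q q' -> known q a b -> known q' a b.
Proof.
move=> /prefixP [r ->] /orP [s|s]; apply/orP; [by left|right].
by rewrite mem_cat s.
Qed.

Lemma handled_next q q' h w u z : prefix q q' -> h < size q -> z < n -> uniq q ->
  handled q' (next_h h w) (next_w w) u z ->
  handled q h w u z \/ u = nth (0, 0) q h /\ z = w.
Proof.
move=> /prefixP [r ->] hq zn uq; rewrite /handled mem_cat index_cat.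
have [uin|uin] /= := boolP (u \in q); last first.
  by rewrite /next_h /next_w; case: ifP => _ /andP [_]; lia.
rewrite /next_h /next_w; case: eqP => [e|e] H.
  have [e'|?] := eqVneq (index u q) h; last by left; lia.
  have [?|?] := ltnP z w; first by left; lia.
  by right; split; [rewrite -e' nth_index|lia].
have [?|?] := ltnP (index u q) h; first by left; lia.
have [?|?] := ltnP z w; first by left; lia.
have e' : index u q = h by lia.
by right; split; [rewrite -e' nth_index|lia].
Qed.

Lemma betaP a c b : reflect (exists e, cfg l a b c e) (beta_tab a c b).
Proof.
apply: (iffP existsP) => [[d /cfgP H]|[d H]]; first by exists (nat_of_ord d).
have dn : d < n by apply: (@lbound d b); move: H; rewrite /cfg lsym; lia.
by exists (Ordinal dn); apply/cfgP.
Qed.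

(** For arcs before position [h], [handled] sets no bound on the vertex; vertices outside the graph
    are harmless because they meet no edge. *)
Lemma rules_bounded a b c : n <= c -> [/\ fbdb a b c = false, fbdb c a b = false,
  beta_tab a b c = false & monob a b c = false].
Proof.
move=> nc; have l0 u : ~ 0 < l c u by move/lbound; rewrite ltnNge nc.
have l0' u : ~ 0 < l u c by rewrite lsym.
split; [apply/fbdP|apply/fbdP|apply/betaP|apply/monoP].
- by move/fbd_pos => [_ /l0'].
- by move/fbd_pos => [/l0].
- by case=> d [[/l0']].
- by case=> p [e _]; move: p; rewrite e => /l0'.
Qed.

Lemma advance_inv q h w : run_inv q h w false -> h < size q ->
  let st := advance q h w in
  run_inv st.1 (next_h h w) (next_w w) st.2 /\ prefix q st.1.
Proof.
move=> [wfq _ wn sat] hq; rewrite /advance.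
have uin := mem_nth (0, 0) hq.
case E: (nth (0, 0) q h) => [x y]; rewrite E in uin.
have [pxy fxy _ _ _] := (let: And3 _ _ H := wfq in H) _ uin; rewrite /= in pxy.
set st1 := if step_in _ _ _ _ then _ else _.
have [wf1 r1 p1 k1] : [/\ wf st1.1, st1.2 -> refuted, prefix q st1.1 &
    step_in q x y w -> ~~ st1.2 -> known st1.1 w y].
  rewrite /st1; case: ifP => H; last by split=> //; exact: prefix_refl.
  have [||//|?? _ ? ?] := @force_wf q false w y wfq; try by split.
    by case/orP: H => [/fbdP|/andP [/monoP]]; rewrite /fbd /mono (lsym w y); lia.
  move=> S' cS' sub Sx; have Sxy := fxy S' cS' sub Sx.
  case/orP: H => [/fbdP F|/andP [/monoP M /(known_forced wfq cS' sub Sx) Sw]].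
    by apply: (cl_step cS' Sxy); apply: rhead.
  by apply: (cl_nae cS' _ Sw Sxy); exact: mono_rot (mono_rot lsym M).
set st := if step_out _ _ _ _ then _ else _.
have [wf2 r2 d2 p2 k2] : [/\ wf st.1, st.2 -> refuted, st1.2 -> st.2,
    prefix st1.1 st.1 & step_out st1.1 x y w -> ~~ st.2 -> known st.1 x w].
  rewrite /st; case: ifP => H; last by split=> //; exact: prefix_refl.
  have -> : st1 = (st1.1, st1.2) by case: (st1).
  have [||//|????] := @force_wf st1.1 st1.2 x w wf1; try by split.
    case/or3P: H => [/fbdP|/andP [/monoP]|/betaP [d]].
    - by rewrite /fbd (lsym x w); lia.
    - by rewrite /mono; lia.
    - by rewrite /cfg /mono; lia.
  move=> S' cS' sub Sx; have Sxy := fxy S' cS' sub Sx.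
  case/or3P: H => [/fbdP F|/andP [/monoP M /(known_forced wf1 cS' sub Sx) Sw]|/betaP [d C]].
  - by apply: (cl_step cS' Sxy); apply: rtail.
  - exact: (cl_nae cS' M Sxy Sw).
  - by apply: (cl_step cS' Sxy); apply: rbeta C.
have pq : prefix q st.1 by apply: prefix_trans p2.
have [r Er] := prefixP pq.
split=> //; split=> //.
- rewrite Er size_cat (leq_trans _ (leq_addr _ _)) // /next_h.
  by case: ifP => // _; exact: ltnW.
- rewrite /next_w; case: eqP => [_|/eqP ne]; first exact: leq_ltn_trans wn.
  by rewrite ltn_neqAle ne.
case Es : st.2; first exact: r2.
have ns : ~~ st.2 by rewrite Es.
have ns1 : ~~ st1.2 by apply: contra ns.
have {}k1 (H : step_in q x y w) : known st.1 w y by apply: (prefix_known p2); apply: k1.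
have uq : uniq q by case: wfq.
have pk := prefix_known pq.
have dn u z : z < n -> _ := @handled_next q st.1 h w u z pq hq ^~ uq.
have doneq u z : handled q h w u z -> u \in q by case/andP.
have ln a b : 0 < l a b -> b < n by rewrite lsym; apply: lbound.
have old a b c : handled q h w (a, b) c -> c < n ->
  [/\ fbdb a b c -> known st.1 c b, fbdb c a b -> known st.1 a c,
      beta_tab a b c -> known st.1 a c,
      monob a b c -> sg b c || handled st.1 (next_h h w) (next_w w) (b, c) a -> known st.1 a c
    & monob a b c -> sg c a || handled st.1 (next_h h w) (next_w w) (c, a) b -> known st.1 c b].
  move=> D cn; have [h1 h2 h3 h4 h5] := sat _ _ _ D.
  have ab : known q a b by rewrite /known (doneq _ _ D) orbT.
  split=> [/h1|/h2|/h3||]; try exact: pk.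
  - move=> M; have an : a < n by move/monoP: M => [/lbound].
    case/orP=> [s|]; first by apply/pk/h4; rewrite ?s.
    case/dn=> // [D'|[]]; first by apply/pk/h4; rewrite ?D' ?orbT.
    (* The partner arc is the one examined in this very step, with vertex [a], so the triangle fires
       now. *)
    rewrite E => -[? ?] ?; subst; apply: k1; rewrite /step_in; apply/orP; right.
    by rewrite ab andbT monob_rot.
  - move=> M; have bn : b < n by move/monoP: M => [/ln].
    case/orP=> [s|]; first by apply/pk/h5; rewrite ?s.
    case/dn=> // [D'|[]]; first by apply/pk/h5; rewrite ?D' ?orbT.
    rewrite E => -[? ?] ?; subst; apply: k2 => //; rewrite /step_out.
    rewrite (prefix_known p1 ab) andbT; apply/or3P/Or32.
    by do 2!apply: monob_rot.
move=> a b c D; have [cn|cn] := boolP (c < n); last first.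
  by rewrite -leqNgt in cn; have [-> -> -> ->] := rules_bounded a b cn.
case/dn: (D) => // [D'|]; first exact: old.
rewrite E => -[[? ?] ?]; subst a b c; split.
- by move=> F; apply: k1; rewrite /step_in F.
- by move=> F; apply: k2 => //; rewrite /step_out F.
- by move=> F; apply: k2 => //; rewrite /step_out F !orbT.
- move=> M H; apply: k2 => //; rewrite /step_out M /=; apply/or3P/Or32.
  have xn : x < n by move/monoP: M => [/lbound].
  case/orP: H => [s|/dn]; first by rewrite /known s.
  case=> // [/doneq H|[H _]]; apply: (prefix_known p1); first by rewrite /known H orbT.
  by rewrite /known H E uin orbT.
- move=> M H; apply: k1; rewrite /step_in M /=; apply/orP; right.
  have yn : y < n by apply: ln pxy.
  case/orP: H => [s|/dn]; first by rewrite /known s.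
  case=> // [/doneq H|[H _]]; first by rewrite /known H orbT.
  by rewrite /known H E uin orbT.
Qed.

Lemma run_closed q w : run_inv q (size q) w false ->
  closed l (fun u => known q u.1 u.2).
Proof.
move=> [[uq _ Hq] _ _ sat].
have dn u z : u \in q -> handled q (size q) w u z.
  by move=> uin; rewrite /handled uin index_mem uin.
apply: closed_of => //.
- move=> u /orP [su|uin] /orP [su'|uin'].
  + exact: (cl_cons cS su).
  + by have [_ _ _ /negP] := Hq _ uin'; rewrite /rv /=.
  + by have [_ _ _ /negP] := Hq (u.1, u.2) uin.
  + by have [_ _ _ _ /negP] := Hq (u.1, u.2) uin.
- move=> x y z F /orP [s|uin].
    by have := cl_step cS (u:=(x, y)) s (rhead _ F); rewrite /S /known /= => ->.
  by have [h _ _ _ _] := sat _ _ _ (dn _ z uin); apply/h/fbdP.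
- move=> x y z F /orP [s|uin].
    by have := cl_step cS (u:=(y, z)) s (rtail _ F); rewrite /S /known /= => ->.
  by have [_ h _ _ _] := sat _ _ _ (dn _ x uin); apply/h/fbdP.
- move=> a b c d F /orP [s|uin].
    by have := cl_step cS (u:=(a, c)) s (rbeta _ F); rewrite /S /known /= => ->.
  by have [_ _ h _ _] := sat _ _ _ (dn _ b uin); apply/h/betaP; exists d.
- move=> a b c M /orP [s|uin] /orP [s'|uin'].
  + by have := cl_nae cS M s s'; rewrite /S /known /= => ->.
  + have [_ _ _ _ h] := sat _ _ _ (dn _ a uin'); apply: h.
      by apply/monoP; exact: mono_rot.
    by rewrite s.
  + by have [_ _ _ h _] := sat _ _ _ (dn _ c uin); apply: h; [apply/monoP|rewrite s'].
  + by have [_ _ _ h _] := sat _ _ _ (dn _ c uin); apply: h;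
      [apply/monoP|rewrite (dn _ a uin') orbT].
Qed.

Lemma run_init : 0 < n -> 0 < l x0.1 x0.2 -> ~~ sg x0.1 x0.2 -> ~~ sg x0.2 x0.1 ->
  run_inv [:: x0] 0 0 false.
Proof.
move=> n0 p s s'; split=> //.
  split=> //; first exact: mem_head.
  move=> u; rewrite inE => /eqP ->; split=> //.
  by rewrite inE; apply/eqP; case: x0 p => a b /= p [E _]; move: p; rewrite E lxx.
by move=> x y z; rewrite /handled !ltn0 !andbF.
Qed.
End Run.

(** This justifies answering NO although earlier arcs were fixed greedily: by [extend_all], any
    solution, even one that disagrees with [sg], would yield a closed extension through one of the
    two directions. *)
Lemma refuted_both n (l : nat -> nat -> nat) (sg : nat -> nat -> bool) x O :
  (forall a b, l a b = l b a) -> (forall a, l a a = 0) ->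
  (forall a b, 0 < l a b -> a < n) ->
  closed l (fun u => sg u.1 u.2) -> 0 < l x.1 x.2 ->
  refuted l sg x -> refuted l sg (x.2, x.1) -> ~ tto l O.
Proof.
move=> lsym lxx _ cS p r1 r2 tO.
have [//|S' [cS' sub tot]] := @extend_all _ _ lsym lxx O (tto_closed lsym tO)
  (tto_total tO) (fun u => sg u.1 u.2) [:: x] cS.
  by move=> u; rewrite inE => /eqP ->.
case: (tot x (mem_head _ _)) => H.
- exact: (r1 S').
- exact: (r2 S').
Qed.

(** * Running time of programs *)

Section Hoare.
Variable W : nat.

Definition wp c s (Q : nat -> state -> Prop) :=
  exists t s', exec W c s t s' /\ Q t s'.

(** Symbolic execution of loop-free code. Its time is bounded once and for all by [ccost], which
    charges both branches of a test, so postconditions need not mention time. *)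
Fixpoint run c s (Q : state -> Prop) : Prop :=
  match c with
  | Skip => Q s
  | Assign i e => exists2 v, eval W s e = Some v & Q (set_reg s i v)
  | Store ea ev => exists a v,
      [/\ eval W s ea = Some a, a <= W, eval W s ev = Some v & Q (set_mem s a v)]
  | Seq c1 c2 => run c1 s (fun s1 => run c2 s1 Q)
  | If e c1 c2 => exists2 v, eval W s e = Some v &
      if v != 0 then run c1 s Q else run c2 s Q
  | While _ _ => False
  end.

Fixpoint ccost c : nat :=
  match c with
  | Skip => 1
  | Assign _ e => (expr_cost e).+1
  | Store ea ev => (expr_cost ea + expr_cost ev).+1
  | Seq c1 c2 => ccost c1 + ccost c2
  | If e c1 c2 => (expr_cost e + (ccost c1 + ccost c2)).+1
  | While _ _ => 0
  end.

Lemma wp_run c s Q : run c s Q -> wp c s (fun t s' => t <= ccost c /\ Q s').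
Proof.
elim: c s Q => [|i e|ea ev|c1 IH1 c2 IH2|e c1 IH1 c2 IH2|//] s Q /=.
- by move=> H; exists 1, s; split=> //; constructor.
- by move=> [v ev H]; exists (expr_cost e).+1, (set_reg s i v); split=> //; constructor.
- move=> [a [v [Ha aW Hv H]]].
  by exists (expr_cost ea + expr_cost ev).+1, (set_mem s a v); split=> //; constructor.
- move=> /IH1 [t1 [s1 [E1 [b1 /IH2 [t2 [s2 [E2 [b2 H]]]]]]]].
  by exists (t1 + t2), s2; split; [econstructor; eauto|split=> //; lia].
- move=> [v Hv]; case: ifP => nz.
    move=> /IH1 [t1 [s1 [E1 [b1 H]]]]; exists (expr_cost e + t1).+1, s1.
    by split; [econstructor; eauto; rewrite nz|split=> //; lia].
  move=> /IH2 [t1 [s1 [E1 [b1 H]]]]; exists (expr_cost e + t1).+1, s1.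
  by split; [econstructor; eauto; rewrite nz|split=> //; lia].
Qed.

Lemma run_seq c1 c2 s Q : run c1 s (fun s1 => run c2 s1 Q) -> run (Seq c1 c2) s Q.
Proof. by []. Qed.
Lemma run_assign v i e s (Q : state -> Prop) :
  eval W s e = Some v -> Q (set_reg s i v) -> run (Assign i e) s Q.
Proof. by move=> H HQ; exists v. Qed.
Lemma run_skip s (Q : state -> Prop) : Q s -> run Skip s Q.
Proof. by []. Qed.
Lemma run_if (b : bool) e c1 c2 s Q : eval W s e = Some (b : nat) ->
  (b -> run c1 s Q) -> (~~ b -> run c2 s Q) -> run (If e c1 c2) s Q.
Proof. by move=> He H1 H2; exists (b : nat) => //; case: b H1 H2 {He} => H1 H2; [apply: H1|apply: H2]. Qed.
Lemma run_conseq c s (Q Q' : state -> Prop) :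
  run c s Q -> (forall s', Q s' -> Q' s') -> run c s Q'.
Proof.
elim: c s Q Q' => [|i e|ea ev|c1 IH1 c2 IH2|e c1 IH1 c2 IH2|//] s Q Q' /= H QQ.
- exact: QQ.
- by case: H => v ? ?; exists v => //; apply: QQ.
- by case: H => a [v [? ? ? ?]]; exists a, v; split=> //; apply: QQ.
- by apply: IH1 H _ => s' H; apply: IH2 H _.
- by case: H => v ?; case: ifP => nz H; exists v; rewrite ?nz //; [apply: IH1 H _|apply: IH2 H _].
Qed.

Lemma wp_conseq c s (Q Q' : nat -> state -> Prop) :
  wp c s Q -> (forall t s', Q t s' -> Q' t s') -> wp c s Q'.
Proof. by move=> [t [s' [E H]]] QQ; exists t, s'; split=> //; apply: QQ. Qed.

Lemma wp_seq c1 c2 s Q :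
  wp c1 s (fun t1 s1 => wp c2 s1 (fun t2 s2 => Q (t1 + t2) s2)) -> wp (Seq c1 c2) s Q.
Proof.
move=> [t1 [s1 [E1 [t2 [s2 [E2 H]]]]]].
by exists (t1 + t2), s2; split=> //; econstructor; eauto.
Qed.

Lemma wp_if e (b : bool) c1 c2 s Q : eval W s e = Some (b : nat) ->
  (b -> wp c1 s (fun t => Q (expr_cost e + t).+1)) ->
  (~~ b -> wp c2 s (fun t => Q (expr_cost e + t).+1)) -> wp (If e c1 c2) s Q.
Proof.
move=> He H1 H2.
have [t [s' [E H]]] : wp (if (b : nat) != 0 then c1 else c2) s (fun t => Q (expr_cost e + t).+1).
  by case: b H1 H2 {He} => H1 H2; [apply: H1|apply: H2].
by exists (expr_cost e + t).+1, s'; split=> //; econstructor; eauto.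
Qed.

(* [I f t s]: [f] is the remaining fuel and [t] the time already spent. *)
Lemma wp_while e c (I : nat -> nat -> state -> Prop) (Q : nat -> state -> Prop) :
  (forall f t s, I f t s -> exists2 b : bool, eval W s e = Some (b : nat) &
     if b then wp c s (fun t' s' => exists2 f', f' < f &
                         I f' (t + (expr_cost e + t').+1) s')
     else Q (t + (expr_cost e).+1) s) ->
  forall f s, I f 0 s -> wp (While e c) s Q.
Proof.
move=> step f s; suff gen t : I f t s -> wp (While e c) s (fun t' => Q (t + t')) by apply: gen.
elim/ltn_ind: f t s => f IH t s /step [[] He].
  move=> [t1 [s1 [E1 [f' ff' /(IH _ ff') [t2 [s2 [E2 H]]]]]]].
  exists (expr_cost e + t1 + t2).+1, s2; split; first by econstructor; eauto.
  by have -> : t + (expr_cost e + t1 + t2).+1 = t + (expr_cost e + t1).+1 + t2 by lia.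
by move=> H; exists (expr_cost e).+1, s; split=> //; constructor.
Qed.

(** * Boolean expressions and counted loops *)

Definition ltE := Bin OpLt.
Definition eqE := Bin OpEq.
Definition addE := Bin OpAdd.
Definition mulE := Bin OpMul.
(** Both factors are always evaluated, so the second must be defined even when the first test
    fails. *)
Definition andE := Bin OpMul.
Definition notE e := Bin OpSub (Cst 1) e.
Definition orE e1 e2 := notE (andE (notE e1) (notE e2)).

Definition For i b body := Seq (Assign i (Cst 0))
  (While (ltE (Reg i) b) (Seq body (Assign i (addE (Reg i) (Cst 1))))).

Fixpoint fetch_free e : bool :=
  match e with
  | Cst _ | Reg _ => true
  | Fetch _ => false
  | Bin _ e1 e2 => fetch_free e1 && fetch_free e2
  end.

Lemma eval_fetch_free e s s' : fetch_free e -> regs s' = regs s -> eval W s' e = eval W s e.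
Proof.
move=> + rr; elim: e => //= [i _|o e1 IH1 e2 IH2 /andP [/IH1 -> /IH2 ->] //].
by rewrite rr.
Qed.

Hypothesis W1 : 0 < W.

Lemma ev_add s e1 e2 v1 v2 : eval W s e1 = Some v1 -> eval W s e2 = Some v2 ->
  v1 + v2 <= W -> eval W s (addE e1 e2) = Some (v1 + v2).
Proof. by move=> /= -> -> ->. Qed.
Lemma ev_mul s e1 e2 v1 v2 : eval W s e1 = Some v1 -> eval W s e2 = Some v2 ->
  v1 * v2 <= W -> eval W s (mulE e1 e2) = Some (v1 * v2).
Proof. by move=> /= -> -> ->. Qed.
Lemma ev_lt s e1 e2 v1 v2 : eval W s e1 = Some v1 -> eval W s e2 = Some v2 ->
  eval W s (ltE e1 e2) = Some (v1 < v2 : nat).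
Proof. by move=> /= -> ->; rewrite (leq_trans (leq_b1 _) W1). Qed.
Lemma ev_eq s e1 e2 v1 v2 : eval W s e1 = Some v1 -> eval W s e2 = Some v2 ->
  eval W s (eqE e1 e2) = Some (v1 == v2 : nat).
Proof. by move=> /= -> ->; rewrite (leq_trans (leq_b1 _) W1). Qed.
Lemma ev_and s e1 e2 (b1 b2 : bool) : eval W s e1 = Some (b1 : nat) ->
  eval W s e2 = Some (b2 : nat) -> eval W s (andE e1 e2) = Some (b1 && b2 : nat).
Proof. by move=> /= -> ->; rewrite mulnb (leq_trans (leq_b1 _) W1). Qed.
Lemma ev_compl s e x : eval W s e = Some x -> eval W s (notE e) = Some (1 - x).
Proof. by move=> /= ->; rewrite (leq_trans (leq_subr _ _) W1). Qed.
Lemma ev_not s e (b : bool) : eval W s e = Some (b : nat) ->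
  eval W s (notE e) = Some (~~ b : nat).
Proof. by move=> /= ->; rewrite (leq_trans (leq_subr _ _) W1); case: b. Qed.
Lemma ev_or s e1 e2 (b1 b2 : bool) : eval W s e1 = Some (b1 : nat) ->
  eval W s e2 = Some (b2 : nat) -> eval W s (orE e1 e2) = Some (b1 || b2 : nat).
Proof.
move=> H1 H2; rewrite (ev_not (ev_and (ev_not H1) (ev_not H2))).
by rewrite negb_and !negbK.
Qed.

(** Besides the body, an iteration costs [expr_cost b + 3] for the test and 4 for the increment.
    Initialisation costs 2 and the final failing test [expr_cost b + 3]. *)
Lemma wp_for i b body N (J : nat -> nat -> state -> Prop) s : N < W ->
  (forall k t s, k <= N -> J k t s -> regs s i = k -> eval W s b = Some N) ->
  (forall k t s, k < N -> J k t s -> regs s i = k ->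
     wp body s (fun t' s' => regs s' i = k /\
                  J k.+1 (t + t' + (expr_cost b + 7)) (set_reg s' i k.+1))) ->
  J 0 0 (set_reg s i 0) ->
  wp (For i b body) s (fun t s' => exists2 t0, t = t0 + (expr_cost b + 5) &
                                    J N t0 s' /\ regs s' i = N).
Proof.
move=> NW Hb Hbody J0; apply: wp_seq.
exists 2, (set_reg s i 0); split; first by constructor.
apply: (@wp_while _ _ (fun f t s => exists2 k, k + f = N & J k t s /\ regs s i = k) _ _ N);
  last by exists 0 => //; split; rewrite //= /upd eqxx.
move=> {J0} f t {}s [k kf [Jk Hk]].
exists (k < N).
  by rewrite -[k in k < N]Hk; apply: ev_lt => //; apply: Hb Jk Hk; lia.
case: ifP => kN; last first.
  have e : k = N by lia.
  by rewrite e in Jk Hk; exists t; [rewrite /=; lia|].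
apply: wp_seq; apply: wp_conseq (Hbody k t s kN Jk Hk) _ => t' s' [Hk' Jk'].
exists 4, (set_reg s' i k.+1); split.
  by have := @ExecAssign W s' i (addE (Reg i) (Cst 1)) k.+1; apply=> /=; rewrite Hk' addn1 ifT //; lia.
exists f.-1; first by lia.
exists k.+1; first by lia.
split; last by rewrite /= /upd eqxx.
by rewrite (_ : t + _ = t + t' + (expr_cost b + 7)) //=; lia.
Qed.
End Hoare.

(** * The program *)

(* Array [k] of the machine occupies the cells [off + (16 * i + k)], where
   [off] (register 2) is the first address after the input.
   0: adjacency, 1: labels, 2 and 3: tails and heads of the arcs,
   4: [beta_tab], 5: the arcs chosen so far, 6: stamps of the two tentative
   runs, 7 and 8: tails and heads of the arcs in their queues. *)
Definition cellE k e := addE (Reg 2) (addE (mulE (Cst 16) e) (Cst k)).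
Definition getE k e := Fetch (cellE k e).
Definition put k e v := Store (cellE k e) v.
Definition pairE a b := addE (mulE a (Reg 0)) b.

(** Adjacency and raw labels are kept apart: a label may exceed the word bound, so the value label
    plus one of the proof cannot be computed by the machine, and labels are only copied and
    compared. *)
Definition adjE x y := getE 0 (pairE x y).
Definition labE x y := getE 1 (pairE x y).
Definition fbdE x y z :=
  andE (adjE x y) (andE (adjE y z) (andE (notE (ltE (labE y z) (labE x y)))
    (notE (andE (adjE x z) (notE (ltE (labE x z) (labE y z))))))).
Definition monoE a b c :=
  andE (adjE a b) (andE (adjE b c) (andE (adjE a c)
    (andE (eqE (labE a b) (labE b c)) (eqE (labE b c) (labE a c))))).
Definition cfgE a b c d :=
  andE (monoE a b c) (andE (adjE b d) (andE (adjE a d)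
    (andE (notE (ltE (labE a b) (labE b d))) (andE (ltE (labE a b) (labE a d))
      (notE (andE (adjE c d) (notE (ltE (labE c d) (labE a b))))))))).

Definition block := foldr Seq Skip.
Local Notation "i <- e" := (Assign i e) (at level 70).

Definition prologue := block [:: 0 <- Fetch (Cst 0); 1 <- Fetch (Cst 1);
  2 <- addE (mulE (Cst 3) (Reg 1)) (Cst 2)].

Definition load_edge := block [::
  6 <- Fetch (addE (mulE (Cst 3) (Reg 3)) (Cst 2));
  7 <- Fetch (addE (mulE (Cst 3) (Reg 3)) (Cst 3));
  8 <- Fetch (addE (mulE (Cst 3) (Reg 3)) (Cst 4));
  put 0 (pairE (Reg 6) (Reg 7)) (Cst 1); put 0 (pairE (Reg 7) (Reg 6)) (Cst 1);
  put 1 (pairE (Reg 6) (Reg 7)) (Reg 8); put 1 (pairE (Reg 7) (Reg 6)) (Reg 8);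
  put 2 (mulE (Cst 2) (Reg 3)) (Reg 6); put 3 (mulE (Cst 2) (Reg 3)) (Reg 7);
  put 2 (addE (mulE (Cst 2) (Reg 3)) (Cst 1)) (Reg 7);
  put 3 (addE (mulE (Cst 2) (Reg 3)) (Cst 1)) (Reg 6)].

Definition load_graph := For 3 (Reg 1) load_edge.

(** Registers 6, 4, 7, 5 play the roles of [a], [b], [c], [d] in [cfg]; the entry is indexed by the
    arc [ac] and then by [b], as in [beta_tab]. *)
Definition mark := If (cfgE (Reg 6) (Reg 4) (Reg 7) (Reg 5))
  (put 4 (pairE (pairE (Reg 6) (Reg 7)) (Reg 4)) (Cst 1)) Skip.

Definition two_m := mulE (Cst 2) (Reg 1).

Definition fetch_arc := block [:: 6 <- getE 2 (Reg 3); 7 <- getE 3 (Reg 3); 9 <- Cst 0].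
Definition count_mono := If (monoE (Reg 6) (Reg 4) (Reg 7)) (9 <- addE (Reg 9) (Cst 1)) Skip.
Definition mark_vertex :=
  If (monoE (Reg 6) (Reg 4) (Reg 7)) (For 5 (Reg 0) mark) Skip.
Definition mark_arc := block [:: 4 <- getE 2 (Reg 10); 5 <- getE 3 (Reg 10); mark].

Definition fill_arc := Seq fetch_arc (Seq (For 4 (Reg 0) count_mono)
  (If (ltE (mulE (Reg 9) (Reg 0)) (Reg 1)) (For 4 (Reg 0) mark_vertex)
                                           (For 10 two_m mark_arc))).

Definition fill_table := For 3 two_m fill_arc.

(** The two runs share an array, interleaved by parity. An arc is queued when its stamp equals the
    number of the current race, so nothing is erased between races. *)
Definition stampE a b := getE 6 (addE (mulE (pairE a b) (Cst 2)) (Reg 12)).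
Definition slotE e := addE (mulE e (Cst 2)) (Reg 12).
Definition chosenE a b := getE 5 (pairE a b).
Definition knownE a b := orE (chosenE a b) (eqE (stampE a b) (Reg 26)).

(* Registers of a run: 12 is its number (0 or 1), 13 and 14 the ends of its
   queue, 15 the vertex to be examined, 16 whether it has failed; 17 to 20 hold
   the values of 13 to 16 for the other run. *)
Definition force_cmd := If (knownE (Reg 24) (Reg 23)) (16 <- Cst 1)
  (If (knownE (Reg 23) (Reg 24)) Skip (block [::
     put 6 (addE (mulE (pairE (Reg 23) (Reg 24)) (Cst 2)) (Reg 12)) (Reg 26);
     put 7 (slotE (Reg 14)) (Reg 23); put 8 (slotE (Reg 14)) (Reg 24);
     14 <- addE (Reg 14) (Cst 1)])).

Definition step_in_cmd :=
  If (orE (fbdE (Reg 21) (Reg 22) (Reg 15))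
          (andE (monoE (Reg 21) (Reg 22) (Reg 15)) (knownE (Reg 15) (Reg 21))))
     (block [:: 23 <- Reg 15; 24 <- Reg 22; force_cmd]) Skip.
Definition step_out_cmd :=
  If (orE (fbdE (Reg 15) (Reg 21) (Reg 22))
       (orE (andE (monoE (Reg 21) (Reg 22) (Reg 15)) (knownE (Reg 22) (Reg 15)))
            (getE 4 (pairE (pairE (Reg 21) (Reg 22)) (Reg 15)))))
     (block [:: 23 <- Reg 21; 24 <- Reg 15; force_cmd]) Skip.

Definition advance_cmd := block [::
  21 <- getE 7 (slotE (Reg 13)); 22 <- getE 8 (slotE (Reg 13));
  step_in_cmd; step_out_cmd;
  15 <- addE (Reg 15) (Cst 1);
  If (eqE (Reg 15) (Reg 0)) (block [:: 15 <- Cst 0; 13 <- addE (Reg 13) (Cst 1)]) Skip].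

Definition swap_cmd := block [::
  25 <- Reg 13; 13 <- Reg 17; 17 <- Reg 25; 25 <- Reg 14; 14 <- Reg 18; 18 <- Reg 25;
  25 <- Reg 15; 15 <- Reg 19; 19 <- Reg 25; 25 <- Reg 16; 16 <- Reg 20; 20 <- Reg 25;
  12 <- notE (Reg 12)].

(** Exchanging the register banks after each step lets one body serve both runs; a failed run merely
    passes its turn. The loop ends when both runs have failed, or when the run about to move is
    alive with an exhausted queue. *)
Definition race_body := block [:: If (Reg 16) Skip advance_cmd; swap_cmd].
Definition race_cond := andE (notE (andE (Reg 16) (Reg 20)))
  (orE (Reg 16) (ltE (Reg 13) (Reg 14))).

Definition start_run := block [::
  put 6 (addE (mulE (pairE (Reg 6) (Reg 7)) (Cst 2)) (Reg 12)) (Reg 26);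
  put 7 (slotE (Cst 0)) (Reg 6); put 8 (slotE (Cst 0)) (Reg 7);
  13 <- Cst 0; 14 <- Cst 1; 15 <- Cst 0; 16 <- Cst 0].

Definition commit_arc :=
  put 5 (pairE (getE 7 (slotE (Reg 4))) (getE 8 (slotE (Reg 4)))) (Cst 1).

(** The race number is the edge index plus one, hence different from the initial content 0 of the
    stamps. *)
Definition start_race := block [:: 26 <- addE (Reg 3) (Cst 1); 12 <- Cst 0; start_run;
  25 <- Reg 6; 6 <- Reg 7; 7 <- Reg 25; swap_cmd; start_run].

Definition race := Seq start_race (Seq (While race_cond race_body)
  (If (Reg 16) (11 <- Cst 1) (For 4 (Reg 14) commit_arc))).

Definition fetch_edge := block [:: 6 <- getE 2 (mulE (Cst 2) (Reg 3));
  7 <- getE 3 (mulE (Cst 2) (Reg 3))].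

Definition orient_edge := Seq fetch_edge
  (If (orE (Reg 11) (orE (chosenE (Reg 6) (Reg 7)) (chosenE (Reg 7) (Reg 6)))) Skip race).

Definition orient := Seq (11 <- Cst 0) (For 3 (Reg 1) orient_edge).

Definition output_arc a b := block [::
  Store (addE (mulE (Cst 2) (Reg 3)) (Cst 1)) a;
  Store (addE (mulE (Cst 2) (Reg 3)) (Cst 2)) b].

Definition output_edge := Seq fetch_edge (If (chosenE (Reg 6) (Reg 7))
  (output_arc (Reg 6) (Reg 7)) (output_arc (Reg 7) (Reg 6))).

Definition epilogue := If (Reg 11) (Store (Cst 0) (Cst 0))
  (Seq (For 3 (Reg 1) output_edge) (Store (Cst 0) (Cst 1))).

Definition tto_program := Seq prologue (Seq load_graph (Seq fill_table (Seq orient epilogue))).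

(** * Correctness of the program *)

Section Machine.
Variables (n m P W : nat) (E : nat -> nat -> bool) (Lb : nat -> nat -> nat).
(** [P] bounds all array indices: [n^3] for the table, [2 n^2] for the stamps, about [4 m] for two
    interleaved queues of at most [2 m] arcs. The factor 64 leaves room for sixteen interleaved
    arrays placed after the input. *)
Hypotheses (HP : n * n * n + n * n * 2 + 4 * m + n + 8 <= P) (HW : 64 * P <= W).

Let off := 3 * m + 2.
Definition lab a b := if E a b then (Lb a b).+1 else 0.

Definition cell k i := off + (16 * i + k).
Definition arr (M : nat -> nat) k i := M (cell k i).
Definition ix a b := a * n + b.

Lemma W_gt0 : 0 < W. Proof. by move: HP HW; lia. Qed.
Hint Resolve W_gt0 : core.

Lemma arr_upd M k i v k' j : k < 16 -> k' < 16 ->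
  arr (upd M (cell k i) v) k' j = if (k' == k) && (j == i) then v else arr M k' j.
Proof.
move=> k16 k16'; rewrite /arr /upd /cell; congr (if _ then _ else _).
by apply/eqP/andP => [H|[/eqP -> /eqP ->]] //; split; apply/eqP; lia.
Qed.

Lemma ix_lt a b : a < n -> b < n -> ix a b < n * n.
Proof. by rewrite /ix; nia. Qed.
Lemma ix_le a b : a < n -> b < n -> ix a b <= P.
Proof. by move=> an bn; have := ix_lt an bn; lia. Qed.
Lemma ix_eq a b a' b' : b < n -> b' < n -> (ix a b == ix a' b') = (a == a') && (b == b').
Proof.
move=> bn bn'; apply/eqP/andP => [H|[/eqP -> /eqP ->]] //.
have aa : a = a' by move: H; rewrite /ix; nia.
by subst a'; split=> //; apply/eqP; move: H; rewrite /ix; lia.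
Qed.

Lemma ix3_le a c b : a < n -> c < n -> b < n -> ix (ix a c) b <= P.
Proof. by move=> an cn bn; have := ix_lt an cn; rewrite {2}/ix; nia. Qed.

Lemma ixr_le a b r : a < n -> b < n -> r < 2 -> ix a b * 2 + r <= P.
Proof. by move=> an bn; have := ix_lt an bn; lia. Qed.

Lemma ev_get s k e i : regs s 2 = off -> k < 16 -> eval W s e = Some i -> i <= P ->
  eval W s (getE k e) = Some (arr (memory s) k i).
Proof.
move=> Hoff k16 /= -> iP; rewrite Hoff.
by do 4 (rewrite ifT; last by lia).
Qed.

Lemma run_put s k e v i x Q : regs s 2 = off -> k < 16 -> eval W s e = Some i -> i <= P ->
  eval W s v = Some x -> Q (set_mem s (cell k i) x) -> run W (put k e v) s Q.
Proof.
move=> Hoff k16 He iP Hv HQ; exists (cell k i), x; split=> //; last by rewrite /cell; lia.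
by rewrite /= He Hoff; do 3 (rewrite ifT; last by lia).
Qed.

Lemma ev_pair s e1 e2 a b : regs s 0 = n -> eval W s e1 = Some a -> eval W s e2 = Some b ->
  ix a b <= P -> eval W s (pairE e1 e2) = Some (ix a b).
Proof.
rewrite /ix => Hn H1 H2 ab.
by rewrite /= H1 H2 Hn; do 2 (rewrite ifT; last by lia).
Qed.

Definition static s := [/\ regs s 0 = n, regs s 1 = m, regs s 2 = off &
  forall a b, a < n -> b < n ->
    arr (memory s) 0 (ix a b) = E a b /\ arr (memory s) 1 (ix a b) = lab a b - 1].

Section Tests.
Variables (s : state) (ea eb ec : expr) (a b c : nat).
Hypotheses (St : static s).
Hypotheses (Ha : eval W s ea = Some a) (Hb : eval W s eb = Some b) (Hc : eval W s ec = Some c).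
Hypotheses (an : a < n) (bn : b < n) (cn : c < n).

Lemma ev_adj x y ex ey : eval W s ex = Some x -> eval W s ey = Some y ->
  x < n -> y < n -> eval W s (adjE ex ey) = Some (E x y : nat).
Proof.
have [Hn _ H2 HM] := St => Hx Hy xn yn; rewrite -(proj1 (HM _ _ xn yn)).
by apply: ev_get => //; [apply: ev_pair => //|]; apply: ix_le.
Qed.

Lemma ev_lab x y ex ey : eval W s ex = Some x -> eval W s ey = Some y ->
  x < n -> y < n -> eval W s (labE ex ey) = Some (lab x y - 1).
Proof.
have [Hn _ H2 HM] := St => Hx Hy xn yn; rewrite -(proj2 (HM _ _ xn yn)).
by apply: ev_get => //; [apply: ev_pair => //|]; apply: ix_le.
Qed.

Ltac test := repeat first [apply: ev_and; [by []| |] | apply: ev_not; [by []|]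
  | apply: ev_lt; [by []| |] | apply: ev_eq; [by []| |]
  | by apply: ev_adj | by apply: ev_lab ].

Lemma ev_fbd : eval W s (fbdE ea eb ec) = Some (fbdb lab a b c : nat).
Proof.
have -> : fbdb lab a b c = [&& E a b, E b c, ~~ (lab b c - 1 < lab a b - 1) &
    ~~ (E a c && ~~ (lab a c - 1 < lab b c - 1))].
  by rewrite /fbdb /lab; case: (E a b); case: (E b c); case: (E a c); rewrite //=; lia.
by test.
Qed.

Lemma ev_mono : eval W s (monoE ea eb ec) = Some (monob lab a b c : nat).
Proof.
have -> : monob lab a b c = [&& E a b, E b c, E a c, lab a b - 1 == lab b c - 1 &
    lab b c - 1 == lab a c - 1].
  by rewrite /monob /lab; case: (E a b); case: (E b c); case: (E a c); rewrite //=; lia.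
by test.
Qed.

Lemma ev_cfg ed d : eval W s ed = Some d -> d < n ->
  eval W s (cfgE ea eb ec ed) = Some (cfgb lab a b c d : nat).
Proof.
move=> Hd dn.
have -> : cfgb lab a b c d = [&& monob lab a b c, E b d, E a d,
    ~~ (lab a b - 1 < lab b d - 1), lab a b - 1 < lab a d - 1 &
    ~~ (E c d && ~~ (lab c d - 1 < lab a b - 1))].
  rewrite /cfgb; case M: (monob lab a b c) => //=; move: M.
  by rewrite /monob /lab; case: (E a b); case: (E b d); case: (E a d); case: (E c d);
    rewrite //=; lia.
apply: ev_and; [by []|exact: ev_mono|]; test.
Qed.
End Tests.

Arguments run : simpl never.
Arguments eval : simpl never.
Arguments block : simpl never.

Lemma block_cons c cs : block (c :: cs) = Seq c (block cs).
Proof. by []. Qed.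
Lemma block_nil : block [::] = Skip.
Proof. by []. Qed.

Variable es : seq (nat * nat).
Hypotheses (size_es : size es = m) (Esym : forall a b, E a b = E b a)
  (Lsym : forall a b, E a b -> Lb a b = Lb b a) (En : forall a b, E a b -> a < n)
  (es_edge : forall u, u \in es -> E u.1 u.2)
  (edge_es : forall a b, E a b -> ((a, b) \in es) || ((b, a) \in es)).

(** * Loading the edge list *)

Definition arc j := let p := nth (0, 0) es j./2 in if odd j then (p.2, p.1) else p.
Definition arcs k := mkseq arc k.

Lemma arcsS k : arcs k.+1 = rcons (arcs k) (arc k).
Proof. by rewrite /arcs /mkseq -addn1 iotaD map_cat cats1. Qed.

Lemma edge_n k : k < m -> let u := nth (0, 0) es k in [/\ E u.1 u.2, u.1 < n & u.2 < n].
Proof.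
move=> km u; have uE : E u.1 u.2 by apply: es_edge; rewrite mem_nth ?size_es.
by split=> //; [apply: En uE|rewrite Esym in uE; apply: En uE].
Qed.

Lemma arc_edge j : j < 2 * m -> [/\ E (arc j).1 (arc j).2, (arc j).1 < n & (arc j).2 < n].
Proof.
move=> jm; have [|H1 H2 H3] := @edge_n j./2; first by lia.
by rewrite /arc; case: (odd j) => //; rewrite Esym.
Qed.

Lemma mem_arcs a b : ((a, b) \in arcs (2 * m)) = E a b.
Proof.
apply/mapP/idP => [[j]|Eab].
  by rewrite mem_iota => /andP [_ /arc_edge [H _ _]] e; rewrite -e in H.
have [H|H] := orP (edge_es Eab).
  exists (index (a, b) es).*2; first by have := index_mem (a, b) es; rewrite H mem_iota size_es; lia.
  by rewrite /arc odd_double doubleK nth_index.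
exists (index (b, a) es).*2.+1; first by have := index_mem (b, a) es; rewrite H mem_iota size_es; lia.
by rewrite /arc /= odd_double uphalf_double nth_index.
Qed.

Record input_at s := Input {
  in_n : memory s 0 = n; in_m : memory s 1 = m;
  in_es : forall i, i < m -> [/\ memory s (3 * i + 2) = (nth (0, 0) es i).1,
    memory s (3 * i + 3) = (nth (0, 0) es i).2 &
    memory s (3 * i + 4) = Lb (nth (0, 0) es i).1 (nth (0, 0) es i).2];
  in_0 : forall a, off <= a -> memory s a = 0 }.

Record loading k t s := Loading {
  ld_regs : [/\ regs s 0 = n, regs s 1 = m & regs s 2 = off];
  ld_in : forall i, i < m -> [/\ memory s (3 * i + 2) = (nth (0, 0) es i).1,
    memory s (3 * i + 3) = (nth (0, 0) es i).2 &
    memory s (3 * i + 4) = Lb (nth (0, 0) es i).1 (nth (0, 0) es i).2];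
  ld_mx : forall a b, a < n -> b < n -> 
    arr (memory s) 0 (ix a b) = ((a, b) \in arcs (2 * k)) /\
    arr (memory s) 1 (ix a b) = if (a, b) \in arcs (2 * k) then Lb a b else 0;
  ld_arc : forall j, j < 2 * k ->
    arr (memory s) 2 j = (arc j).1 /\ arr (memory s) 3 j = (arc j).2;
  ld_0 : forall h i, 4 <= h < 16 -> arr (memory s) h i = 0;
  ld_time : t <= (ccost load_edge + 20) * k }.

Lemma mem_cell M h i v a : a < off -> upd M (cell h i) v a = M a.
Proof. by move=> H; rewrite /upd; case: eqP => // e; move: H; rewrite e /cell; lia. Qed.

Lemma arc2 k : arc (2 * k) = nth (0, 0) es k.
Proof. by rewrite /arc mul2n odd_double doubleK. Qed.
Lemma arc2S k : arc (2 * k).+1 = ((nth (0, 0) es k).2, (nth (0, 0) es k).1).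
Proof. by rewrite /arc /= mul2n odd_double /= uphalf_double. Qed.

Lemma run_load_edge k t s : k < m -> loading k t s -> regs s 3 = k ->
  run W load_edge s (fun s' => regs s' 3 = k /\
    forall t', t' <= t + (ccost load_edge + 20) -> loading k.+1 t' (set_reg s' 3 k.+1)).
Proof.
move=> km L k3; have [[r0 r1 r2] Lin Lmx Larc L0 Lt] := L.
have [iu iv il] := Lin _ km.
have [Euv un vn] := edge_n km.
set u := (nth (0, 0) es k).1 in iu il un Euv; set v := (nth (0, 0) es k).2 in iv il vn Euv.
have uvE : nth (0, 0) es k = (u, v) by rewrite /u /v -surjective_pairing.
have idx s' c : regs s' 3 = k -> c <= 4 ->
    eval W s' (addE (mulE (Cst 3) (Reg 3)) (Cst c)) = Some (3 * k + c).
  move=> k3' c4; have -> : 3 * k = 3 * regs s' 3 by rewrite k3'.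
  by apply: ev_add => //; [apply: ev_mul => //|]; rewrite k3'; lia.
have idx2 s' : regs s' 3 = k -> eval W s' (mulE (Cst 2) (Reg 3)) = Some (2 * k).
  by move=> k3'; rewrite -k3'; apply: ev_mul => //; rewrite k3'; lia.
have idx2S s' : regs s' 3 = k -> eval W s' (addE (mulE (Cst 2) (Reg 3)) (Cst 1)) = Some (2 * k).+1.
  by move=> k3'; rewrite -[(2 * k).+1]addn1; apply: ev_add; [apply: idx2|by []|lia].
have fch s' c x : regs s' 3 = k -> c <= 4 -> memory s' (3 * k + c) = x ->
    eval W s' (Fetch (addE (mulE (Cst 3) (Reg 3)) (Cst c))) = Some x.
  by move=> k3' c4 <-; have := idx s' c k3' c4; rewrite /eval -/eval => ->; rewrite ifT //; lia.
rewrite /load_edge !block_cons block_nil.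
apply: run_seq; apply: (run_assign (fch _ 2 u _ _ _)) => //.
apply: run_seq; apply: (run_assign (fch _ 3 v _ _ _)) => //.
apply: run_seq; apply: (run_assign (fch _ 4 (Lb u v) _ _ _)) => //.
set s3 := set_reg _ 8 _.
have evr s' r x : regs s' = regs s3 -> regs s3 r = x -> eval W s' (Reg r) = Some x.
  by rewrite /eval => -> ->.
have ev67 s' : regs s' = regs s3 -> eval W s' (pairE (Reg 6) (Reg 7)) = Some (ix u v).
  move=> e; apply: ev_pair; rewrite ?e //; try exact: evr; exact: ix_le.
have ev76 s' : regs s' = regs s3 -> eval W s' (pairE (Reg 7) (Reg 6)) = Some (ix v u).
  move=> e; apply: ev_pair; rewrite ?e //; try exact: evr; exact: ix_le.
apply: run_seq; eapply run_put; [exact r2 | by [] | exact: ev67 | exact: ix_le | reflexivity | ].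
apply: run_seq; eapply run_put; [exact r2 | by [] | exact: ev76 | exact: ix_le | reflexivity | ].
apply: run_seq; eapply run_put; [exact r2 | by [] | exact: ev67 | exact: ix_le | exact: evr | ].
apply: run_seq; eapply run_put; [exact r2 | by [] | exact: ev76 | exact: ix_le | exact: evr | ].
apply: run_seq; eapply run_put; [exact r2 | by [] | exact: idx2 | by lia | exact: evr | ].
apply: run_seq; eapply run_put; [exact r2 | by [] | exact: idx2 | by lia | exact: evr | ].
apply: run_seq; eapply run_put; [exact r2 | by [] | exact: idx2S | by lia | exact: evr | ].
apply: run_seq; eapply run_put; [exact r2 | by [] | exact: idx2S | by lia | exact: evr | ].
apply: run_skip; split=> // t' ht.
have ak : arcs (2 * k.+1) = rcons (rcons (arcs (2 * k)) (u, v)) (v, u).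
  by rewrite (_ : 2 * k.+1 = (2 * k).+2) ?arcsS ?arc2 ?arc2S ?uvE //; lia.
split=> //.
- by move=> i im; rewrite /= !mem_cell; [exact: Lin|..]; lia.
- move=> a b an bn; have [A0 A1] := Lmx a b an bn.
  rewrite /= !arr_upd //= !ix_eq // A0 A1 ak !(mem_rcons, in_cons) !xpair_eqE /upd /=.
  case: (boolP (_ && _)) => [/andP [/eqP -> /eqP ->]|_] /=; first by rewrite Lsym // Esym.
  by case: (boolP (_ && _)) => [/andP [/eqP -> /eqP ->]|_].
- move=> j jk; rewrite /= !arr_upd //=.
  have [->|n1] := eqVneq j (2 * k).+1; first by rewrite arc2S uvE.
  have [->|n2] := eqVneq j (2 * k); first by rewrite arc2 uvE.
  by apply: Larc; lia.
- move=> h i hh; rewrite /= !arr_upd //; try by lia.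
  have [-> -> -> ->] : [/\ h == 0 = false, h == 1 = false, h == 2 = false & h == 3 = false].
    by split; apply/eqP; lia.
  exact: L0.
- by move: ht Lt; set c := ccost load_edge + 20; rewrite [c * k.+1]mulnS; lia.
Qed.

Lemma wp_load s : (forall i, i < m ->
    [/\ memory s (3 * i + 2) = (nth (0, 0) es i).1,
        memory s (3 * i + 3) = (nth (0, 0) es i).2 &
        memory s (3 * i + 4) = Lb (nth (0, 0) es i).1 (nth (0, 0) es i).2]) ->
    (forall a, off <= a -> memory s a = 0) ->
  [/\ regs s 0 = n, regs s 1 = m & regs s 2 = off] ->
  wp W load_graph s (fun t s' => exists2 t0, t = t0 + 6 & loading m t0 s').
Proof.
move=> Hin H0 Hr; have mW : m < W by lia.
apply: wp_conseq (wp_for W_gt0 (J := loading) mW _ _ _) _.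
- by move=> k t s' _ L _; case: L => -[_ <- _] *.
- move=> k t s' km L k3; apply: wp_conseq (wp_run (run_load_edge km L k3)) _.
  by move=> t' s2 [ht [k3' H]]; split=> //; apply: H; rewrite [expr_cost _]/=; lia.
- have Z h i : arr (memory s) h i = 0 by apply: H0; rewrite /cell; lia.
  by split=> //; move=> * //; rewrite /= !Z.
- by move=> t s' [t0 -> [H _]]; exists t0.
Qed.

Lemma loading_static t s : loading m t s -> static s.
Proof.
case=> -[r0 r1 r2] _ Lmx _ _ _; split=> // a b an bn; have [-> ->] := Lmx a b an bn.
by rewrite mem_arcs /lab; case: (E a b); rewrite // subn1.
Qed.

(** * Tabulating the additional implications *)

Definition graph s := static s /\ forall j, j < 2 * m ->
  arr (memory s) 2 j = (arc j).1 /\ arr (memory s) 3 j = (arc j).2.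

Lemma graph_reg s i v : 3 <= i -> graph s -> graph (set_reg s i v).
Proof.
move=> i3 [[r0 r1 r2 H] H']; split; last exact: H'.
by split=> //; rewrite /= /upd ifF //; apply/eqP; lia.
Qed.

Lemma graph_mem s h i v : 4 <= h < 16 -> graph s -> graph (set_mem s (cell h i) v).
Proof.
move=> hh [[r0 r1 r2 H] H'].
have ne j x : j < 4 -> arr (memory (set_mem s (cell h i) v)) j x = arr (memory s) j x.
  move=> j4; rewrite /= arr_upd; try by lia.
  by rewrite (_ : j == h = false) //; apply/eqP; lia.
by split; [split|] => //; [move=> a b an bn|move=> j jm]; rewrite !ne //; [apply: H|apply: H'].
Qed.

(** Marks are sound, and those demanded by [R] are present; whether other valid entries are already
    marked is left open, and [R] grows along the loops. *)
Definition table (R : nat -> nat -> nat -> Prop) M := forall a c b, a < n -> c < n -> b < n ->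
  exists v : bool, [/\ arr M 4 (ix (ix a c) b) = v, v -> beta_tab n lab a c b & R a c b -> v].

Definition tabling R s := [/\ graph s, table R (memory s) &
  forall h i, 5 <= h < 16 -> arr (memory s) h i = 0].

Lemma tabling_reg R s i v : 3 <= i -> tabling R s -> tabling R (set_reg s i v).
Proof. by move=> i3 [G T Z]; split=> //; apply: graph_reg. Qed.

Lemma tabling_sub (R R' : nat -> nat -> nat -> Prop) s :
  (forall a c b, a < n -> c < n -> b < n -> R' a c b -> R a c b) -> tabling R s -> tabling R' s.
Proof.
move=> sub [G T Z]; split=> // a c b an cn bn; have [v [e v1 v2]] := T a c b an cn bn.
by exists v; split=> // /sub -/(_ an cn bn).
Qed.

Definition marked (R : nat -> nat -> nat -> Prop) a c (Q : nat -> Prop) a' c' b' :=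
  R a' c' b' \/ [/\ a' = a, c' = c & Q b'].

Lemma ev_regE s i v : regs s i = v -> eval W s (Reg i) = Some v.
Proof. by rewrite /eval => ->. Qed.

Lemma run_mark R s a b c d : tabling R s -> a < n -> b < n -> c < n -> d < n ->
  regs s 6 = a -> regs s 4 = b -> regs s 7 = c -> regs s 5 = d ->
  run W mark s (fun s' => regs s' = regs s /\
    tabling (marked R a c (fun b' => b' = b /\ cfgb lab a b c d)) s').
Proof.
move=> [G T Z] an bn cn dn r6 r4 r7 r5.
have St : static s by case: G.
have [r0 _ r2 _] := St.
apply: (run_if (ev_cfg St (ev_regE r6) (ev_regE r4) (ev_regE r7) an bn cn (ev_regE r5) dn)) => C.
  have e : eval W s (pairE (pairE (Reg 6) (Reg 7)) (Reg 4)) = Some (ix (ix a c) b).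
    apply: ev_pair => //; [apply: ev_pair => //; try exact: ev_regE; exact: ix_le|exact: ev_regE|].
    exact: ix3_le.
  eapply run_put; [exact: r2|by []|exact: e|exact: ix3_le|reflexivity|].
  split=> //; split; first exact: graph_mem.
  - move=> a' c' b' an' cn' bn'; have [v [ev v1 v2]] := T a' c' b' an' cn' bn'.
    rewrite /= arr_upd //= ix_eq // ix_eq //.
    have [/andP [/andP [/eqP ? /eqP ?] /eqP ?]|ne] := boolP (_ && _).
      subst a' c' b'; exists true; split=> // _.
      by apply/existsP; exists (Ordinal dn).
    exists v; split=> // -[/v2 //|[? ? [? _]]]; subst a' c' b'.
    by rewrite !eqxx in ne.
  - move=> h i hh; rewrite /= arr_upd; try by lia.
    by rewrite (_ : h == 4 = false) ?Z //; apply/eqP; lia.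
apply: run_skip; split=> //; apply: tabling_sub (And3 G T Z).
by move=> a' c' b' _ _ _ [//|[_ _ [_ C']]]; rewrite C' in C.
Qed.

Definition cmark := ccost mark + 20.

Lemma wp_mark_vertex_loop R s a b c : tabling R s -> a < n -> b < n -> c < n ->
  regs s 6 = a -> regs s 4 = b -> regs s 7 = c ->
  wp W (For 5 (Reg 0) mark) s (fun t s' => [/\ t <= cmark * n + 6,
    tabling (marked R a c (fun b' => b' = b /\ exists2 d, d < n & cfgb lab a b c d)) s' &
    forall i, i != 5 -> regs s' i = regs s i]).
Proof.
move=> T an bn cn r6 r4 r7; have nW : n < W by lia.
pose J k t s' := [/\ t <= cmark * k,
    tabling (marked R a c (fun b' => b' = b /\ exists2 d, d < k & cfgb lab a b c d)) s' &
    forall i, i != 5 -> regs s' i = regs s i].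
apply: wp_conseq (wp_for W_gt0 (J := J) nW _ _ _) _.
- by move=> k t s' _ [_ [[[<-]]]].
- move=> k t s' kn [ht T' rr] r5.
  have r6' : regs s' 6 = a by rewrite rr.
  have r4' : regs s' 4 = b by rewrite rr.
  have r7' : regs s' 7 = c by rewrite rr.
  apply: wp_conseq (wp_run (run_mark T' an bn cn kn r6' r4' r7' r5)) _ => t' s2 [ht' [e T2]]; split; first by rewrite e.
  split.
  + by rewrite mulnS [expr_cost _]/= /cmark; move: ht ht'; rewrite /cmark; lia.
  + apply: tabling_reg => //; apply: tabling_sub T2.
    move=> a' c' b' _ _ _ [?|[? ? [? [d dk C]]]]; first by left; left.
    have [ek|nk] := eqVneq d k; first by subst d; right.
    by left; right; split=> //; split=> //; exists d => //; lia.
  + by move=> i i5; rewrite /= /upd (negPf i5) e rr.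
- split=> //; last by move=> i i5; rewrite /= /upd (negPf i5).
  apply: tabling_reg => //; apply: tabling_sub T.
  by move=> a' c' b' _ _ _ [//|[_ _ [_ [d]]]].
- by move=> t s' [t0 -> [[ht T' rr] _]]; split=> //; rewrite [expr_cost _]/=; lia.
Qed.

Definition nmono a c k := \sum_(b < k) monob lab a b c.

Lemma nmonoS a c k : nmono a c k.+1 = nmono a c k + monob lab a k c.
Proof. by rewrite /nmono big_ord_recr. Qed.

Definition cvertex := ccost mark + expr_cost (monoE (Reg 6) (Reg 4) (Reg 7)) + 40.

(** Only a vertex that completes a monolabel triangle pays for the inner loop, whence [n] plus [n]
    times the number of triangles. *)
Lemma wp_mark_vertices R s a c : tabling R s -> a < n -> c < n ->
  regs s 6 = a -> regs s 7 = c ->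
  wp W (For 4 (Reg 0) mark_vertex) s (fun t s' => [/\ t <= cvertex * (n + n * nmono a c n) + 6,
    tabling (marked R a c (beta_tab n lab a c)) s' & regs s' 3 = regs s 3]).
Proof.
move=> T an cn r6 r7; have nW : n < W by lia.
pose J k t s' := [/\ t <= cvertex * (k + n * nmono a c k),
    tabling (marked R a c (fun b' => b' < k /\ beta_tab n lab a c b')) s' &
    forall i, i != 5 -> i != 4 -> regs s' i = regs s i].
apply: wp_conseq (wp_for W_gt0 (J := J) nW _ _ _) _.
- by move=> k t s' _ [_ [[[<-]]]].
- move=> k t s' kn [ht T' rr] r4.
  have r6' : regs s' 6 = a by rewrite rr.
  have r7' : regs s' 7 = c by rewrite rr.
  have St : static s' by case: T' => -[].
  have nm := nmonoS a c k.
  rewrite /mark_vertex.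
  have em := ev_mono St (ev_regE r6') (ev_regE r4) (ev_regE r7') an kn cn.
  eapply wp_if; [exact: em|move=> M|move=> M].
    apply: wp_conseq (wp_mark_vertex_loop T' an kn cn r6' r4 r7') _.
    move=> t' s2 [ht' T2 rr2]; split; first by rewrite rr2.
    split.
    + have -> : nmono a c k.+1 = (nmono a c k).+1 by rewrite nm M addn1.
      move: ht' ht; rewrite [expr_cost (Reg _)]/= /cmark /cvertex.
      set u := ccost mark; set v := expr_cost _; set w := nmono _ _ _ => h1 h2.
      by nia.
    + apply: tabling_reg => //; apply: tabling_sub T2.
      move=> a' c' b' _ _ _ [?|[? ? [bk B]]]; first by left; left.
      have [ek|nk] := eqVneq b' k; last by left; right; split=> //; split=> //; lia.
      subst b'; right; split=> //; split=> //.
      by case/existsP: B => d C; exists (d : nat).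
    + by move=> i i5 i4; rewrite /= /upd (negPf i4) rr2 ?rr.
  exists 1, s'; split; first by constructor.
  split=> //; split.
  + rewrite nm (negPf M) addn0 [expr_cost (Reg _)]/=.
    move: ht; rewrite /cvertex.
    by set u := ccost mark; set v := expr_cost _; set w := nmono _ _ _; nia.
  + apply: tabling_reg => //; apply: tabling_sub T'.
    move=> a' c' b' _ _ _ [?|[? ? [bk B]]]; first by left.
    have [ek|nk] := eqVneq b' k; last by right; split=> //; split=> //; lia.
    subst b'; case/existsP: B => d /and5P [M' _ _ _ _].
    by rewrite M' in M.
  + by move=> i i5 i4; rewrite /= /upd (negPf i4) rr.
- split=> //; last by move=> i i5 i4; rewrite /= /upd (negPf i4).
  apply: tabling_reg => //; apply: tabling_sub T.
  by move=> a' c' b' _ _ _ [//|[_ _ []]].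
- move=> t s' [t0 -> [[ht T' rr] _]]; split=> //; last by rewrite rr.
    by rewrite [expr_cost _]/=; lia.
  by apply: tabling_sub T' => a' c' b' _ _ bn [?|[? ? ?]]; [left|right].
Qed.

Lemma ev_two_m s : regs s 1 = m -> eval W s two_m = Some (2 * m).
Proof. by move=> r1; apply: ev_mul => //; [exact: ev_regE|lia]. Qed.

Definition carc := ccost mark_arc + 40.

(** Enumerating arcs misses nothing, because [cfg] requires [bd] to be an edge. *)
Lemma wp_mark_arcs R s a c : tabling R s -> a < n -> c < n ->
  regs s 6 = a -> regs s 7 = c ->
  wp W (For 10 two_m mark_arc) s (fun t s' => [/\ t <= carc * (2 * m) + 10,
    tabling (marked R a c (beta_tab n lab a c)) s' & regs s' 3 = regs s 3]).
Proof.
move=> T an cn r6 r7; have mW : 2 * m < W by lia.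
pose J k t s' := [/\ t <= carc * k,
    tabling (marked R a c (fun b' => exists2 j, j < k &
      (arc j).1 = b' /\ cfgb lab a b' c (arc j).2)) s' &
    forall i, i != 10 -> i != 4 -> i != 5 -> regs s' i = regs s i].
apply: wp_conseq (wp_for W_gt0 (J := J) mW _ _ _) _.
- by move=> k t s' _ [_ [[[_ r1 _ _] _] _ _] _] _; apply: ev_two_m.
- move=> k t s' km [ht T' rr] r10.
  have [_ bn dn] := arc_edge km.
  have [[[r0 r1 r2 _] Ga] _ _] := T'.
  have [e1 e2] := Ga k km.
  have body : run W mark_arc s' (fun s2 => (forall i, i != 4 -> i != 5 -> regs s2 i = regs s' i) /\
      tabling (marked (marked R a c (fun b' => exists2 j, j < k &
      (arc j).1 = b' /\ cfgb lab a b' c (arc j).2)) a c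
        (fun b' => b' = (arc k).1 /\ cfgb lab a (arc k).1 c (arc k).2)) s2).
    rewrite /mark_arc !block_cons block_nil.
    have kP : k <= P by lia.
    apply: run_seq; apply: (run_assign (v := (arc k).1)).
      by rewrite -e1; apply: ev_get => //; exact: ev_regE.
    apply: run_seq; apply: (run_assign (v := (arc k).2)).
      by rewrite -e2; apply: ev_get => //; exact: ev_regE.
    set s2 := set_reg _ 5 _.
    have T2 : tabling (marked R a c (fun b' => exists2 j, j < k &
      (arc j).1 = b' /\ cfgb lab a b' c (arc j).2)) s2 by do 2!apply: tabling_reg => //.
    apply: run_seq; apply: run_conseq (run_mark T2 an bn cn dn _ _ _ _) _ => //.
    - by rewrite /= /upd /= rr.
    - by rewrite /= /upd /= rr.
    - move=> s3 [e3 T3]; apply: run_skip; split=> // i i4 i5.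
      by rewrite e3 /= /upd (negPf i4) (negPf i5).
  apply: wp_conseq (wp_run body) _ => t' s2 [ht' [e3 T2]]; split; first by rewrite e3.
  split.
  + by move: ht ht'; rewrite [expr_cost _]/= /carc; set u := ccost _; nia.
  + apply: tabling_reg => //; apply: tabling_sub T2.
    move=> a' c' b' _ _ _ [?|[? ? [j jk [eb C]]]]; first by left; left.
    have [ek|nk] := eqVneq j k; last by left; right; split=> //; exists j => //; lia.
    by subst j; right; split=> //; rewrite eb.
  + by move=> i i10 i4 i5; rewrite /= /upd (negPf i10) e3 // rr.
- split=> //; last by move=> i i10; rewrite /= /upd (negPf i10).
  apply: tabling_reg => //; apply: tabling_sub T.
  by move=> a' c' b' _ _ _ [//|[_ _ [j]]].
- move=> t s' [t0 -> [[ht T' rr] _]]; split=> //; last by rewrite rr.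
    by rewrite [expr_cost _]/=; lia.
  apply: tabling_sub T' => a' c' b' _ _ bn [?|[? ? /existsP [d C]]]; first by left.
  right; split=> //; have Ebd : E b' d.
    by move: C; rewrite /cfgb /lab; case: (E b' d); rewrite // andbF.
  move: Ebd; rewrite -mem_arcs => /mapP [j]; rewrite mem_iota => /andP [_ jm] e.
  by exists j => //; rewrite -e.
Qed.

Lemma nmono_le a c k : nmono a c k <= k.
Proof.
elim: k => [|k IH]; first by rewrite /nmono big_ord0.
by rewrite nmonoS; case: (monob _ _ _ _) => /=; lia.
Qed.

Definition ccount := ccost count_mono + 20.

Lemma wp_count R s a c : tabling R s -> a < n -> c < n ->
  regs s 6 = a -> regs s 7 = c -> regs s 9 = 0 ->
  wp W (For 4 (Reg 0) count_mono) s (fun t s' => [/\ t <= ccount * n + 6,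
    tabling R s', regs s' 9 = nmono a c n & forall i, i != 4 -> i != 9 -> regs s' i = regs s i]).
Proof.
move=> T an cn r6 r7 r9; have nW : n < W by lia.
pose J k t s' := [/\ t <= ccount * k, tabling R s', regs s' 9 = nmono a c k &
    forall i, i != 4 -> i != 9 -> regs s' i = regs s i].
apply: wp_conseq (wp_for W_gt0 (J := J) nW _ _ _) _.
- by move=> k t s' _ [_ [[[<-]]]].
- move=> k t s' kn [ht T' r9' rr] r4.
  have r6' : regs s' 6 = a by rewrite rr.
  have r7' : regs s' 7 = c by rewrite rr.
  have St : static s' by case: T' => -[].
  have body : run W count_mono s' (fun s2 => [/\ tabling R s2, regs s2 9 = nmono a c k.+1 &
      forall i, i != 9 -> regs s2 i = regs s' i]).
    apply: (run_if (ev_mono St (ev_regE r6') (ev_regE r4) (ev_regE r7') an kn cn)) => M.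
      apply: (run_assign (v := nmono a c k + 1)).
        apply: ev_add => //; first exact: ev_regE.
        by have := nmono_le a c k; lia.
      split; first exact: tabling_reg.
        by rewrite /= /upd /= nmonoS M.
      by move=> i i9; rewrite /= /upd (negPf i9).
    by apply: run_skip; split=> //; rewrite nmonoS (negPf M) addn0.
  apply: wp_conseq (wp_run body) _ => t' s2 [ht' [T2 r92 rr2]]; split; first by rewrite rr2.
  split=> //.
  + by move: ht ht'; rewrite [expr_cost _]/= /ccount; set u := ccost _; nia.
  + by move=> i i4 i9; rewrite /= /upd (negPf i4) rr2 // rr.
- split=> //; first by rewrite /nmono big_ord0.
  by move=> i i4 i9; rewrite /= /upd (negPf i4).
- by move=> t s' [t0 -> [[ht T' r9' rr] _]]; split=> //; rewrite [expr_cost _]/=; lia.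
Qed.

(** The term [n + 1] pays for counting the triangles on the arc, which happens even when there are
    none. *)
Definition table_cost i := n + 1 + minn (nmono (arc i).1 (arc i).2 n * n) m.
Definition cfill := ccost fetch_arc + ccount + cvertex + 2 * carc + 100.

Lemma wp_fill_arc R s i : tabling R s -> i < 2 * m -> regs s 3 = i ->
  wp W fill_arc s (fun t s' => [/\ t <= cfill * table_cost i,
    tabling (marked R (arc i).1 (arc i).2 (beta_tab n lab (arc i).1 (arc i).2)) s' &
    regs s' 3 = i]).
Proof.
move=> T im r3; have [_ an cn] := arc_edge im.
have [[[r0 r1 r2 _] Ga] _ _] := T.
have [e1 e2] := Ga i im.
have iP : i <= P by lia.
have start : run W fetch_arc s (fun s' => [/\ tabling R s', regs s' 3 = i,
    regs s' 6 = (arc i).1, regs s' 7 = (arc i).2 & regs s' 9 = 0]).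
  rewrite /fetch_arc !block_cons block_nil.
  apply: run_seq; apply: (run_assign (v := (arc i).1)).
    by rewrite -e1; apply: ev_get => //; exact: ev_regE.
  apply: run_seq; apply: (run_assign (v := (arc i).2)).
    by rewrite -e2; apply: ev_get => //; exact: ev_regE.
  by apply: run_seq; apply: (run_assign (v := 0)).
apply: wp_seq; apply: wp_conseq (wp_run start) _ => t1 s1 [ht1 [T1 r3' r6 r7 r9]].
apply: wp_seq; apply: wp_conseq (wp_count T1 an cn r6 r7 r9) _ => t2 s2 [ht2 T2 r9' rr].
have [[[r0' r1' r2' _] _] _ _] := T2.
have nn := nmono_le (arc i).1 (arc i).2 n.
have test : eval W s2 (ltE (mulE (Reg 9) (Reg 0)) (Reg 1)) =
    Some (nmono (arc i).1 (arc i).2 n * n < m : nat).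
  apply: ev_lt => //; last exact: ev_regE.
  by apply: ev_mul; [exact: ev_regE|exact: ev_regE|nia].
have r6' : regs s2 6 = (arc i).1 by rewrite rr.
have r7' : regs s2 7 = (arc i).2 by rewrite rr.
have r3'' : regs s2 3 = i by rewrite rr.
have ec : expr_cost (ltE (mulE (Reg 9) (Reg 0)) (Reg 1)) = 5 by [].
eapply wp_if; [exact: test|move=> lt|move=> ge].
  apply: wp_conseq (wp_mark_vertices T2 an cn r6' r7') _ => t3 s3 [ht3 T3 e3].
  split=> //; last by rewrite e3.
  rewrite ec /table_cost (minn_idPl (ltnW lt)) /cfill; rewrite [n * nmono _ _ _]mulnC in ht3.
  move: ht1 ht2 ht3; move: (ccost fetch_arc) ccount cvertex carc (nmono _ _ _ * n).
  by move=> u1 u2 u3 u4 w h1 h2 h3; rewrite !mulnDl !mulnDr; lia.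
apply: wp_conseq (wp_mark_arcs T2 an cn r6' r7') _ => t3 s3 [ht3 T3 e3].
split=> //; last by rewrite e3.
rewrite -leqNgt in ge; rewrite ec /table_cost (minn_idPr ge) /cfill.
move: ht1 ht2 ht3; move: (ccost fetch_arc) ccount cvertex carc.
by move=> u1 u2 u3 u4 h1 h2 h3; rewrite !mulnDl !mulnDr; lia.
Qed.

Definition full_table a c b := E a c && beta_tab n lab a c b.

Lemma sum_tableS k :
  \sum_(i < k.+1) table_cost i = \sum_(i < k) table_cost i + table_cost k.
Proof. by rewrite big_ord_recr. Qed.

Lemma wp_fill_table s : tabling (fun _ _ _ => False) s ->
  wp W fill_table s (fun t s' => t <= (cfill + 20) * \sum_(i < 2 * m) table_cost i + 10 /\
    tabling full_table s').
Proof.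
move=> T; have mW : 2 * m < W by lia.
pose J k t s' := t <= (cfill + 20) * \sum_(i < k) table_cost i /\
    tabling (fun a c b => (a, c) \in arcs k /\ beta_tab n lab a c b) s'.
apply: wp_conseq (wp_for W_gt0 (J := J) mW _ _ _) _.
- by move=> k t s' _ [_ [[[_ r1 _ _] _] _ _]] _; apply: ev_two_m.
- move=> k t s' km [ht T'] r3.
  apply: wp_conseq (wp_fill_arc T' km r3) _ => t' s2 [ht' T2 r3']; split=> //; split.
  + rewrite sum_tableS (_ : expr_cost two_m = 3) //.
    have : 0 < table_cost k by rewrite /table_cost; lia.
    move: ht ht'; move: cfill (\sum_(i < k) _) (table_cost k) => u1 u2 u3 h1 h2 h3.
    by rewrite !mulnDl !mulnDr; rewrite mulnDl in h1; lia.
  + apply: tabling_reg => //; apply: tabling_sub T2.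
    move=> a c b _ _ _ [+ B]; rewrite arcsS mem_rcons in_cons => /orP [/eqP e|?].
      by right; rewrite -e.
    by left.
- split=> //; apply: tabling_reg => //.
  by apply: tabling_sub T => a c b _ _ _ [].
- move=> t s' [t0 -> [[ht T'] _]]; split; first by rewrite -[expr_cost two_m]/3; lia.
  by apply: tabling_sub T' => a c b _ _ _ /andP [Eac B]; rewrite mem_arcs.
Qed.

Definition tabled s := graph s /\ table full_table (memory s).

Lemma tabled_reg s i v : 3 <= i -> tabled s -> tabled (set_reg s i v).
Proof. by move=> i3 [G T]; split=> //; apply: graph_reg. Qed.

Lemma tabled_mem s h i v : 5 <= h < 16 -> tabled s -> tabled (set_mem s (cell h i) v).
Proof.
move=> hh [G T]; split; first by apply: graph_mem => //; lia.
move=> a c b an cn bn; rewrite /= arr_upd; try by lia.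
have -> : 4 == h = false by apply/eqP; lia.
exact: T.
Qed.

(** * A tentative run in memory *)

Definition chosen (sg : nat -> nat -> bool) M :=
  forall a b, a < n -> b < n -> arr M 5 (ix a b) = sg a b.

Definition run_mem r (q : seq (nat * nat)) st M :=
  (forall a b, a < n -> b < n -> (arr M 6 (ix a b * 2 + r) == st) = ((a, b) \in q)) /\
  forall k, k < size q -> arr M 7 (k * 2 + r) = (nth (0, 0) q k).1 /\
                          arr M 8 (k * 2 + r) = (nth (0, 0) q k).2.

(** No stamp exceeds the current one ([cf_max]), so the number of the next race is fresh. *)
Record conf sg st r q q' (d : bool) s := Conf {
  cf_tab : tabled s;
  cf_r : regs s 12 = r; cf_size : regs s 14 = size q; cf_dead : regs s 16 = d;
  cf_st : regs s 26 = st;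
  cf_chosen : chosen sg (memory s);
  cf_mem : run_mem r q st (memory s); cf_mem' : run_mem (1 - r) q' st (memory s);
  cf_max : forall x, arr (memory s) 6 x <= st }.

Lemma conf_reg sg st r q q' d s i v : 3 <= i -> i \notin [:: 12; 14; 16; 26] ->
  conf sg st r q q' d s -> conf sg st r q q' d (set_reg s i v).
Proof.
move=> i3; rewrite !inE !negb_or => /and4P [n12 n14 n16 n26] [T *].
split=> //; first exact: tabled_reg.
- by rewrite /= /upd eq_sym (negPf n12).
- by rewrite /= /upd eq_sym (negPf n14).
- by rewrite /= /upd eq_sym (negPf n16).
- by rewrite /= /upd eq_sym (negPf n26).
Qed.

Lemma tabled_regs s : tabled s -> [/\ regs s 0 = n, regs s 1 = m & regs s 2 = off].
Proof. by case=> -[[]]. Qed.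

Lemma ev_chosen sg s ea eb a b : tabled s -> chosen sg (memory s) ->
  eval W s ea = Some a -> eval W s eb = Some b ->
  a < n -> b < n -> eval W s (chosenE ea eb) = Some (sg a b : nat).
Proof.
move=> T Hc Ha Hb an bn; have [e0 e1 e2] := tabled_regs T; rewrite -Hc //.
by apply: ev_get => //; [apply: ev_pair => //|]; apply: ix_le.
Qed.

Section Conf.
Variables (sg : nat -> nat -> bool) (st r : nat) (q q' : seq (nat * nat)) (d : bool) (s : state).
Hypotheses (cf : conf sg st r q q' d s) (r2 : r < 2).

Lemma conf_regs : [/\ regs s 0 = n, regs s 1 = m & regs s 2 = off].
Proof. by have [[[[]]]] := cf. Qed.

Lemma ev_stamp ea eb a b : eval W s ea = Some a -> eval W s eb = Some b ->
  a < n -> b < n ->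
  eval W s (addE (mulE (pairE ea eb) (Cst 2)) (Reg 12)) = Some (ix a b * 2 + r).
Proof.
have [e0 e1 e2] := conf_regs => Ha Hb an bn; have ab := ix_lt an bn.
apply: ev_add; last by lia.
  by apply: ev_mul => //; [apply: ev_pair => //; apply: ix_le|lia].
exact: ev_regE (cf_r cf).
Qed.

Lemma ev_known ea eb a b : eval W s ea = Some a -> eval W s eb = Some b ->
  a < n -> b < n -> eval W s (knownE ea eb) = Some (known sg q a b : nat).
Proof.
move=> Ha Hb an bn; apply: ev_or => //; first exact: (ev_chosen (cf_tab cf) (cf_chosen cf)).
rewrite -(proj1 (cf_mem cf)) //; apply: ev_eq => //; last exact: ev_regE (cf_st cf).
have [e0 e1 e2] := conf_regs.
by apply: ev_get => //; [apply: ev_stamp|apply: ixr_le].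
Qed.

Lemma ev_slot e k : eval W s e = Some k -> k <= 2 * m + 2 ->
  eval W s (slotE e) = Some (k * 2 + r).
Proof.
move=> He k2; apply: ev_add; [|exact: ev_regE (cf_r cf)|by lia].
by apply: ev_mul => //; lia.
Qed.

(** The slack of one over [2 * m] serves the second call within a single [advance], when the first
    may have appended an arc. *)
Lemma run_force a b : a < n -> b < n -> size q <= 2 * m + 1 ->
  regs s 23 = a -> regs s 24 = b ->
  run W force_cmd s (fun s' =>
    conf sg st r (force sg (q, d) a b).1 q' (force sg (q, d) a b).2 s' /\
    forall i, i != 14 -> i != 16 -> regs s' i = regs s i).
Proof.
move=> an bn sq r23 r24; have [e0 e1 e2] := conf_regs.
have E23 := ev_regE r23; have E24 := ev_regE r24.
rewrite /force /=.
apply: (run_if (ev_known E24 E23 bn an)) => [K|/negPf ->].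
  rewrite K; apply: (run_assign (v := 1)) => //; split; last first.
    by move=> i i14 i16; rewrite /= /upd (negPf i16).
  by case: cf => T *; split=> //; apply: tabled_reg.
apply: (run_if (ev_known E23 E24 an bn)) => [->|/negPf K]; first by apply: run_skip.
have abq : (a, b) \notin q by move: K; rewrite /known; case: (_ \in q); rewrite ?orbT.
rewrite K !block_cons block_nil.
have es' s' : regs s' = regs s ->
    eval W s' (addE (mulE (pairE (Reg 23) (Reg 24)) (Cst 2)) (Reg 12)) = Some (ix a b * 2 + r).
  by move=> e; rewrite (@eval_fetch_free _ _ s) // (ev_stamp E23 E24).
have el s' : regs s' = regs s -> eval W s' (slotE (Reg 14)) = Some (size q * 2 + r).
  by move=> e; rewrite (@eval_fetch_free _ _ s) // (ev_slot (ev_regE (cf_size cf))) //; lia.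
apply: run_seq; eapply run_put; [exact: e2|by []|exact: es'|exact: ixr_le|exact: ev_regE (cf_st cf)|].
apply: run_seq; eapply run_put; [exact: e2|by []|exact: el|by lia|exact: E23|].
apply: run_seq; eapply run_put; [exact: e2|by []|exact: el|by lia|exact: E24|].
apply: run_seq; apply: (run_assign (v := (size q).+1)).
  rewrite -[(size q).+1]addn1; apply: ev_add => //; [exact: ev_regE (cf_size cf)|by lia].
apply: run_skip; split; last by move=> i i14 i16; rewrite /= /upd (negPf i14).
case: cf => T c12 c14 c16 c26 Hc Hm Hm' Hx; split=> //=.
- by apply: tabled_reg => //; do 3!apply: tabled_mem => //.
- by rewrite size_rcons.
- by move=> x y xn yn; rewrite !arr_upd //= Hc.
- have [H1 H2] := Hm; split.
    move=> x y xn yn; rewrite !arr_upd //= mem_rcons in_cons xpair_eqE -ix_eq // -H1 //.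
    have -> : (ix x y * 2 + r == ix a b * 2 + r) = (ix x y == ix a b).
      by rewrite eqn_add2r eqn_pmul2r.
    by case: (ix x y == ix a b); rewrite ?eqxx.
  move=> k; rewrite size_rcons ltnS => kq; rewrite !arr_upd //= nth_rcons.
  have -> : (k * 2 + r == size q * 2 + r) = (k == size q) by rewrite eqn_add2r eqn_pmul2r.
  by move: kq; case: ltngtP => // kq _; apply: H2.
- have [H1 H2] := Hm'; split.
    move=> x y xn yn; rewrite !arr_upd //= -H1 //.
    (* Cells of the two runs have opposite parity, so the other run is untouched. *)
    by rewrite (_ : _ == ix a b * 2 + r = false) //; apply/eqP; lia.
  move=> k kq; rewrite !arr_upd //=.
  have -> : (k * 2 + (1 - r) == size q * 2 + r) = false by apply/eqP; lia.
  exact: H2.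
- by move=> x; rewrite !arr_upd //=; case: ifP.
Qed.
End Conf.

Lemma run_advance sg st r q q' s h w : conf sg st r q q' false s -> r < 2 ->
  (forall u, u \in q -> E u.1 u.2) -> size q <= 2 * m -> h < size q -> w < n ->
  regs s 13 = h -> regs s 15 = w ->
  let a := advance n lab sg q h w in
  run W advance_cmd s (fun s' => [/\ conf sg st r a.1 q' a.2 s',
    regs s' 13 = next_h n h w, regs s' 15 = next_w n w &
    forall i, i \notin [:: 13; 14; 15; 16; 21; 22; 23; 24] -> regs s' i = regs s i]).
Proof.
move=> cf r2 qE sq hq wn r13 r15 a.
have uq := mem_nth (0, 0) hq.
set x := (nth (0, 0) q h).1; set y := (nth (0, 0) q h).2.
have nE : nth (0, 0) q h = (x, y) by rewrite /x /y -surjective_pairing.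
have Exy : E x y by apply: qE uq.
have xn : x < n by apply: En Exy.
have yn : y < n by apply: (@En y x); rewrite Esym.
have [e0 e1 e2] := conf_regs cf.
have [Hx Hy] := proj2 (cf_mem cf) h hq.
rewrite /advance_cmd !block_cons block_nil.
apply: run_seq; apply: (run_assign (v := x)).
  rewrite /x -Hx; apply: ev_get => //; last by lia.
  by apply: (ev_slot cf r2); [exact: ev_regE|lia].
set s1 := set_reg _ 21 _.
have cf1 : conf sg st r q q' false s1 by apply: conf_reg.
apply: run_seq; apply: (run_assign (v := y)).
  rewrite /y -Hy; apply: ev_get => //; last by lia.
  by apply: (ev_slot cf1 r2); [exact: ev_regE|lia].
set s2 := set_reg _ 22 _.
have cf2 : conf sg st r q q' false s2 by apply: conf_reg.
have St2 : static s2 by case: (cf_tab cf2) => -[].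
have E21 s' : regs s' 21 = x -> eval W s' (Reg 21) = Some x := @ev_regE s' 21 x.
have E22 s' : regs s' 22 = y -> eval W s' (Reg 22) = Some y := @ev_regE s' 22 y.
have E15 s' : regs s' 15 = w -> eval W s' (Reg 15) = Some w := @ev_regE s' 15 w.
have ein : eval W s2 (orE (fbdE (Reg 21) (Reg 22) (Reg 15))
    (andE (monoE (Reg 21) (Reg 22) (Reg 15)) (knownE (Reg 15) (Reg 21)))) =
    Some (step_in lab sg q x y w : nat).
  apply: ev_or => //; first by apply: ev_fbd => //; (exact: E21 || exact: E22 || exact: E15).
  apply: ev_and => //; first by apply: ev_mono => //; (exact: E21 || exact: E22 || exact: E15).
  by apply: (ev_known cf2 r2) => //; (exact: E21 || exact: E22 || exact: E15).
pose a1 := if step_in lab sg q x y w then force sg (q, false) w y else (q, false).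
have in1 : run W step_in_cmd s2 (fun s' => [/\ conf sg st r a1.1 q' a1.2 s',
    size a1.1 <= 2 * m + 1 &
    forall i, i \notin [:: 14; 16; 23; 24] -> regs s' i = regs s2 i]).
  rewrite /a1; apply: (run_if ein) => [->|/negPf ->]; last by apply: run_skip; split=> //=; lia.
  rewrite !block_cons block_nil.
  apply: run_seq; apply: (run_assign (v := w)); first exact: E15.
  apply: run_seq; apply: (run_assign (v := y)); first exact: E22.
  set s3 := set_reg _ 24 _.
  have cf3 : conf sg st r q q' false s3 by do 2!apply: conf_reg => //.
  have sq' : size q <= 2 * m + 1 by lia.
  apply: run_seq; apply: run_conseq (run_force cf3 r2 wn yn sq' erefl erefl) _.
  move=> s4 [cf4 rr]; apply: run_skip; split=> //.
    by rewrite /force /=; case: ifP => // _; case: ifP => //= _; rewrite ?size_rcons; lia.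
  move=> i; rewrite !inE !negb_or => /and4P [n14 n16 n23 n24].
  by rewrite rr //= /upd (negPf n23) (negPf n24).
apply: run_seq; apply: run_conseq in1 _ => s3 [cf3 sq1 rr3].
have St3 : static s3 by case: (cf_tab cf3) => -[].
have r21 : regs s3 21 = x by rewrite rr3.
have r22 : regs s3 22 = y by rewrite rr3.
have r15' : regs s3 15 = w by rewrite rr3.
have [f0 f1 f2] := conf_regs cf3.
have eout : eval W s3 (orE (fbdE (Reg 15) (Reg 21) (Reg 22))
       (orE (andE (monoE (Reg 21) (Reg 22) (Reg 15)) (knownE (Reg 22) (Reg 15)))
            (getE 4 (pairE (pairE (Reg 21) (Reg 22)) (Reg 15))))) =
    Some (step_out n lab sg a1.1 x y w : nat).
  apply: ev_or => //; first by apply: ev_fbd => //; (exact: E21 || exact: E22 || exact: E15).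
  apply: ev_or => //.
    apply: ev_and => //; first by apply: ev_mono => //; (exact: E21 || exact: E22 || exact: E15).
    by apply: (ev_known cf3 r2) => //; (exact: E21 || exact: E22 || exact: E15).
  have [v [ev v1 v2]] := proj2 (cf_tab cf3) x y w xn yn wn.
  have <- : v = beta_tab n lab x y w.
    by apply/idP/idP => // B; apply: v2; rewrite /full_table Exy.
  rewrite -ev; apply: ev_get => //; last exact: ix3_le.
  apply: ev_pair => //; [|by exact: E15|by exact: ix3_le].
  by apply: ev_pair => //; [exact: E21|exact: E22|exact: ix_le].
have aE : a = if step_out n lab sg a1.1 x y w then force sg a1 x w else a1.
  by rewrite /a /advance nE.
have out1 : run W step_out_cmd s3 (fun s' => conf sg st r a.1 q' a.2 s' /\
    forall i, i \notin [:: 14; 16; 23; 24] -> regs s' i = regs s3 i).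
  rewrite aE; apply: (run_if eout) => [->|/negPf ->]; last by apply: run_skip.
  rewrite !block_cons block_nil.
  apply: run_seq; apply: (run_assign (v := x)); first exact: E21.
  apply: run_seq; apply: (run_assign (v := w)); first exact: E15.
  set s4 := set_reg _ 24 _.
  have cf4 : conf sg st r a1.1 q' a1.2 s4 by do 2!apply: conf_reg => //.
  apply: run_seq; apply: run_conseq (run_force cf4 r2 xn wn sq1 erefl erefl) _.
  move=> s5; rewrite -surjective_pairing => -[cf5 rr]; apply: run_skip; split=> //.
  move=> i; rewrite !inE !negb_or => /and4P [n14 n16 n23 n24].
  by rewrite rr //= /upd (negPf n23) (negPf n24).
apply: run_seq; apply: run_conseq out1 _ => s4 [cf4 rr4].
have r15'' : regs s4 15 = w by rewrite rr4.
have r13'' : regs s4 13 = h by rewrite rr4 // rr3.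
have [g0 g1 g2] := conf_regs cf4.
apply: run_seq; apply: (run_assign (v := w.+1)).
  by rewrite -[w.+1]addn1; apply: ev_add => //; [exact: E15|lia].
set s5 := set_reg _ 15 _.
have cf5 : conf sg st r a.1 q' a.2 s5 by apply: conf_reg.
have ew : eval W s5 (eqE (Reg 15) (Reg 0)) = Some (w.+1 == n : nat).
  by apply: ev_eq => //; apply: ev_regE.
have frame i : i \notin [:: 13; 14; 15; 16; 21; 22; 23; 24] ->
    regs s4 i = regs s i /\ (i == 13 = false) /\ (i == 15 = false).
  rewrite !inE !negb_or.
  move=> /and5P [n13 n14 n15 n16 /and4P [n21 n22 n23 n24]].
  rewrite (negPf n13) (negPf n15); split=> //.
  rewrite rr4 ?inE ?negb_or ?n14 ?n16 ?n23 // rr3 ?inE ?negb_or ?n14 ?n16 ?n23 //.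
  by rewrite /= /upd (negPf n21) (negPf n22).
apply: run_seq; apply: (run_if ew) => wn'.
  rewrite /next_h /next_w wn'.
  apply: run_seq; apply: (run_assign (v := 0)) => //.
  apply: run_seq; apply: (run_assign (v := h.+1)).
    by rewrite -[h.+1]addn1; apply: ev_add => //; [exact: ev_regE|lia].
  do 2!apply: run_skip; split=> //.
    by do 2!apply: conf_reg => //.
  by move=> i /frame [<- [n13 n15]]; rewrite /= /upd n13 n15.
rewrite /next_h /next_w (negPf wn'); do 2!apply: run_skip; split=> //.
by move=> i /frame [<- [n13 n15]]; rewrite /= /upd n15.
Qed.

(** * The alternating race of the two directions *)

Implicit Type sg : nat -> nat -> bool.
Record race_st sg i r q h w (d : bool) q' h' w' (d' : bool) s := RaceSt {
  rs_conf : conf sg i.+1 r q q' d s;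
  rs_h : regs s 13 = h; rs_w : regs s 15 = w; rs_h' : regs s 17 = h';
  rs_q' : regs s 18 = size q'; rs_w' : regs s 19 = w'; rs_d' : regs s 20 = d';
  rs_fail : regs s 11 = 0; rs_i : regs s 3 = i }.

Lemma run_swap_regs s : run W swap_cmd s (fun s' =>
  [/\ memory s' = memory s, regs s' 12 = 1 - regs s 12,
      [/\ regs s' 13 = regs s 17, regs s' 14 = regs s 18, regs s' 15 = regs s 19 &
          regs s' 16 = regs s 20],
      [/\ regs s' 17 = regs s 13, regs s' 18 = regs s 14, regs s' 19 = regs s 15 &
          regs s' 20 = regs s 16] &
      forall i, i \notin [:: 12; 13; 14; 15; 16; 17; 18; 19; 20; 25] -> regs s' i = regs s i]).
Proof.
rewrite /swap_cmd !block_cons block_nil.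
have er s' k v : regs s' k = v -> eval W s' (Reg k) = Some v by move=> <-.
apply: run_seq; apply: (run_assign (v := regs s 13)); first exact: er.
apply: run_seq; apply: (run_assign (v := regs s 17)); first exact: er.
apply: run_seq; apply: (run_assign (v := regs s 13)); first exact: er.
apply: run_seq; apply: (run_assign (v := regs s 14)); first exact: er.
apply: run_seq; apply: (run_assign (v := regs s 18)); first exact: er.
apply: run_seq; apply: (run_assign (v := regs s 14)); first exact: er.
apply: run_seq; apply: (run_assign (v := regs s 15)); first exact: er.
apply: run_seq; apply: (run_assign (v := regs s 19)); first exact: er.
apply: run_seq; apply: (run_assign (v := regs s 15)); first exact: er.
apply: run_seq; apply: (run_assign (v := regs s 16)); first exact: er.
apply: run_seq; apply: (run_assign (v := regs s 20)); first exact: er.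
apply: run_seq; apply: (run_assign (v := regs s 16)); first exact: er.
apply: run_seq; apply: (run_assign (v := 1 - regs s 12)); first by apply: ev_compl => //; exact: er.
apply: run_skip; split; try (split; exact: erefl); try exact: erefl.
move=> i; rewrite !inE !negb_or => /and5P [n12 n13 n14 n15 /and5P [n16 n17 n18 n19 /andP [n20 n25]]].
by rewrite /= /upd (negPf n12) (negPf n13) (negPf n14) (negPf n15) (negPf n16) (negPf n17)
  (negPf n18) (negPf n19) (negPf n20) (negPf n25).
Qed.

Lemma tabled_eq s s' : (forall i, i < 3 -> regs s' i = regs s i) -> memory s' = memory s ->
  tabled s -> tabled s'.
Proof. by rewrite /tabled /graph /static => rr ->; rewrite !rr. Qed.

Lemma run_swap sg i r q h w d q' h' w' d' s : r < 2 ->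
  race_st sg i r q h w d q' h' w' d' s ->
  run W swap_cmd s (race_st sg i (1 - r) q' h' w' d' q h w d).
Proof.
move=> r2 [[T c12 c14 c16 c26 Hc Hm Hm' Hx] eh ew eh' eq' ew' ed' ef ei].
apply: run_conseq (run_swap_regs s) _ => s' [eM e12 [e13 e14 e15 e16] [e17 e18 e19 e20] rr].
have r2' : 1 - (1 - r) = r by lia.
split; rewrite ?e13 ?e15 ?e17 ?e18 ?e19 ?e20 ?rr //.
split; rewrite ?e12 ?e14 ?e16 ?c12 ?r2' ?eM ?rr //.
by apply: tabled_eq T => // j j3; apply: rr; rewrite !inE; lia.
Qed.

Definition race_start (u : nat * nat) r := if r == 0 then u else (u.2, u.1).

(** The position [h * n + w] counts the steps of a run. As the runs alternate, the iterations number
    at most twice this for a live run, plus one for the run about to move. An iteration takes place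
    only while some run is alive, and a live run has position below [2 m n + n]; this yields
    [ri_max]. *)
Record race_inv (sg : nat -> nat -> bool) u it r q h w (d : bool) q' h' w' (d' : bool) := RaceInv {
  ri_r : r < 2;
  ri_run : run_inv n lab sg (race_start u r) q h w d;
  ri_run' : run_inv n lab sg (race_start u (1 - r)) q' h' w' d';
  ri_it : ~~ d -> it <= 2 * (h * n + w) + 1;
  ri_it' : ~~ d' -> it <= 2 * (h' * n + w');
  ri_max : it <= 4 * (m * n) + 2 * n + 4 }.

Lemma lab_gt0 a b : (0 < lab a b) = E a b.
Proof. by rewrite /lab; case: (E a b). Qed.

Lemma lab_sym a b : lab a b = lab b a.
Proof. by rewrite /lab (Esym b a); case Eab: (E a b) => //; rewrite Lsym. Qed.

Hypothesis Eirr : forall a, E a a = false.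

Lemma lab_xx a : lab a a = 0.
Proof. by rewrite /lab Eirr. Qed.

Lemma lab_bound a b : 0 < lab a b -> a < n.
Proof. by rewrite lab_gt0; apply: En. Qed.

Lemma uniq_size (q : seq (nat * nat)) : uniq q -> (forall u, u \in q -> E u.1 u.2) ->
  size q <= 2 * m.
Proof.
move=> uq qE; rewrite -[2 * m](size_mkseq arc); apply: uniq_leq_size => // u /qE.
by rewrite -mem_arcs -surjective_pairing.
Qed.

Lemma wf_edges sg x q : wf lab sg x q -> forall u, u \in q -> E u.1 u.2.
Proof. by move=> [_ _ H] u /H [p _ _ _ _]; rewrite -lab_gt0. Qed.

Lemma wf_size sg x q : wf lab sg x q -> size q <= 2 * m.
Proof. by move=> H; apply: uniq_size; [case: H|apply: wf_edges H]. Qed.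

Definition crace := ccost race_body + expr_cost race_cond + 1.

Definition race_end sg i u t s := exists it r q h w d q' h' w' d',
  [/\ race_st sg i r q h w d q' h' w' d' s,
      race_inv sg u it r q h w d q' h' w' d', t <= crace * (it + 1) &
      (d && d') || (~~ d && (size q <= h))].

Lemma run_race_body sg i u it r q h w d q' h' w' d' s :
  race_st sg i r q h w d q' h' w' d' s -> race_inv sg u it r q h w d q' h' w' d' ->
  ~~ (d && d') -> d || (h < size q) ->
  run W race_body s (fun s' => exists q1 h1 w1 d1,
    race_st sg i (1 - r) q' h' w' d' q1 h1 w1 d1 s' /\
    race_inv sg u it.+1 (1 - r) q' h' w' d' q1 h1 w1 d1).
Proof.
move=> R I nd hq; have [r2 Ir Ir' Hit Hit' Hm] := I.
have s2 := wf_size (let: And4 H _ _ _ := Ir in H).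
have s2' := wf_size (let: And4 H _ _ _ := Ir' in H).
have [_ hq1 wn _] := Ir; have [_ hq1' wn' _] := Ir'.
rewrite /race_body !block_cons block_nil.
have ed : eval W s (Reg 16) = Some (d : nat) by apply: ev_regE; apply: cf_dead (rs_conf R).
apply: run_seq; apply: (run_if ed) => Hd.
  apply: run_skip; apply: run_seq; apply: run_conseq (run_swap r2 R) _ => s' R'.
  apply: run_skip; exists q, h, w, d; split=> //.
  have r2' : 1 - (1 - r) = r by lia.
  have nd' : ~~ d' by move: nd; rewrite Hd.
  split=> //; rewrite ?r2' //; first by lia.
  - by move/Hit'; lia.
  - by rewrite Hd.
  - have hm : h' * n <= 2 * m * n by rewrite leq_mul2r (leq_trans hq1' s2') orbT.
    by have := Hit' nd'; lia.
have hlt : h < size q by move: hq; rewrite (negPf Hd).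
have d0 : d = false := negbTE Hd.
subst d.
have R0 := R; case: R0 => cf eh ew eh' eq' ew' ed' ef ei.
have adv := run_advance cf r2 (wf_edges (let: And4 H _ _ _ := Ir in H)) s2 hlt wn eh ew.
apply: run_conseq adv _ => s1 [cf1 e13 e15 rr].
have := advance_inv lab_sym lab_xx lab_bound Ir hlt.
set a := advance _ _ _ _ _ _ in cf1 *; move=> [Ia _].
have R1 : race_st sg i r a.1 (next_h n h w) (next_w n w) a.2 q' h' w' d' s1.
  by split=> //; rewrite rr.
apply: run_seq; apply: run_conseq (run_swap r2 R1) _ => s' R'.
apply: run_skip; exists a.1, (next_h n h w), (next_w n w), a.2; split=> //.
have r2' : 1 - (1 - r) = r by lia.
have wk : next_h n h w * n + next_w n w = h * n + w + 1.
  by rewrite /next_h /next_w; case: eqP => [<-|_]; rewrite ?mulSn; lia.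
split=> //; rewrite ?r2' //; first by lia.
- by move/Hit'; lia.
- by move=> _; rewrite wk; have := Hit isT; lia.
- have hm : h * n <= 2 * m * n by rewrite leq_mul2r (leq_trans (ltnW hlt) s2) orbT.
  by have := Hit isT; lia.
Qed.

Lemma wp_race_loop sg i u r q h w d q' h' w' d' s :
  race_st sg i r q h w d q' h' w' d' s -> race_inv sg u 0 r q h w d q' h' w' d' ->
  wp W (While race_cond race_body) s (race_end sg i u).
Proof.
move=> R0 I0.
pose I f t s := exists it r q h w d q' h' w' d',
  [/\ race_st sg i r q h w d q' h' w' d' s, race_inv sg u it r q h w d q' h' w' d',
      t <= crace * it & f + it = 4 * (m * n) + 2 * n + 4].
apply: (@wp_while _ _ _ I _ _ (4 * (m * n) + 2 * n + 4)); last first.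
  by exists 0, r, q, h, w, d, q', h', w', d'; split=> //; rewrite ?muln0 ?addn0.
move=> {R0 I0} f t {}s [it [{}r [{}q [{}h [{}w [{}d [{}q' [{}h' [{}w' [{}d' [R J ht hf]]]]]]]]]]].
exists (~~ (d && d') && (d || (h < size q))).
  have ed : eval W s (Reg 16) = Some (d : nat) by apply: ev_regE; apply: cf_dead (rs_conf R).
  have ed' : eval W s (Reg 20) = Some (d' : nat) by apply: ev_regE; apply: rs_d' R.
  apply: ev_and => //; first by apply: ev_not => //; apply: ev_and.
  apply: ev_or => //; apply: ev_lt => //; apply: ev_regE; first exact: rs_h R.
  exact: cf_size (rs_conf R).
case: ifP => [/andP [nd hq]|/negbT].
  apply: wp_conseq (wp_run (run_race_body R J nd hq)) _.
  move=> t' s' [ht' [q1 [h1 [w1 [d1 [R1 J1]]]]]].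
  have := ri_max J1 => itm.
  exists f.-1; first by lia.
  exists it.+1, (1 - r), q', h', w', d', q1, h1, w1, d1; split=> //; last by lia.
  by move: ht ht'; rewrite mulnS /crace; move: (ccost race_body) (expr_cost race_cond) => u1 u2; lia.
rewrite negb_and negbK => ex.
exists it, r, q, h, w, d, q', h', w', d'; split=> //.
  rewrite mulnDr muln1; move: ht; rewrite /crace.
  by move: (ccost race_body) (expr_cost race_cond) => u1 u2; lia.
by move: ex; case: (d) => //=; rewrite -leqNgt.
Qed.

Lemma run_start_run st s a b r : tabled s -> a < n -> b < n -> r < 2 ->
  regs s 6 = a -> regs s 7 = b -> regs s 12 = r -> regs s 26 = st ->
  (forall x, arr (memory s) 6 x <= st) ->
  (forall x y, x < n -> y < n -> arr (memory s) 6 (ix x y * 2 + r) != st) ->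
  run W start_run s (fun s' => [/\ tabled s',
    (regs s' 13 = 0 /\ regs s' 14 = 1) /\ (regs s' 15 = 0 /\ regs s' 16 = 0),
    run_mem r [:: (a, b)] st (memory s'),
    (forall x, arr (memory s') 6 x <= st) /\
    (forall i, i \notin [:: 13; 14; 15; 16] -> regs s' i = regs s i) &
    [/\ forall x, arr (memory s') 5 x = arr (memory s) 5 x,
        forall q, run_mem (1 - r) q st (memory s) -> run_mem (1 - r) q st (memory s') &
        forall x, x != ix a b * 2 + r -> arr (memory s') 6 x = arr (memory s) 6 x]]).
Proof.
move=> T an bn r2 r6 r7 r12 r26 Hx Hne.
have [e0 e1 e2] : [/\ regs s 0 = n, regs s 1 = m & regs s 2 = off] by have [[[]]] := T.
have ab := ix_lt an bn.
have es' s' : regs s' = regs s ->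
    eval W s' (addE (mulE (pairE (Reg 6) (Reg 7)) (Cst 2)) (Reg 12)) = Some (ix a b * 2 + r).
  move=> e; rewrite (@eval_fetch_free _ _ s) //.
  apply: ev_add; [|exact: ev_regE|by lia].
  apply: ev_mul => //; last by lia.
  by apply: ev_pair => //; [exact: ev_regE|exact: ev_regE|exact: ix_le].
have el s' : regs s' = regs s -> eval W s' (slotE (Cst 0)) = Some r.
  by move=> e; rewrite (@eval_fetch_free _ _ s) // /slotE /eval /= r12 !ifT //; lia.
rewrite /start_run !block_cons block_nil.
apply: run_seq; eapply run_put; [exact: e2|by []|exact: es'|exact: ixr_le|exact: ev_regE r26|].
apply: run_seq; eapply run_put; [exact: e2|by []|exact: el|by lia|exact: ev_regE r6|].
apply: run_seq; eapply run_put; [exact: e2|by []|exact: el|by lia|exact: ev_regE r7|].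
apply: run_seq; apply: (run_assign (v := 0)); first by [].
apply: run_seq; apply: (run_assign (v := 1)); first by [].
apply: run_seq; apply: (run_assign (v := 0)); first by [].
apply: run_seq; apply: (run_assign (v := 0)); first by [].
apply: run_skip; split=> //.
- by do 4!apply: tabled_reg => //; do 3!apply: tabled_mem => //.
- split.
    move=> x y xn yn; rewrite /= !arr_upd //= inE xpair_eqE -ix_eq // eqn_add2r eqn_pmul2r //.
    by case: (ix x y == ix a b); rewrite ?eqxx // (negPf (Hne _ _ xn yn)).
  by case=> // _; rewrite /= !arr_upd //= mul0n add0n eqxx.
- split; first by move=> x; rewrite /= !arr_upd //=; case: ifP.
  move=> i; rewrite !inE !negb_or => /and4P [n13 n14 n15 n16].
  by rewrite /= /upd (negPf n13) (negPf n14) (negPf n15) (negPf n16).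
- split.
  + by move=> x; rewrite /= !arr_upd.
  + move=> q [H1 H2]; split.
      move=> x y xn yn; rewrite /= !arr_upd //= -H1 //.
      by rewrite (_ : _ == ix a b * 2 + r = false) //; apply/eqP; lia.
    move=> k kq; rewrite /= !arr_upd //=.
    have -> : (k * 2 + (1 - r) == r) = false by apply/eqP; lia.
    exact: H2.
  + by move=> x ne; rewrite /= !arr_upd //= (negPf ne).
Qed.

Lemma run_start_race sg i s a b : tabled s -> a < n -> b < n -> i < m ->
  regs s 3 = i -> regs s 6 = a -> regs s 7 = b -> regs s 11 = 0 ->
  chosen sg (memory s) -> (forall x, arr (memory s) 6 x <= i) ->
  run W start_race s (race_st sg i 1 [:: (b, a)] 0 0 false [:: (a, b)] 0 0 false).
Proof.
move=> T an bn im r3 r6 r7 r11 Hc Hx.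
have [e0 e1 e2] : [/\ regs s 0 = n, regs s 1 = m & regs s 2 = off] by have [[[]]] := T.
rewrite /start_race /swap_cmd !block_cons block_nil.
apply: run_seq; apply: (run_assign (v := i.+1)).
  by rewrite -[i.+1]addn1; apply: ev_add => //; [exact: ev_regE|lia].
apply: run_seq; apply: (run_assign (v := 0)); first by [].
set s1 := set_reg _ 12 _.
have T1 : tabled s1 by do 2!apply: tabled_reg => //.
have ne1 x : arr (memory s) 6 x != i.+1 by apply/eqP; have := Hx x; lia.
have le1 x : arr (memory s) 6 x <= i.+1 by apply: leq_trans (Hx x) _.
apply: run_seq; apply: run_conseq (run_start_run T1 an bn (_ : 0 < 2) r6 r7 erefl erefl _ _) _ => //.
move=> s2 [T2 [[r13 r14] [r15 r16]] M2 [le2 rr2] [G2 _ ne2]].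
have er s' k : eval W s' (Reg k) = Some (regs s' k) by [].
do 3 (apply: run_seq; apply: (run_assign (er _ _))).
set s3 := set_reg _ 7 _.
have q6 : regs s3 6 = b by rewrite /s3 /= /upd /= rr2.
have q7 : regs s3 7 = a by rewrite /s3 /= /upd /= rr2.
have T3 : tabled s3 by do 3!apply: tabled_reg => //.
have k3 k : k \in [:: 3; 11; 12; 26] -> regs s3 k = regs s1 k.
  by rewrite !inE => /or4P [] /eqP ->; rewrite /s3 /= /upd /= rr2.
apply: run_seq; apply: run_conseq (run_swap_regs s3) _.
move=> s4 [M4 r12 _ [r17 r18 r19 r20] rr4].
have {}r17 : regs s4 17 = 0 by rewrite r17.
have {}r18 : regs s4 18 = 1 by rewrite r18.
have {}r19 : regs s4 19 = 0 by rewrite r19.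
have {}r20 : regs s4 20 = 0 by rewrite r20.
have {}r12 : regs s4 12 = 1 by rewrite r12 k3.
have T4 : tabled s4 by apply: tabled_eq T3 => // j j3; apply: rr4; rewrite !inE; lia.
have {}M4 : memory s4 = memory s2 by [].
have ne4 x y : x < n -> y < n -> arr (memory s4) 6 (ix x y * 2 + 1) != i.+1.
  by move=> xn yn; rewrite M4 ne2 //; apply/eqP; lia.
have r26 : regs s4 26 = i.+1 by rewrite rr4 // k3.
have s46 : regs s4 6 = b by rewrite rr4.
have s47 : regs s4 7 = a by rewrite rr4.
have le4 x : arr (memory s4) 6 x <= i.+1 by rewrite M4.
apply: run_seq; apply: run_conseq (run_start_run T4 bn an (_ : 1 < 2) s46 s47 r12 r26 le4 ne4) _ => //.
move=> s5 [T5 [[p13 p14] [p15 p16]] M5 [le5 rr5] [G5 O5 ne5]].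
apply: run_skip; split=> //; rewrite ?rr5 ?r17 ?r18 ?r19 ?r20 ?rr4 ?k3 //.
split=> //; rewrite ?rr5 //.
- by move=> x y xn yn; rewrite G5 M4 G2 Hc.
- by apply: O5; rewrite M4.
Qed.

Definition ccommit := ccost commit_arc + 20.

Lemma wp_commit sg i r q q' h w h' w' d' s : r < 2 -> uniq q ->
  (forall u, u \in q -> E u.1 u.2) ->
  race_st sg i r q h w false q' h' w' d' s ->
  wp W (For 4 (Reg 14) commit_arc) s (fun t s' => [/\ tabled s', chosen (known sg q) (memory s'),
     regs s' 3 = i /\ regs s' 11 = 0, forall x, arr (memory s') 6 x <= i.+1 &
     t <= ccommit * size q + 6]).
Proof.
move=> r2 uq qE [cf eh ew eh' eq' ew' ed' ef ei].
have sq := uniq_size uq qE.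
have qW : size q < W by apply: leq_ltn_trans sq _; lia.
pose J k t s' := [/\ tabled s' /\ t <= ccommit * k, chosen (known sg (take k q)) (memory s'),
  [/\ regs s' 3 = i, regs s' 11 = 0, regs s' 12 = r & regs s' 14 = size q],
  forall x, arr (memory s') 6 x <= i.+1 &
  forall k, k < size q -> arr (memory s') 7 (k * 2 + r) = (nth (0, 0) q k).1 /\
                          arr (memory s') 8 (k * 2 + r) = (nth (0, 0) q k).2].
apply: wp_conseq (wp_for W_gt0 (J := J) qW _ _ _) _.
- by move=> k t s' _ [_ _ [_ _ _ e]] _ _ _; apply: ev_regE.
- move=> k t s' kq [[T ht] Hc [e3 e11 e12 e14] Hx Hq] r4.
  have [e0 e1 e2] : [/\ regs s' 0 = n, regs s' 1 = m & regs s' 2 = off] by have [[[]]] := T.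
  have [H7 H8] := Hq k kq.
  have k2 : k < 2 * m by apply: leq_trans kq sq.
  have uin := mem_nth (0, 0) kq.
  have Euv := qE _ uin.
  have un := En Euv; have vn : (nth (0, 0) q k).2 < n by rewrite Esym in Euv; apply: En Euv.
  have el : eval W s' (slotE (Reg 4)) = Some (k * 2 + r).
    apply: ev_add; [|exact: ev_regE|by lia].
    by apply: ev_mul => //; [exact: ev_regE|lia].
  have body : run W commit_arc s' (fun s2 => regs s2 = regs s' /\
      J k.+1 (t + ccommit) s2).
    have ea : eval W s' (pairE (getE 7 (slotE (Reg 4))) (getE 8 (slotE (Reg 4)))) =
        Some (ix (nth (0, 0) q k).1 (nth (0, 0) q k).2).
      apply: ev_pair => //; last exact: ix_le.
        by rewrite -H7; apply: ev_get => //; lia.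
      by rewrite -H8; apply: ev_get => //; lia.
    eapply run_put; [exact: e2|by []|exact: ea|exact: ix_le|reflexivity|].
    split=> //; split=> //.
    + by split; [apply: tabled_mem|rewrite mulnS; lia].
    + move=> a b an bn; rewrite /= arr_upd //= ix_eq // Hc // /known.
      rewrite (take_nth (0, 0)) // mem_rcons in_cons.
      rewrite (_ : ((a, b) == nth (0, 0) q k) =
        (a == (nth (0, 0) q k).1) && (b == (nth (0, 0) q k).2)); last by [].
      by case: (_ && _); rewrite ?orbT.
    + by move=> x; rewrite /= arr_upd //=; apply: Hx.
    + by move=> k' kq'; rewrite /= !arr_upd //=; apply: Hq.
  apply: wp_conseq (wp_run body) _ => t' s2 [ht' [er [[T2 ht2] Hc2 [p3 p11 p12 p14] Hx2 Hq2]]].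
  split; first by rewrite er.
  split=> //; split; first exact: tabled_reg.
  by move: ht; rewrite mulnS [expr_cost _]/= /ccommit; move: ht'; move: (ccost _) => u; lia.
- have [H1 H2] := cf_mem cf; split=> //.
  + by split; [apply: tabled_reg => //; apply: cf_tab cf|rewrite muln0].
  + by move=> a b an bn; rewrite take0 /known orbF; apply: cf_chosen cf _ _ an bn.
  + by split=> //; rewrite /= /upd /=; [apply: cf_r cf|apply: cf_size cf].
  + exact: cf_max cf.
- move=> t s' [t0 -> [[[T ht] Hc [e3 e11 _ _] Hx _] _]]; rewrite take_size in Hc.
  by split=> //; rewrite [expr_cost _]/=; lia.
Qed.

Lemma closed_ext (S S' : nat * nat -> Prop) : (forall u, S u <-> S' u) -> closed lab S -> closed lab S'.
Proof.
move=> SS cS; split.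
- by move=> u /SS Su /SS; apply: (cl_cons cS Su).
- by move=> u v /SS Su uv; apply/SS; apply: (cl_step cS Su).
- by move=> a b c M /SS Sab /SS Sbc; apply/SS; apply: (cl_nae cS M Sab Sbc).
Qed.

(** * Orienting all edges *)

Definition corient := ccost fetch_edge + ccost start_race + crace + ccommit + 100.

(** Paid at most once, since a lost race raises the flag in register 11 and all later edges are
    skipped. It dominates [ri_max] because [n <= m * n] as soon as there is an edge. *)
Definition fail_cost := 6 * (m * n) + 4.

(** [Q] collects the committed arcs, and each is charged [4 n]. The arcs are distinct, so there are
    at most [2 m] of them and the races won cost [O(nm)] altogether. *)
Record orienting_by i t s (Q : seq (nat * nat)) (f : bool) := Orienting {
  or_tab : tabled s; or_fail : regs s 11 = f;
  or_stamp : forall x, arr (memory s) 6 x <= i;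
  or_chosen : chosen (fun a b => (a, b) \in Q) (memory s);
  or_uniq : uniq Q; or_edge : forall u, u \in Q -> E u.1 u.2;
  or_no : f -> forall O, ~ tto lab O;
  or_closed : ~~ f -> closed lab (fun u => (u.1, u.2) \in Q);
  or_done : ~~ f -> forall j, j < i -> let u := nth (0, 0) es j in
     (u \in Q) || ((u.2, u.1) \in Q);
  or_time : t <= corient * (i + 4 * (n * size Q) + f * fail_cost) }.

Definition orienting i t s := exists Q f, orienting_by i t s Q f.

Lemma run_fetch_edge s i : tabled s -> i < m -> regs s 3 = i ->
  run W fetch_edge s (fun s' => s' =
    set_reg (set_reg s 6 (nth (0, 0) es i).1) 7 (nth (0, 0) es i).2).
Proof.
move=> T im r3; have [e0 e1 e2] := tabled_regs T.
have [[_ Ga] _] := T; have [|a1 a2] := Ga (2 * i); first by lia.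
rewrite arc2 in a1 a2.
have e2i s' : regs s' 3 = i -> eval W s' (mulE (Cst 2) (Reg 3)) = Some (2 * i).
  by move=> e; apply: ev_mul => //; [exact: ev_regE|lia].
rewrite /fetch_edge !block_cons block_nil.
apply: run_seq; apply: (run_assign (v := (nth (0, 0) es i).1)).
  by rewrite -a1; apply: ev_get => //; [exact: e2i|lia].
apply: run_seq; apply: (run_assign (v := (nth (0, 0) es i).2)).
  by rewrite -a2; apply: ev_get => //; [exact: e2i|lia].
exact: run_skip.
Qed.

(** The final position is [size q * n + w] with [w < n]; the queue contains at least the starting
    arc, so doubling the bound absorbs the partial row and the constant. *)
Lemma race_success_time sg u it r q h w d q' h' w' d' :
  race_inv sg u it r q h w d q' h' w' d' -> ~~ d -> size q <= h ->
  it <= 4 * (n * size q).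
Proof.
move=> [r2 Ir _ Hit _ _] nd hq; have [[_ xq _] hq' wn _] := Ir.
have q0 : 0 < size q by case: (q) xq.
have {}hq : h = size q by apply/eqP; rewrite eqn_leq hq hq'.
have := Hit nd; rewrite hq [_ * n]mulnC.
have nq : n <= n * size q by rewrite leq_pmulr.
by lia.
Qed.

Lemma wp_orient_edge i t s : i < m -> regs s 3 = i -> orienting i t s ->
  wp W orient_edge s (fun t' s' => regs s' 3 = i /\
     forall s2, s2 = set_reg s' 3 i.+1 -> orienting i.+1 (t + t' + 20) s2).
Proof.
move=> im r3 [Q [f [T e11 Hx Hc uQ QE Hno Hcl Hd ht]]].
set sg := fun a b => (a, b) \in Q.
apply: wp_seq; apply: wp_conseq (wp_run (run_fetch_edge T im r3)) _ => t1 s1 [ht1 es1].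
have [Eab an bn] := edge_n im.
set a := (nth (0, 0) es i).1 in es1 Eab an *; set b := (nth (0, 0) es i).2 in es1 Eab bn *.
have uE : nth (0, 0) es i = (a, b) by rewrite /a /b -surjective_pairing.
have T1 : tabled s1 by rewrite es1; do 2!apply: tabled_reg => //.
have r6 : regs s1 6 = a by rewrite es1.
have r7 : regs s1 7 = b by rewrite es1.
have r31 : regs s1 3 = i by rewrite es1.
have r11 : regs s1 11 = f by rewrite es1.
have M1 : memory s1 = memory s by rewrite es1.
have Hc1 : chosen sg (memory s1) by rewrite M1.
have Hx1 x : arr (memory s1) 6 x <= i by rewrite M1.
clear es1.
have n0 : 0 < n by apply: leq_ltn_trans an.
have cond : eval W s1 (orE (Reg 11) (orE (chosenE (Reg 6) (Reg 7)) (chosenE (Reg 7) (Reg 6)))) =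
    Some (f || (sg a b || sg b a) : nat).
  apply: ev_or => //; first exact: ev_regE.
  by apply: ev_or => //; apply: ev_chosen => //; exact: ev_regE.
have ecost : expr_cost (orE (Reg 11) (orE (chosenE (Reg 6) (Reg 7)) (chosenE (Reg 7) (Reg 6)))) <= 60.
  by [].
eapply wp_if; [exact: cond|move=> skip|rewrite negb_or negb_or => /and3P [nf nab nba]].
  exists 1, s1; split; first by constructor.
  split=> // s2 ->; exists Q, f; split=> //.
  - by move=> x; apply: leq_trans (Hx1 x) _.
  - move=> nf j; rewrite ltnS leq_eqVlt => /orP [/eqP ->|]; last exact: Hd.
    by move: skip; rewrite (negPf nf) uE.
  - move: ht ht1 ecost; rewrite /corient.
    move: (expr_cost _) (ccost fetch_edge) (ccost start_race) crace ccommit (n * size Q) fail_cost.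
    by move=> u1 u2 u3 u4 u5 u6 u7 h1 h2 h3; lia.
have f0 : f = false by apply: negbTE.
subst f; rewrite mul0n addn0 in ht.
have {}Hcl := Hcl isT; have {}Hd := Hd isT.
apply: wp_seq.
apply: wp_conseq (wp_run (run_start_race T1 an bn im r31 r6 r7 r11 Hc1 Hx1)) _.
move=> t2 s2 [ht2 R2].
have I2 : race_inv sg (a, b) 0 1 [:: (b, a)] 0 0 false [:: (a, b)] 0 0 false.
  split=> //; apply: run_init => //; rewrite ?lab_gt0 //; try exact: lab_xx.
  by rewrite Esym.
apply: wp_seq; apply: wp_conseq (wp_race_loop R2 I2) _ => t3 s3.
move=> [it [r [q [h [w [d [q' [h' [w' [d' [R I ht3 ex]]]]]]]]]]].
have ed : eval W s3 (Reg 16) = Some (d : nat) by apply: ev_regE; apply: cf_dead (rs_conf R).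
have [rlt Ir Ir' _ _ itm] := I.
eapply wp_if; [exact: ed|move=> Hd1|move=> Hd1].
  have Hd2 : d' by move: ex; rewrite Hd1 /= => /orP [].
  exists 2, (set_reg s3 11 1); split; first by constructor.
  split; first by apply: rs_i R.
  move=> s4 ->; exists Q, true; split=> //.
  - by do 2!apply: tabled_reg => //; apply: cf_tab (rs_conf R).
  - exact: cf_max (rs_conf R).
  - exact: cf_chosen (rs_conf R).
  - move=> _ O.
    have [_ _ _] := Ir; rewrite Hd1 => ref1.
    have [_ _ _] := Ir'; rewrite Hd2 => ref2.
    have pab : 0 < lab a b by rewrite lab_gt0.
    have [e|e] : r = 0 \/ r = 1 by lia.
      subst r; exact: (@refuted_both _ _ _ (a, b) _ lab_sym lab_xx lab_bound Hcl pab ref1 ref2).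
    subst r; exact: (@refuted_both _ _ _ (a, b) _ lab_sym lab_xx lab_bound Hcl pab ref2 ref1).
  - have mn : n <= m * n by rewrite leq_pmull //; apply: leq_ltn_trans im.
    have {}itm : it <= fail_cost by rewrite /fail_cost; lia.
    have : crace * (it + 1) <= crace * (fail_cost + 1) by rewrite leq_mul2l leq_add2r itm orbT.
    move: ht ht1 ht2 ht3 ecost; rewrite mul1n /corient [expr_cost (Reg 16)]/=.
    move: (expr_cost _) (ccost fetch_edge) (ccost start_race) crace ccommit (n * size Q) fail_cost.
    move=> u1 u2 u3 u4 u5 u6 u7 h1 h2 h3 h4 h5 h6.
    have p2 := leq0n (u2 * u7); have p3 := leq0n (u3 * u7); have p4 := leq0n (u4 * u7);
  have p5 := leq0n (u5 * u7).
    by lia.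
have {}ex : size q <= h by move: ex; rewrite (negPf Hd1).
have d0 : d = false by apply: negbTE.
subst d; have itq := race_success_time I isT ex.
have [wfq hq _ _] := Ir.
have eh : h = size q by apply/eqP; rewrite eqn_leq ex hq.
have [uq xq Hq] := wfq.
apply: wp_conseq (wp_commit rlt uq (wf_edges wfq) R) _.
move=> t4 s4 [T4 Hc4 [r34 r114] Hx4 ht4]; split=> //.
move=> s5 ->; exists (q ++ Q), false; split=> //.
- by move=> x y xn yn; rewrite (Hc4 _ _ xn yn) /= mem_cat orbC.
- rewrite cat_uniq uq uQ andbT /=; apply/hasPn => u uQ'.
  by apply/negP => /Hq [_ _ + _ _]; rewrite /sg -surjective_pairing uQ'.
- by move=> u; rewrite mem_cat => /orP [/(wf_edges wfq)|/QE].
- move=> _; rewrite eh in Ir.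
  apply: closed_ext (run_closed lab_sym lab_bound Hcl Ir) => u.
  by rewrite mem_cat orbC.
- move=> _ j; rewrite ltnS leq_eqVlt => /orP [/eqP ->|ji] /=; rewrite !mem_cat.
    by rewrite uE; move: xq; rewrite /race_start; case: eqP => _ -> //=; rewrite !orbT.
  by case/orP: (Hd j ji) => ->; rewrite !orbT.
- rewrite mul0n addn0 size_cat [n * (_ + _)]mulnDr.
  have : crace * (it + 1) <= crace * (4 * (n * size q) + 1) by rewrite leq_mul2l leq_add2r itq orbT.
  have q0 : 0 < size q by case: (q) xq.
  have : ccommit * size q <= ccommit * (n * size q) by rewrite leq_mul2l leq_pmull ?orbT.
  move: ht ht1 ht2 ht3 ht4 ecost; rewrite /corient [expr_cost (Reg 16)]/=.
  move: (expr_cost _) (ccost fetch_edge) (ccost start_race) crace ccommit (n * size Q) (n * size q) (size q).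
  move=> u1 u2 u3 u4 u5 u6 u7 u8 h1 h2 h3 h4 h5 h6 h7 h8.
  have p2 := leq0n (u2 * u7); have p3 := leq0n (u3 * u7); have p4 := leq0n (u4 * u7);
  have p5 := leq0n (u5 * u7).
  by lia.
Qed.

Lemma wp_orient s : tabled s -> (forall x, arr (memory s) 6 x = 0) ->
  (forall x, arr (memory s) 5 x = 0) ->
  wp W orient s (fun t s' => exists2 t0, orienting m t0 s' & t = t0 + 8).
Proof.
move=> T Z6 Z5; apply: wp_seq; exists 2, (set_reg s 11 0); split; first by constructor.
have mW : m < W by lia.
apply: wp_conseq (wp_for W_gt0 (J := orienting) mW _ _ _) _.
- by move=> k t s' _ [Q [f [/tabled_regs [_ e _] _ _ _ _ _ _ _ _ _]]] _; apply: ev_regE.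
- move=> k t s' km J r3; apply: wp_conseq (wp_orient_edge km r3 J) _ => t' s2 [e H].
  split=> //; have [Q [f [? ? ? ? ? ? ? ? ? ht]]] := H _ erefl.
  by exists Q, f; split=> //; apply: leq_trans ht; rewrite [expr_cost _]/=; lia.
- by exists [::], false; split=> // x; rewrite Z6.
- by move=> t s' [t0 -> [J _]]; exists t0 => //; rewrite [expr_cost _]/=; lia.
Qed.

(** * Writing the answer *)

Lemma arr_low M a v k i : a < off -> arr (upd M a v) k i = arr M k i.
Proof. by move=> H; rewrite /arr /upd /cell ifF //; apply/eqP; lia. Qed.

(** The output cells [1], ..., [2 m] lie below [off]: they overwrite the input, which is no longer
    read, and spare the arrays. *)
Lemma tabled_low s a v : a < off -> tabled s -> tabled (set_mem s a v).
Proof.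
move=> H [[[e0 e1 e2 G] Ga] T]; split; first split.
- by split=> // x y xn yn; rewrite /= !arr_low //; apply: G.
- by move=> j jm; rewrite /= !arr_low //; apply: Ga.
- by move=> x y z xn yn zn; rewrite /= arr_low //; apply: T.
Qed.

Lemma chosen_low sg M a v : a < off -> chosen sg M -> chosen sg (upd M a v).
Proof. by move=> H Hc x y xn yn; rewrite arr_low // Hc. Qed.

Definition out_arc (sg : nat -> nat -> bool) j :=
  let u := nth (0, 0) es j in if sg u.1 u.2 then u else (u.2, u.1).

Definition written sg k (M : nat -> nat) := forall j, j < k ->
  M (1 + 2 * j) = (out_arc sg j).1 /\ M (2 + 2 * j) = (out_arc sg j).2.

Definition coutput := ccost fetch_edge + expr_cost (chosenE (Reg 6) (Reg 7)) +
  ccost (output_arc (Reg 6) (Reg 7)) + ccost (output_arc (Reg 7) (Reg 6)) + 40.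

Lemma run_output_arc s i x y (ex ey : expr) : i < m -> regs s 3 = i ->
  fetch_free ex -> fetch_free ey -> eval W s ex = Some x -> eval W s ey = Some y ->
  run W (output_arc ex ey) s (fun s' => s' = set_mem (set_mem s (1 + 2 * i) x) (2 + 2 * i) y).
Proof.
move=> im r3 fx fy Hx Hy; rewrite /output_arc !block_cons block_nil.
have ea s' c : regs s' = regs s -> c <= 2 ->
    eval W s' (addE (mulE (Cst 2) (Reg 3)) (Cst c)) = Some (c + 2 * i).
  move=> e c2; rewrite addnC; apply: ev_add => //; last by lia.
  by apply: ev_mul => //; [apply: ev_regE; rewrite e|lia].
apply: run_seq; exists (1 + 2 * i), x; split; [exact: ea|by lia|exact: Hx|].
apply: run_seq; exists (2 + 2 * i), y; split; [exact: ea|by lia| |exact: run_skip].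
by rewrite (@eval_fetch_free _ _ s).
Qed.

Lemma wp_output sg s : tabled s -> chosen sg (memory s) ->
  wp W (For 3 (Reg 1) output_edge) s (fun t s' => written sg m (memory s') /\
    t <= coutput * m + 6).
Proof.
move=> T Hc; have mW : m < W by lia.
pose J k t s' := [/\ tabled s', chosen sg (memory s'), written sg k (memory s') &
  t <= coutput * k].
apply: wp_conseq (wp_for W_gt0 (J := J) mW _ _ _) _.
- by move=> k t s' _ [/tabled_regs [_ e _] _ _ _] _; apply: ev_regE.
- move=> k t s' km [T' Hc' Hw ht] r3.
  apply: wp_seq; apply: wp_conseq (wp_run (run_fetch_edge T' km r3)) _ => t1 s1 [ht1 es1].
  have [Eab an bn] := edge_n km.
  have T1 : tabled s1 by rewrite es1; do 2!apply: tabled_reg => //.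
  have M1 : memory s1 = memory s' by rewrite es1.
  have r6 : regs s1 6 = (nth (0, 0) es k).1 by rewrite es1.
  have r7 : regs s1 7 = (nth (0, 0) es k).2 by rewrite es1.
  have r31 : regs s1 3 = k by rewrite es1.
  have fin x y c c' t2 s2 : ccost c <= c' -> t2 <= ccost c ->
      c' <= ccost (output_arc (Reg 6) (Reg 7)) + ccost (output_arc (Reg 7) (Reg 6)) ->
      out_arc sg k = (x, y) -> s2 = set_mem (set_mem s1 (1 + 2 * k) x) (2 + 2 * k) y ->
      regs s2 3 = k /\ J k.+1 (t + (t1 + (expr_cost (chosenE (Reg 6) (Reg 7)) + t2).+1) +
        (expr_cost (Reg 1) + 7)) (set_reg s2 3 k.+1).
    move=> hc ht2 hc' oe ->; split=> //; split.
    - by apply: tabled_reg => //; do 2!(apply: tabled_low; first by lia).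
    - by do 2!(apply: chosen_low; first by lia); rewrite M1.
    - move=> j; rewrite ltnS leq_eqVlt => /orP [/eqP ->|jk].
        have ne : (1 + 2 * k == 2 + 2 * k) = false by apply/eqP; lia.
        by rewrite oe /= /upd !eqxx ne.
      rewrite /= /upd !ifF; try (by apply/eqP; lia).
      by rewrite M1; apply: Hw.
    - move: ht ht1 ht2 hc hc'; rewrite /coutput [expr_cost (Reg 1)]/=.
      move: (expr_cost _) (ccost fetch_edge) (ccost (output_arc (Reg 6) _)) (ccost (output_arc (Reg 7) _)).
      by move: (ccost c) => u0 u1 u2 u3 u4 h1 h2 h3 h4 h5; rewrite mulnS; lia.
  eapply wp_if.
  + apply: (ev_chosen T1 (_ : chosen sg (memory s1)) (ev_regE r6) (ev_regE r7) an bn).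
    by rewrite M1.
  + move=> C; apply: wp_conseq (wp_run (run_output_arc km r31 _ _ (ev_regE r6) (ev_regE r7))) _ => //.
    move=> t2 s2 [ht2 es2]; apply: (fin _ _ _ _ t2 s2 _ ht2 (leq_addr _ _) _ es2) => //.
    by rewrite /out_arc C -surjective_pairing.
  + move=> /negPf C; apply: wp_conseq (wp_run (run_output_arc km r31 _ _ (ev_regE r7) (ev_regE r6))) _ => //.
    move=> t2 s2 [ht2 es2]; apply: (fin _ _ _ _ t2 s2 _ ht2 (leq_addl _ _) _ es2) => //.
    by rewrite /out_arc C.
- by split=> //; rewrite muln0.
- by move=> t s' [t0 -> [[_ _ Hw ht] _]]; split=> //; rewrite [expr_cost _]/=; lia.
Qed.

Lemma wp_epilogue t0 s Q f : orienting_by m t0 s Q f ->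
  wp W epilogue s (fun t s' => [/\ answers_yes s' = ~~ f,
     ~~ f -> written (fun a b => (a, b) \in Q) m (memory s') & t <= coutput * m + 20]).
Proof.
move=> [T e11 _ Hc _ _ _ _ _ _].
eapply wp_if; [exact: ev_regE e11|move=> F|move=> F].
  rewrite F; exists 3, (set_mem s 0 0); split; first by apply: (@ExecStore W s (Cst 0) (Cst 0) 0 0).
  by split=> //=; lia.
apply: wp_seq; apply: wp_conseq (wp_output T Hc) _ => t s' [Hw ht].
exists 3, (set_mem s' 0 1); split; first by apply: (@ExecStore W s' (Cst 0) (Cst 1) 0 1).
split; [by rewrite F| |by rewrite [expr_cost _]/=; lia].
by move=> _ j jm; have := Hw j jm.
Qed.

(** * The whole program and its running time *)

Definition cprogram := ccost prologue + (ccost load_edge + 20) + (cfill + 20) + corient + coutput + 100.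

Definition program_time := 1 + m + \sum_(i < 2 * m) table_cost i + (m + 8 * (n * m) + fail_cost) + m.

Lemma wp_program s : input_at s ->
  wp W tto_program s (fun t s' => t <= cprogram * program_time /\
    ((answers_yes s' = false /\ forall O, ~ tto lab O) \/
     (answers_yes s' /\ exists sg : nat -> nat -> bool,
        [/\ tto lab (fun u => sg u.1 u.2), written sg m (memory s') &
            forall a b, sg a b -> E a b]))).
Proof.
move=> [in0 in1 ines inz].
have start : run W prologue s (fun s' => memory s' = memory s /\
    [/\ regs s' 0 = n, regs s' 1 = m & regs s' 2 = off]).
  rewrite /prologue !block_cons block_nil.
  apply: run_seq; apply: (run_assign (v := n)); first by rewrite /eval /= in0.
  apply: run_seq; apply: (run_assign (v := m)); first by rewrite /eval /= W_gt0 in1.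
  apply: run_seq; apply: (run_assign (v := off)); last by apply: run_skip.
  by apply: ev_add => //; [apply: ev_mul => //; lia|rewrite /off; lia].
apply: wp_seq; apply: wp_conseq (wp_run start) _ => t1 s1 [ht1 [M1 R1]].
have ines1 : forall i, i < m -> [/\ memory s1 (3 * i + 2) = (nth (0, 0) es i).1,
    memory s1 (3 * i + 3) = (nth (0, 0) es i).2 &
    memory s1 (3 * i + 4) = Lb (nth (0, 0) es i).1 (nth (0, 0) es i).2] by rewrite M1.
have inz1 a : off <= a -> memory s1 a = 0 by rewrite M1; apply: inz.
apply: wp_seq; apply: wp_conseq (wp_load ines1 inz1 R1) _ => t2 s2 [t20 e2 L].
have St := loading_static L; case: L => _ _ _ La L0 ht2.
have T2 : tabling (fun _ _ _ => False) s2.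
  split=> //; last by move=> h i hh; apply: L0; lia.
  by move=> a c b an cn bn; exists false; split=> //; apply: L0.
apply: wp_seq; apply: wp_conseq (wp_fill_table T2) _ => t3 s3 [ht3 [G3 T3 Z3]].
have Z6 x : arr (memory s3) 6 x = 0 by apply: Z3.
have Z5 x : arr (memory s3) 5 x = 0 by apply: Z3.
apply: wp_seq; apply: wp_conseq (wp_orient (conj G3 T3) Z6 Z5) _ => t4 s4 [t40 [Q [f J]] e4].
apply: wp_conseq (wp_epilogue J) _ => t5 s5 [ya yw ht5].
case: J => _ _ _ _ uQ QE no cl dn ht4; split.
  have sQ : 4 * (n * size Q) <= 8 * (n * m).
    by have := uniq_size uQ QE; have := leq0n n; nia.
  have hf : f * fail_cost <= fail_cost by case: (f); rewrite ?mul1n.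
  have ht4' : t40 <= corient * (m + 8 * (n * m) + fail_cost).
    by apply: leq_trans ht4 _; rewrite leq_mul2l; apply/orP; right; lia.
  rewrite /cprogram /program_time {}e2 {}e4; move: ht1 ht2 ht3 ht4' ht5.
  move: (ccost prologue) (ccost load_edge + 20) (cfill + 20) corient coutput.
  move: (\sum_(i < _) _) (m + 8 * (n * m) + fail_cost) => u1 u2 c1 c2 c3 c4 c5 h1 h2 h3 h4 h5.
  apply: (@leq_trans (c1 + c2 * m + c3 * u1 + c4 * u2 + c5 * m + 100)); first by lia.
  have le c y : y <= 1 + m + u1 + u2 + m -> c * y <= c * (1 + m + u1 + u2 + m).
    by move=> yX; rewrite leq_mul2l yX orbT.
  have le1 c : c <= c * (1 + m + u1 + u2 + m) by rewrite leq_pmulr.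
  move: (le c2 m) (le c3 u1) (le c4 u2) (le c5 m) (le1 c1) (le1 100) => {le le1}.
  set X := 1 + m + u1 + u2 + m; move=> l2 l3 l4 l5 l1 l6; rewrite !mulnDl.
  by repeat apply: leq_add => //; [apply: l2|apply: l3|apply: l4|apply: l5]; lia.
move: {ht4} no cl dn ya yw; case: f => no cl dn ya yw; first by left; rewrite ya; split=> //; apply: no.
right; rewrite ya; split=> //; exists (fun a b => (a, b) \in Q); split; last first.
- by move=> a b /QE.
- exact: yw.
apply: closed_tto => //; first exact: lab_sym.
- exact: cl.
- by move=> a b /QE; rewrite lab_gt0.
- have key u : u \in es -> (u \in Q) || ((u.2, u.1) \in Q).
    move=> ues; have := dn isT (index u es); rewrite -size_es index_mem ues nth_index //.
    exact.
  move=> a b; rewrite lab_gt0 => /edge_es /orP [] /key /orP [] /= -> //; by [left|right].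
Qed.

Lemma nmono_sym a c k : nmono a c k = nmono c a k.
Proof.
apply: eq_bigr => b _; rewrite /monob (lab_sym a b) (lab_sym b c) (lab_sym a c).
by congr nat_of_bool; lia.
Qed.

Lemma sum_arcs (f : nat -> nat -> nat) k : k <= m -> (forall a b, f a b = f b a) ->
  \sum_(i < 2 * k) f (arc i).1 (arc i).2 =
  2 * \sum_(j < k) f (nth (0, 0) es j).1 (nth (0, 0) es j).2.
Proof.
move=> + fs; elim: k => [|k IH] km; first by rewrite !big_ord0.
rewrite (_ : 2 * k.+1 = (2 * k).+2); last by lia.
rewrite !big_ord_recr /= IH; last by lia.
by rewrite arc2 arc2S /= (fs _ (nth (0, 0) es k).1); lia.
Qed.

(** A sum of minima is at most the minimum of the sums; the two arcs of an edge lie in the same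
    number of triangles, which gives the factor 2. *)
Lemma sum_table_le : \sum_(i < 2 * m) table_cost i <=
  2 * m * (n + 1) + 2 * minn (n * \sum_(u <- es) nmono u.1 u.2 n) (m ^ 2).
Proof.
rewrite /table_cost big_split /= sum_nat_const card_ord leq_add2l minnMr leq_min.
apply/andP; split.
  apply: (@leq_trans (\sum_(i < 2 * m) nmono (arc i).1 (arc i).2 n * n)).
    by apply: leq_sum => i _; apply: geq_minl.
  rewrite -big_distrl /= (@sum_arcs (fun a c => nmono a c n)) //; last by move=> *; apply: nmono_sym.
  rewrite [\sum_(u <- es) _](big_nth (0, 0)) size_es big_mkord.
  by rewrite -mulnA leq_mul2l [n * _]mulnC leqnn.
apply: (@leq_trans (\sum_(i < 2 * m) m)); first by apply: leq_sum => i _; apply: geq_minr.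
by rewrite sum_nat_const card_ord -mulnA.
Qed.

Lemma program_time_le : 
  program_time <= 30 * (n * m) + 10 * minn (n * \sum_(u <- es) nmono u.1 u.2 n) (m ^ 2) + 10.
Proof.
rewrite /program_time /fail_cost.
(* An edge supplies a vertex, so terms linear in [m] are absorbed by [n * m]. *)
have mn : m <= n * m.
  case: (posnP m) => [->|m0]; first by rewrite muln0.
  have [_ H _] := edge_n m0; by rewrite leq_pmull //; apply: leq_ltn_trans H.
by have := sum_table_le; move: (minn _ _) (\sum_(_ < _) _) => u v; lia.
Qed.
End Machine.

(** * Temporal graphs as functions on natural numbers *)

Section Encoding.
Variables (n : nat) (G : temporal_graph n).

(** The machine handles plain numbers; the default value makes numbers outside the vertex range
    isolated. *)
Definition on_vertices T (d : T) (f : 'I_n -> 'I_n -> T) (a b : nat) : T :=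
  if insub a is Some x then if insub b is Some y then f x y else d else d.

Lemma on_vertices_val T (d : T) f (x y : 'I_n) : on_vertices d f x y = f x y.
Proof. by rewrite /on_vertices !valK. Qed.

Definition nadj := on_vertices false (adj G).
Definition nlabel := on_vertices 0 (label G).

Lemma nadj_val (x y : 'I_n) : nadj x y = adj G x y.
Proof. exact: on_vertices_val. Qed.
Lemma nlabel_val (x y : 'I_n) : nlabel x y = label G x y.
Proof. exact: on_vertices_val. Qed.

Lemma nadjP a b : nadj a b -> exists x y : 'I_n, [/\ a = x, b = y & adj G x y].
Proof.
rewrite /nadj /on_vertices; case: insubP => // x _ <-; case: insubP => // y _ <- xy.
by exists x, y.
Qed.

Lemma nadj_sym a b : nadj a b = nadj b a.
Proof.
by apply/idP/idP => /nadjP [x [y [-> -> xy]]]; rewrite nadj_val adj_sym.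
Qed.

Lemma nlabel_sym a b : nadj a b -> nlabel a b = nlabel b a.
Proof. by move=> /nadjP [x [y [-> -> xy]]]; rewrite !nlabel_val label_sym. Qed.

Lemma nadj_lt a b : nadj a b -> a < n.
Proof. by move=> /nadjP [x [y [-> _ _]]]. Qed.

Lemma nadj_irr a : nadj a a = false.
Proof. by apply/negP => /nadjP [x [y [-> /val_inj -> ]]]; rewrite adj_irr. Qed.

Local Notation l := (lab nadj nlabel).

Lemma lab_val (x y : 'I_n) : l x y = if adj G x y then (label G x y).+1 else 0.
Proof. by rewrite /lab nadj_val nlabel_val. Qed.

Lemma tto_nat (O : rel 'I_n) : is_TTO G O ->
  tto l (fun u => on_vertices false O u.1 u.2).
Proof.
move=> [[Oe Ot] Otr].
have P a b : on_vertices false O a b -> exists x y : 'I_n, [/\ a = x, b = y & O x y].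
  rewrite /on_vertices; case: insubP => // x _ <-; case: insubP => // y _ <- xy.
  by exists x, y.
split=> /=.
- by move=> a b /P [x [y [-> -> /Oe xy]]]; rewrite lab_val xy.
- move=> a b; rewrite /lab; case: ifP => // /nadjP [x [y [-> -> xy]]] _.
  rewrite !on_vertices_val; have := Ot _ _ xy; case: (O x y); first by left.
  by right.
- move=> [a b] /= /P [x [y [-> -> xy]]]; rewrite on_vertices_val => yx.
  by have := Ot _ _ (Oe _ _ xy); rewrite xy yx.
- move=> a b c /P [x [y [-> -> xy]]] /P [y' [z [/val_inj <- -> yz]]].
  rewrite !lab_val (Oe _ _ xy) (Oe _ _ yz) ltnS on_vertices_val => le.
  by have [xz lz] := Otr _ _ _ xy yz le; rewrite (Oe _ _ xz).
Qed.

Lemma nat_tto (sg : nat -> nat -> bool) :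
  tto l (fun u => sg u.1 u.2) -> is_TTO G (fun x y : 'I_n => sg x y).
Proof.
move=> [Te Tt Ta Ttr].
have sgE (x y : 'I_n) : sg x y -> adj G x y.
  by move=> /Te; rewrite lab_val; case: (adj G x y).
split; first split=> // x y xy.
  have := Tt x y; rewrite lab_val xy => /(_ isT) /= H.
  have := Ta (val x, val y); rewrite /rv /=.
  by case: (sg x y) (sg y x) H => [] [] //= [] // _ /(_ isT).
move=> x y z xy yz le; have := Ttr x y z xy yz; rewrite !lab_val (sgE _ _ xy) (sgE _ _ yz).
by rewrite ltnS => /(_ le) [xz]; rewrite (sgE _ _ xz).
Qed.

Variable es : seq ('I_n * 'I_n).
Hypothesis Hes : edge_listing G es.

Lemma listing_size : size es = #|edges G|.
Proof. by rewrite cardE -(perm_size Hes) size_map. Qed.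

Lemma listing_uniq : uniq es.
Proof. by apply: (@map_uniq _ _ (fun p => [set p.1; p.2])); rewrite (perm_uniq Hes) enum_uniq. Qed.

Lemma set2_eq (x y z t : 'I_n) : [set x; y] = [set z; t] ->
  (x = z /\ y = t) \/ (x = t /\ y = z).
Proof.
move=> e; have : x \in [set z; t] by rewrite -e set21.
have : y \in [set z; t] by rewrite -e set22.
have : z \in [set x; y] by rewrite e set21.
have : t \in [set x; y] by rewrite e set22.
rewrite !inE; do 4!(move=> /orP [] /eqP ?).
all: (by left; split; congruence) || (by right; split; congruence).
Qed.

Lemma listing_edge p : p \in es -> adj G p.1 p.2.
Proof.
move=> pe; have : [set p.1; p.2] \in enum (edges G).
  by rewrite -(perm_mem Hes); apply: (map_f (fun p => [set p.1; p.2])).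
rewrite mem_enum => /imsetP [[x y]]; rewrite inE /= => xy /set2_eq [] [-> ->] //.
by rewrite adj_sym.
Qed.

Lemma edge_listed x y : adj G x y -> ((x, y) \in es) || ((y, x) \in es).
Proof.
move=> xy; have : [set x; y] \in enum (edges G).
  by rewrite mem_enum; apply/imsetP; exists (x, y); rewrite ?inE.
rewrite -(perm_mem Hes) => /mapP [[z t] zt /set2_eq [] [-> ->]].
  by rewrite zt.
by rewrite zt orbT.
Qed.

Definition nes := [seq (val p.1, val p.2) | p <- es].

Lemma nes_edge u : u \in nes -> nadj u.1 u.2.
Proof. by move=> /mapP [p /listing_edge pe ->]; rewrite nadj_val. Qed.

Lemma edge_nes a b : nadj a b -> ((a, b) \in nes) || ((b, a) \in nes).
Proof.
move=> /nadjP [x [y [-> -> /edge_listed /orP [] H]]]; apply/orP; [left|right]; apply/mapP.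
  by exists (x, y).
by exists (y, x).
Qed.

Lemma nth_input (s : seq ('I_n * 'I_n)) i (p0 : 'I_n * 'I_n) :
  let f := flatten [seq [:: val p.1; val p.2; label G p.1 p.2] | p <- s] in
  (i < size s -> [/\ nth 0 f (3 * i) = (nth p0 s i).1, nth 0 f (3 * i).+1 = (nth p0 s i).2 &
    nth 0 f (3 * i).+2 = label G (nth p0 s i).1 (nth p0 s i).2]) /\ size f = 3 * size s.
Proof.
elim: s i => [|p s IH] i //=; split; last by rewrite (proj2 (IH 0)); lia.
case: i => [|i] // H; have [] := proj1 (IH i) H.
by rewrite (_ : 3 * i.+1 = (3 * i).+3) //; lia.
Qed.

Lemma initial_input : input_at n (size es) nlabel nes (initial_state G es).
Proof.
split=> //=.
- move=> i im; have p0 : 'I_n * 'I_n by case: (es) im => [//|p s _]; exact: p.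
  have [[//|h1 h2 h3] _] := nth_input es i p0.
  rewrite !(nth_map p0) //= !addn2 /= (_ : 3 * i + 3 = (3 * i).+3) /=; last by lia.
  rewrite (_ : 3 * i + 4 = (3 * i).+4) /=; last by lia.
  by rewrite nlabel_val.
- move=> a ha; apply: nth_default.
  have -> : size (input_word G es) = (3 * size es).+2.
    case: (es) => [//|p s]; have [_ /=] := nth_input (p :: s) 0 p.
    by rewrite /input_word /= => ->.
  by move: ha; lia.
Qed.

Definition gmono (a b c : 'I_n) := [&& adj G a b, adj G b c, adj G a c,
  label G a b == label G b c & label G b c == label G a c].

Lemma gmonoE (a b c : 'I_n) : monob l a b c = gmono a b c.
Proof.
rewrite /monob !lab_val /gmono; case: (adj G a b); case: (adj G b c); case: (adj G a c) => //=.
by rewrite andbF.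
Qed.

Definition mono_triples := [set t : 'I_n * 'I_n * 'I_n | gmono t.1.1 t.1.2 t.2].

(** The triples that span a triangle [T] lie in the cube of [T], which has at most [3^3 = 27]
    elements. *)
Lemma card_mono_triples : #|mono_triples| <= 27 * #|monolabel_triangles G|.
Proof.
pose vs (t : 'I_n * 'I_n * 'I_n) := [set t.1.1; t.1.2; t.2].
rewrite -sum1_card (partition_big vs (fun T => T \in monolabel_triangles G)) /=; last first.
  move=> [[a b] c]; rewrite !inE /= => M.
  by apply/existsP; exists a; apply/existsP; exists b; apply/existsP; exists c; rewrite eqxx.
rewrite mulnC -sum_nat_const; apply: leq_sum => T TT.
have T3 : #|T| <= 3.
  move: TT; rewrite inE => /existsP [a /existsP [b /existsP [c /andP [/eqP -> _]]]].
  rewrite -setUA; apply: leq_trans (leq_card_setU _ _) _; rewrite cards1 cards2; by case: eqP.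
rewrite sum1_card.
apply: (@leq_trans #|setX (setX T T) T|).
  apply: subset_leq_card; apply/subsetP => -[[a b] c]; rewrite !inE /= => /andP [_ /eqP <-].
  by rewrite /vs !inE /= !eqxx !orbT.
by rewrite !cardsX; move: #|T| T3 => [|[|[|[|]]]].
Qed.

(** The listing contains no pair twice, so the sum counts distinct ordered monolabel triples. *)
Lemma sum_nmono : \sum_(u <- nes) nmono nadj nlabel u.1 u.2 n <=
  27 * #|monolabel_triangles G|.
Proof.
apply: leq_trans card_mono_triples; rewrite big_map /=.
have -> : #|mono_triples| = \sum_(p : 'I_n * 'I_n) \sum_(b < n) gmono p.1 b p.2.
  rewrite -sum1_card pair_bigA /= big_mkcond /=.
  rewrite (reindex (fun t : 'I_n * 'I_n * 'I_n => (t.1.1, t.2, t.1.2))) /=; last first.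
    by exists (fun t : 'I_n * 'I_n * 'I_n => (t.1.1, t.2, t.1.2)) => -[[]].
  by apply: eq_bigr => -[[a c] b] _; rewrite inE /=; case: gmono.
rewrite big_uniq ?listing_uniq //= [leqRHS](bigID (fun p => p \in es)) /=.
apply: leq_trans (leq_addr _ _); apply: leq_sum => p _.
by apply: leq_sum => b _; rewrite gmonoE.
Qed.

Lemma output_nat (sg : nat -> nat -> bool) s : tto l (fun u => sg u.1 u.2) ->
  written nes sg (size es) (memory s) ->
  forall x y, output_orientation n (size es) s x y = sg x y.
Proof.
move=> [Te Tt Ta _] Hw x y; apply/existsP/idP.
  move=> [[j jm]] /= /andP [/eqP e1 /eqP e2]; have [w1 w2] := Hw j jm.
  have ue : nth (0, 0) nes j \in nes by rewrite mem_nth ?size_map.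
  move: w1 w2; rewrite e1 e2 /out_arc; case: ifP => [H -> -> //|H -> ->] /=.
  have := Tt (nth (0, 0) nes j).1 (nth (0, 0) nes j).2.
  by rewrite /lab (nes_edge ue) H => /(_ isT) [].
move=> sxy; have exy : nadj x y by have := Te x y sxy; rewrite /lab; case: (nadj x y).
have nyx : sg y x = false by apply/negP => syx; apply: (Ta (val x, val y)).
have idx u : u \in nes -> index u nes < size es by rewrite -index_mem size_map.
case/orP: (edge_nes exy) => H; exists (Ordinal (idx _ H)) => /=;
  have := Hw _ (idx _ H); rewrite /out_arc nth_index //= ?sxy ?nyx => -[-> ->] /=; by rewrite !eqxx.
Qed.
End Encoding.

Theorem theorem3 :
  exists (P : cmd) (w C : nat),
    forall (n : nat) (G : temporal_graph n) (es : seq ('I_n * 'I_n)),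
      edge_listing G es ->
      let m := #|edges G| in
      let k := #|monolabel_triangles G| in
      exists (t : nat) (s : state),
        [/\ exec ((n + m + 2) ^ w) P (initial_state G es) t s,
            t <= C * (n * m + minn (k * n) (m ^ 2) + 1),
            answers_yes s <-> comparability_temporal_graph G
          & answers_yes s -> is_TTO G (output_orientation n m s)].
Proof.
(* With [X = n + m + 2], array indices are at most [X^3], and [64 = 2^6 <= X^6] gives the exponent
   9. The factor 300 covers [10 * 27] from the minimum as well as the smaller constants of
   [program_time_le]. *)
exists tto_program, 9, (cprogram * 300) => n G es Hes m k.
have em : size es = m by apply: listing_size.
have snes : size (nes es) = m by rewrite size_map.
set X := n + m + 2; set P := X ^ 3.
have HP : n * n * n + n * n * 2 + 4 * m + n + 8 <= P.
  by rewrite /P /X !expnS expn0; nia.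
have HW : 64 * P <= X ^ 9.
  rewrite (expnD X 6 3) leq_mul2r; apply/orP; right.
  by rewrite (_ : 64 = 2 ^ 6) // leq_exp2r // /X; lia.
have Hin : input_at n m (nlabel G) (nes es) (initial_state G es).
  by rewrite -em; apply: initial_input.
have [t [s [Hex [ht res]]]] := wp_program HP HW snes (@nadj_sym n G) (@nlabel_sym n G)
  (@nadj_lt n G) (nes_edge Hes) (edge_nes Hes) (@nadj_irr n G) Hin.
exists t, s; split=> //.
- apply: leq_trans ht _; rewrite -mulnA leq_mul2l; apply/orP; right.
  apply: leq_trans (program_time_le HP HW snes (@nadj_sym n G) (@nlabel_sym n G)
    (@nadj_lt n G) (nes_edge Hes)) _.
  have sm := sum_nmono Hes.
  have : minn (n * \sum_(u <- nes es) nmono (nadj G) (nlabel G) u.1 u.2 n) (m ^ 2) <=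
      27 * minn (k * n) (m ^ 2).
    rewrite minnMr leq_min !geq_min; apply/andP; split.
      by rewrite mulnA [27 * k * n]mulnC leq_mul2l sm orbT.
    by rewrite leq_pmull ?orbT.
  by move: (minn _ _) (minn _ _) => u v; lia.
- split.
    case: res => [[-> //]|[_ [sg [T Hw _]]] _].
    by exists (fun x y : 'I_n => sg x y); apply: nat_tto.
  case: res => [[_ no] [O HO]|[-> //]].
  by case: (no _ (tto_nat HO)).
- case: res => [[-> //]|[_ [sg [T Hw _]]] _].
  have eO x y : output_orientation n m s x y = sg x y.
    by rewrite -em; apply: (output_nat Hes T); rewrite em.
  have [[H1 H2] H3] := nat_tto T.
  split; first split.
  + by move=> a b; rewrite eO; apply: H1.
  + by move=> a b ab; rewrite !eO; apply: H2.
  + by move=> a b c; rewrite !eO; apply: H3.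
Qed.
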